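(* The probability that a random (unordered) forest of rooted plane trees having total size $n$ is dissimilar is asymptotic, as $n\to\infty$, to the constant $$\kappa=\frac{e^{L+1/2}}{K}\qquad\text{with}\qquad L:=\sum_{m=2}^\infty\frac{(-1)^{m-1}}{m}\sum_{n\ge1}\left(\frac1n\binom{2n-2}{n-1}4^{-n}\right)^m,$$ where $$K:=\exp\left(\sum_{k=1}^\infty\frac{1}{2k}\left(1-\sqrt{1-4^{1-k}}\right)\right).$$ This probability admits a complete asymptotic expansion with oscillating coefficients.
   Context: Let $\mathcal{T}$ be the class of all rooted plane trees, the size of a tree being its number of nodes; the number of trees of size $n\ge1$ is $T_n=\frac1n\binom{2n-2}{n-1}$. An unordered forest is a multiset of trees in $\mathcal{T}$, and its (total) size is the sum of the sizes of its trees, counted with multiplicity. A forest is dissimilar if all the trees that it contains are of different sizes. A random forest of total size $n$ is chosen uniformly among all unordered forests of total size $n$; thus the probability in question is $E_n/F_n$, where $\sum_{n\ge0}F_nz^n=\prod_{n\ge1}(1-z^n)^{-T_n}$ counts all unordered forests and $\sum_{n\ge0}E_nz^n=\prod_{n\ge1}(1+T_nz^n)$ counts dissimilar forests. A sequence $(f_n)$ is said to admit a full (complete) asymptotic expansion with oscillating coefficients if it is of the form $f_n\sim\sum_{r\ge0}\frac{P_r(n)}{n^{\alpha_r}}$ ($n\to\infty$), where the exponents $\alpha_r$ increase to $+\infty$ and each $P_r(n)$ is a polynomial in $\log n$ whose coefficients are periodic functions of $n$. *)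

(* Defs.v *)
From HB Require Import structures.
From mathcomp Require Import all_boot all_order all_algebra finmap multiset.
From mathcomp Require Import all_classical all_reals all_analysis.
Set Implicit Arguments.
Unset Strict Implicit.
Unset Printing Implicit Defensive.
Import Order.TTheory GRing.Theory Num.Theory.
Import numFieldNormedType.Exports.

Local Open Scope classical_set_scope.
Local Open Scope ring_scope.

(* A rooted plane tree is its root together with the ordered sequence of the
   subtrees hanging from the root. *)
Inductive plane_tree : Type := PNode of seq plane_tree.

Fixpoint tree_size (t : plane_tree) : nat :=
  let: PNode s := t in (sumn (map tree_size s)).+1.

(* The embedding into generic trees only serves to equip plane_tree with the
   choiceType structure required by {mset plane_tree}. *)
Fixpoint gentree_of_plane (t : plane_tree) : GenTree.tree void :=
  let: PNode s := t in GenTree.Node 0 (map gentree_of_plane s).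

Fixpoint plane_of_gentree (g : GenTree.tree void) : plane_tree :=
  if g is GenTree.Node _ s then PNode (map plane_of_gentree s) else PNode [::].

Lemma gentree_of_planeK : cancel gentree_of_plane plane_of_gentree.
Proof.
rewrite /cancel; fix IH 1; case=> s /=; congr PNode.
by elim: s => [//|t s IHs] /=; rewrite IH IHs.
Qed.

HB.instance Definition _ :=
  Countable.copy plane_tree (can_type gentree_of_planeK).

Notation forest := {mset plane_tree}%mset.

(* Iterating over f : forest (through enum_mset) visits each tree as many times
   as its multiplicity. *)
Definition forest_size (f : forest) : nat :=
  (\sum_(t <- enum_mset f) tree_size t)%N.

Definition dissimilar (f : forest) : bool :=
  uniq [seq tree_size t | t <- enum_mset f].

Definition forests (n : nat) : set forest :=
  [set f | forest_size f = n].

Definition dissimilar_forests (n : nat) : set forest :=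
  [set f | forest_size f = n /\ dissimilar f].

(* Both sets are finite, so fset_set (which is a dummy value on infinite sets)
   gives their actual cardinalities. *)
Definition dissimilar_prob (R : realType) (n : nat) : R :=
  #|` fset_set (dissimilar_forests n)|%:R / #|` fset_set (forests n)|%:R.

(* All the series below converge, so that each limit is a genuine sum. *)
Definition constL (R : realType) : R :=
  \big[+%R/(0 : R)]_(2 <= m <oo) ((-1) ^+ (m - 1) / m%:R *
    \big[+%R/(0 : R)]_(1 <= n <oo)
      (n%:R^-1 * 'C(2 * n - 2, n - 1)%:R * 4 ^- n) ^+ m).

(* The exponent 1 - k is an integer (possibly negative) one. *)
Definition constK (R : realType) : R :=
  expR (\big[+%R/(0 : R)]_(1 <= k <oo)
    ((2 * k%:R)^-1 * (1 - Num.sqrt (1 - (4 : R) ^ (1 - k%:Z))))).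

Definition kappa (R : realType) : R := expR (constL R + 2^-1) / constK R.

Definition periodic_coef (R : realType) (c : nat -> R) : Prop :=
  exists2 p : nat, (0 < p)%N & forall n, c (n + p)%N = c n.

Definition oscillating_log_poly (R : realType) (P : nat -> R) : Prop :=
  exists (d : nat) (c : nat -> nat -> R),
    (forall j, periodic_coef (c j)) /\
    forall n, P n = \sum_(j < d.+1) c j n * ln n%:R ^+ j.

(* The expansion is understood in the sense of Poincare: truncated after the
   term of index N, it has remainder o(n^(- alpha_N)). As alpha is strictly
   increasing, requiring this for all N amounts to requiring, for all N, a
   remainder O(n^(- alpha_(N+1)) (log n)^d) where d is the degree of P_(N+1).
   The gauge is n^(- alpha_N), not the N-th term itself, because the P_r may
   vanish or oscillate. *)
Definition full_oscillating_expansion (R : realType) (f : nat -> R) : Prop :=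
  exists (alpha : nat -> R) (P : nat -> nat -> R),
    [/\ {homo alpha : r s / (r < s)%N >-> r < s},
        alpha r @[r --> \oo] --> +oo,
        forall r, oscillating_log_poly (P r)
      & forall N,
          ((fun n : nat => f n - \sum_(r < N.+1) P r n / n%:R `^ alpha r)
             : nat -> R^o)
          =o_\oo ((fun n : nat => n%:R `^ (- alpha N)) : nat -> R^o)].

(* Main.v *)
(* With [t_n = T_n 4^-n], the series [sum t_n z^n] is [(1 - sqrt (1 - z)) / 2],
   and the two counting sequences, multiplied by [4^-n], are the coefficients of
     E = exp (sum_m (-1)^(m-1)/m sum_n t_n^m z^(nm)),
     F = exp (sum_m 1/m sum_n t_n 4^(n(1-m)) z^(nm)).
   The terms [m >= 2] of the exponents have summable coefficients of order
   [n^-3], so that only their value at [z = 1] matters for the leading term: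
   [E_n ~ e^(1/2 + L) t_n] and [F_n ~ K t_n].

   For the full expansion of [E], whose exponent is singular at all roots of
   unity, fix a precision [N] and let [q] be a common multiple of the indices
   [m] that matter.  Up to coefficients [O(n^-N)] the exponent is [P y], where
   [P = sqrt (1 - z^q)] and [y] is a polynomial in [z], [P] and [log (1 - z^q)].
   High powers of [P] have small coefficients, so the exponential is again of
   that shape.  The coefficients of [P^i log^j (1 - z^q)] satisfy first-order
   recurrences in [n], which yield their expansions in powers of [n^(-1/2)] and
   [log n] along each residue class mod [q]; hence no complex analysis is
   needed.  The exponent of [F] is singular at [z = 1] only, so [q = 1] suffices
   there and [1/F_n] expands as well.  Expansions at different precisions agree
   because the scale [n^(-r/2) log^j n] is asymptotically independent along
   every residue class. *)

From HB Require Import structures.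
Require Import Defs.
From mathcomp Require Import all_boot all_order all_algebra finmap multiset.
From mathcomp Require Import all_classical all_reals all_analysis.
From mathcomp Require Import ring lra zify.
Set Implicit Arguments.
Unset Strict Implicit.
Unset Printing Implicit Defensive.
Import Order.TTheory GRing.Theory Num.Theory.
Import numFieldNormedType.Exports.
Local Open Scope classical_set_scope.
Local Open Scope ring_scope.

(** * Formal power series *)

(** Coefficient decay replaces analyticity. Series with coefficients O(n^-N), N >= 2, form an
    algebra stable under [exp], and such a series can be divided by 1 - z^q, up to a polynomial of
    degree less than q, at the price of one power of n.

    The difficulty lies in products of a small remainder with the main part P y, whose coefficients
    are only of order n^(-3/2) up to logarithms: such a product is no smaller than P y. The
    remainder is therefore first divided repeatedly by 1 - z^q = P^2, which leaves an element of the
    algebra generated by P and log, plus a high power of P that makes the product small. This halves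
    the precision, whence the factors 2 N.

    The t_n^m are known only through their expansions in n^(-1/2). Expansions can be turned back
    into elements of the algebra because each n^(-i/2), i >= 3, on each residue class, is the
    leading term of a coefficient sequence without logarithms.

    With q = 1 the same division gives the constants: modulo P^2 = 1 - z, a factor that decays fast
    enough reduces to its value at z = 1. *)

Definition fps (R : Type) : Type := nat -> R.

HB.instance Definition _ (R : Type) := gen_eqMixin (fps R).
HB.instance Definition _ (R : Type) := gen_choiceMixin (fps R).

Section FpsRing.
Context {R : comNzRingType}.
Implicit Types a b : fps R.

Definition fps_zero : fps R := fun _ => 0.
Definition fps_opp a : fps R := fun n => - a n.
Definition fps_add a b : fps R := fun n => a n + b n.
Definition fps_one : fps R := fun n => (n == 0%N)%:R.
Definition fps_mul a b : fps R := fun n => \sum_(k < n.+1) a k * b (n - k)%N.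

Fact fps_addA : associative fps_add.
Proof. by move=> a b c; apply/funext => n; rewrite /fps_add addrA. Qed.
Fact fps_addC : commutative fps_add.
Proof. by move=> a b; apply/funext => n; rewrite /fps_add addrC. Qed.
Fact fps_add0 : left_id fps_zero fps_add.
Proof. by move=> a; apply/funext => n; rewrite /fps_add add0r. Qed.
Fact fps_addN : left_inverse fps_zero fps_opp fps_add.
Proof. by move=> a; apply/funext => n; rewrite /fps_add addNr. Qed.

HB.instance Definition _ :=
  GRing.isZmodule.Build (fps R) fps_addA fps_addC fps_add0 fps_addN.

(** Truncation to polynomials lets convolution inherit commutativity and associativity from
    polynomial multiplication. *)
Fact fps_mul_poly m n a b : (m <= n)%N ->
  fps_mul a b m = (\poly_(i < n.+1) a i * \poly_(i < n.+1) b i)`_m.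
Proof.
move=> le_mn; rewrite coefM; apply: eq_bigr => k _.
by rewrite !coef_poly !ltnS (leq_trans (leq_ord k) le_mn)
  (leq_trans (leq_subr _ _) le_mn).
Qed.

Fact fps_mulC : commutative fps_mul.
Proof.
by move=> a b; apply/funext => n; rewrite !(fps_mul_poly _ _ (leqnn n)) mulrC.
Qed.

Fact fps_mulA : associative fps_mul.
Proof.
move=> a b c; apply/funext => n.
pose t (u : fps R) := \poly_(i < n.+1) u i.
transitivity ((t a * (t b * t c))`_n).
  rewrite coefM; apply: eq_bigr => k _.
  by rewrite coef_poly ltn_ord -fps_mul_poly // leq_subr.
rewrite mulrA coefM; apply: eq_bigr => k _.
by rewrite -fps_mul_poly ?leq_ord // coef_poly ltnS leq_subr.
Qed.

Fact fps_mul1 : left_id fps_one fps_mul.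
Proof.
move=> a; apply/funext => n; rewrite /fps_mul big_ord_recl /= mul1r subn0.
by rewrite big1 ?addr0 // => i _; rewrite mul0r.
Qed.

Fact fps_mulDl : left_distributive fps_mul fps_add.
Proof.
move=> a b c; apply/funext => n; rewrite /fps_mul /fps_add -big_split /=.
by apply: eq_bigr => k _; rewrite mulrDl.
Qed.

Fact fps_one_neq0 : fps_one != 0 :> fps R.
Proof.
apply/eqP => /(congr1 (fun a : fps R => a 0%N)); rewrite /fps_one /=.
by move/eqP; rewrite oner_eq0.
Qed.

HB.instance Definition _ := GRing.Zmodule_isComNzRing.Build (fps R)
  fps_mulA fps_mulC fps_mul1 fps_mulDl fps_one_neq0.

Lemma fps0E n : (0 : fps R) n = 0. Proof. by []. Qed.
Lemma fpsDE a b n : (a + b) n = a n + b n. Proof. by []. Qed.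
Lemma fpsNE a n : (- a) n = - a n. Proof. by []. Qed.
Lemma fpsBE a b n : (a - b) n = a n - b n. Proof. by []. Qed.
Lemma fps1E n : (1 : fps R) n = (n == 0%N)%:R. Proof. by []. Qed.
Lemma fpsME a b n : (a * b) n = \sum_(k < n.+1) a k * b (n - k)%N.
Proof. by []. Qed.

Lemma fps_sumE (I : Type) (r : seq I) (P : pred I) (F : I -> fps R) n :
  (\sum_(i <- r | P i) F i) n = \sum_(i <- r | P i) F i n.
Proof.
by elim/big_rec2 : _ => // i y x _ <-; rewrite fpsDE.
Qed.

Definition fpsC (c : R) : fps R := fun n => if n == 0%N then c else 0.
Definition fpsXn (k : nat) : fps R := fun n => (n == k)%:R.

Lemma fpsCE c n : fpsC c n = if n == 0%N then c else 0. Proof. by []. Qed.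
Lemma fpsXnE k n : fpsXn k n = (n == k)%:R. Proof. by []. Qed.

Lemma fpsCM c a n : (fpsC c * a) n = c * a n.
Proof.
rewrite fpsME big_ord_recl /= subn0 big1 ?addr0 // => i _.
by rewrite /fpsC /= mul0r.
Qed.

Lemma fpsC_is_zmod_morphism : zmod_morphism fpsC.
Proof.
by move=> x y; apply/funext => -[|n]; rewrite fpsBE /fpsC ?eqxx ?subr0.
Qed.

Lemma fpsC_is_monoid_morphism : monoid_morphism fpsC.
Proof.
split; first by apply/funext => -[|n].
by move=> x y; apply/funext => n; rewrite fpsCM /fpsC; case: eqP; rewrite ?mulr0.
Qed.

HB.instance Definition _ := GRing.isZmodMorphism.Build R (fps R) fpsC
  fpsC_is_zmod_morphism.
HB.instance Definition _ := GRing.isMonoidMorphism.Build R (fps R) fpsC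
  fpsC_is_monoid_morphism.

Lemma fpsXnM k a n : (fpsXn k * a) n = if (k <= n)%N then a (n - k)%N else 0.
Proof.
rewrite fpsME; case: leqP => lekn.
  have lt : (k < n.+1)%N by [].
  rewrite (bigD1 (Ordinal lt)) //= /fpsXn eqxx mul1r big1 ?addr0 // => i ne.
  by rewrite (negbTE (ne : (i != k :> nat))) mul0r.
rewrite big1 // => i _; rewrite /fpsXn; case: eqP; rewrite ?mul0r // => e.
by have := ltn_ord i; rewrite ltnS e leqNgt lekn.
Qed.

Lemma fpsXnD j k : fpsXn (j + k) = fpsXn j * fpsXn k.
Proof.
apply/funext => n; rewrite fpsXnM /fpsXn; case: leqP => h.
  by rewrite -{1}(subnKC h) eqn_add2l.
by rewrite ltn_eqF // ltn_addr.
Qed.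

Lemma fpsXn0 : fpsXn 0 = 1. Proof. by []. Qed.

(** The Euler derivation z d/dz, which unlike d/dz does not shift indices. *)
Definition fpsD a : fps R := fun n => n%:R * a n.

Lemma fpsD_E a n : fpsD a n = n%:R * a n. Proof. by []. Qed.

Lemma fpsDD a b : fpsD (a + b) = fpsD a + fpsD b.
Proof. by apply/funext => n; rewrite /fpsD !fpsDE mulrDr. Qed.

Lemma fpsD_M a b : fpsD (a * b) = fpsD a * b + a * fpsD b.
Proof.
apply/funext => n; rewrite /fpsD fpsDE !fpsME mulr_sumr -big_split /=.
apply: eq_bigr => k _.
have -> : n%:R = k%:R + (n - k)%:R :> R by rewrite -natrD subnKC ?leq_ord.
ring.
Qed.

Lemma fpsD_X a j : fpsD (a ^+ j.+1) = j.+1%:R * a ^+ j * fpsD a.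
Proof.
elim: j => [|j IH]; first by rewrite !expr1 expr0 mulr1 mul1r.
rewrite exprS fpsD_M IH (exprS a j) -[j.+2%:R]natr1; ring.
Qed.

Lemma fpsD_C c : fpsD (fpsC c) = 0.
Proof. by apply/funext => -[|n]; rewrite /fpsD /fpsC ?mul0r ?mulr0. Qed.

Lemma fpsD_CM c a : fpsD (fpsC c * a) = fpsC c * fpsD a.
Proof. by rewrite fpsD_M fpsD_C mul0r add0r. Qed.

Lemma fpsD_1 : fpsD 1 = 0.
Proof. by apply/funext => -[|n]; rewrite /fpsD fps1E ?mul0r ?mulr0. Qed.

Lemma fps_mul_ext n a b a' b' :
  (forall k, (k <= n)%N -> a k = a' k) -> (forall k, (k <= n)%N -> b k = b' k) ->
  (a * b) n = (a' * b') n.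
Proof.
move=> ha hb; rewrite !fpsME; apply: eq_bigr => k _.
by rewrite ha ?leq_ord // hb // leq_subr.
Qed.

(** The substitution of z^q for z. *)
Definition fpsub (q : nat) a : fps R :=
  fun n => if (q %| n)%N then a (n %/ q)%N else 0.

Lemma fpsubE q a n : fpsub q a n = if (q %| n)%N then a (n %/ q)%N else 0.
Proof. by []. Qed.

Lemma fpsubD q a b : fpsub q (a + b) = fpsub q a + fpsub q b.
Proof.
by apply/funext => n; rewrite fpsDE /fpsub; case: ifP; rewrite ?addr0 ?fpsDE.
Qed.

Lemma fpsubN q a : fpsub q (- a) = - fpsub q a.
Proof.
by apply/funext => n; rewrite fpsNE /fpsub; case: ifP; rewrite ?oppr0 ?fpsNE.
Qed.

Lemma fpsub1 q : (0 < q)%N -> fpsub q 1 = 1.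
Proof.
move=> q0; apply/funext => n; rewrite /fpsub !fps1E; case: ifP => [/dvdnP[k ->]|].
  by rewrite mulnK // muln_eq0 (gtn_eqF q0) orbF.
by case: n => //; rewrite dvdn0.
Qed.

Lemma sum_multiples q m (F : nat -> R) : (0 < q)%N ->
  \sum_(0 <= k < (m * q).+1) (if (q %| k)%N then F (k %/ q)%N else 0) =
  \sum_(0 <= j < m.+1) F j.
Proof.
move=> q0; elim: m => [|m IH]; first by rewrite mul0n !big_nat1 dvdn0 div0n.
rewrite (big_cat_nat (n := (m * q).+1)) //=; last by rewrite ltnS leq_mul2r leqnSn orbT.
rewrite IH [RHS]big_nat_recr //=; congr (_ + _).
rewrite big_nat_recr /=; last by rewrite mulSn addnC -{1}[(m * q)%N]addn0 ltn_add2l.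
rewrite dvdn_mull // mulnK // big_nat_cond big1 ?add0r // => k.
rewrite andbT => /andP[h1 h2]; case: ifP => // /dvdnP[j ej].
by move: h1 h2; rewrite ej !ltn_mul2r q0 /= => h1; rewrite ltnNge h1.
Qed.

Lemma fpsubM q a b : (0 < q)%N -> fpsub q (a * b) = fpsub q a * fpsub q b.
Proof.
move=> q0; apply/funext => n; rewrite fpsME {1}/fpsub.
case: ifP => [/dvdnP[m ->]|nq]; last first.
  rewrite big1 // => k _; rewrite /fpsub; case: ifP => k1; last by rewrite mul0r.
  case: ifP => k2; last by rewrite mulr0.
  by have := dvdn_add k1 k2; rewrite subnKC ?leq_ord // nq.
rewrite mulnK // fpsME -!(big_mkord xpredT (fun k => _ k * _ (_ - k)%N)).
rewrite -(sum_multiples _ (fun j => a j * b (m - j)%N) q0).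
apply: eq_big_nat => k /andP[_]; rewrite ltnS => lek.
rewrite /fpsub; case: ifP => [/dvdnP[j ej]|]; last by rewrite mul0r.
by rewrite ej -mulnBl dvdn_mull // !mulnK.
Qed.

Lemma fpsubX q a j : (0 < q)%N -> fpsub q (a ^+ j) = fpsub q a ^+ j.
Proof.
by move=> q0; elim: j => [|j IH]; rewrite ?fpsub1 // !exprS fpsubM // IH.
Qed.

Lemma fpsubXn q k : (0 < q)%N -> fpsub q (fpsXn k) = fpsXn (k * q).
Proof.
move=> q0; apply/funext => n; rewrite /fpsub /fpsXn; case: ifP => [/dvdnP[m ->]|].
  by rewrite mulnK // eqn_mul2r (gtn_eqF q0).
by move=> nq; case: eqP => // e; move: nq; rewrite e dvdn_mull.
Qed.

End FpsRing.

(* Unification would otherwise unfold convolutions. *)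
#[global] Opaque fps_add fps_opp fps_mul fps_zero fps_one fpsD fpsub fpsC fpsXn.

(** * Polynomial decay of coefficients *)

Section Norms.
Context {R : realType}.
Implicit Types (a b r X : fps R) (e w : nat -> R).

(** The sequence [e - w] is nondecreasing and [e + w] nonincreasing, so the limit of [e] lies
    between them at every index: convergence and its rate come together. *)
Lemma tail_limit e w : (forall k, `|e k.+1 - e k| <= w k - w k.+1) ->
  (forall k, 0 <= w k) ->
  exists2 c, e @ \oo --> c & forall k, `|e k - c| <= w k.
Proof.
move=> hd w0.
have wni : nonincreasing_seq w.
  by apply/nonincreasing_seqP => k; rewrite -subr_ge0 (le_trans _ (hd k)).
have lo k m : (k <= m)%N -> e k - w k <= e m - w m.
  move=> /subnKC <-; elim: (m - k)%N => [|i IH]; first by rewrite addn0.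
  rewrite addnS (le_trans IH) //.
  by have := hd (k + i)%N; rewrite ler_norml => /andP[h _]; lra.
have hi k m : (k <= m)%N -> e m + w m <= e k + w k.
  move=> /subnKC <-; elim: (m - k)%N => [|i IH]; first by rewrite addn0.
  rewrite addnS (le_trans _ IH) //.
  by have := hd (k + i)%N; rewrite ler_norml => /andP[_ h]; lra.
have cw : cvgn w by apply: nonincreasing_is_cvgn => //; exists 0 => _ [k _ <-].
have cu : cvgn (e \+ w).
  apply: nonincreasing_is_cvgn; first by move=> k m /hi.
  exists (e 0%N - w 0%N) => _ [k _ <-]; have := lo 0%N k (leq0n k); have := w0 k.
  rewrite /=; lra.
have ce : cvgn e.
  have -> : e = (e \+ w) \- w by apply/funext => k /=; rewrite addrK.
  exact: is_cvgB.
exists (limn e) => // k.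
rewrite ler_distlC; apply/andP; split.
  apply: limr_ge => //; exists k => // m /= km.
  by have := lo k m km; have := w0 m; lra.
apply: limr_le => //; exists k => // m /= km.
by have := hi k m km; have := w0 m; lra.
Qed.

Definition fbound (C : R) (N : nat) a :=
  forall n, `|a n| <= C * n.+1%:R ^- N.

Definition fsmall (N : nat) a := exists2 C : R, 0 <= C & fbound C N a.

Lemma natS_gt0 n : 0 < n.+1%:R :> R. Proof. by rewrite ltr0n. Qed.
Lemma natSX_gt0 n N : 0 < n.+1%:R ^+ N :> R. Proof. exact/exprn_gt0/natS_gt0. Qed.
Lemma natSXV_gt0 n N : 0 < n.+1%:R ^- N :> R.
Proof. by rewrite invr_gt0 natSX_gt0. Qed.

Lemma fsmallD N a b : fsmall N a -> fsmall N b -> fsmall N (a + b).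
Proof.
move=> [C C0 ha] [D D0 hb]; exists (C + D) => [|n]; first exact: addr_ge0.
by rewrite fpsDE mulrDl (le_trans (ler_normD _ _)) // lerD.
Qed.

Lemma fsmallN N a : fsmall N a -> fsmall N (- a).
Proof. by move=> [C C0 ha]; exists C => // n; rewrite fpsNE normrN. Qed.

Lemma fsmallCM N c a : fsmall N a -> fsmall N (fpsC c * a).
Proof.
move=> [C C0 ha]; exists (`|c| * C) => [|n]; first exact: mulr_ge0.
by rewrite fpsCM normrM -mulrA ler_wpM2l.
Qed.

Lemma fsmall0 N : fsmall N 0.
Proof. by exists 0 => // n; rewrite fps0E normr0 mul0r. Qed.

Lemma fsmall_sum N (I : Type) (s : seq I) (P : pred I) (F : I -> fps R) :
  (forall i, P i -> fsmall N (F i)) -> fsmall N (\sum_(i <- s | P i) F i).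
Proof.
by move=> h; apply: big_ind; [exact: fsmall0 | exact: fsmallD | ].
Qed.

Lemma fsmall_near N a C n0 :
  (forall n, (n0 <= n)%N -> `|a n| <= C * n.+1%:R ^- N) -> fsmall N a.
Proof.
move=> h.
have T0 k : 0 <= `|a k| * k.+1%:R ^+ N by rewrite mulr_ge0 // ltW // natSX_gt0.
pose S := \sum_(k < n0) `|a k| * k.+1%:R ^+ N.
have S0 : 0 <= S by apply: sumr_ge0 => i _; exact: T0.
exists (`|C| + S) => [|n]; first exact: addr_ge0.
case: (leqP n0 n) => hn.
  rewrite (le_trans (h n hn)) // ler_pM2r ?natSXV_gt0 //.
  by rewrite (le_trans (ler_norm _)) // lerDl.
rewrite ler_pdivlMr ?natSX_gt0 // /S (bigD1 (Ordinal hn)) //= addrCA lerDl.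
by rewrite addr_ge0 // sumr_ge0.
Qed.

Lemma fsmall_finite N a n0 : (forall n, (n0 <= n)%N -> a n = 0) -> fsmall N a.
Proof.
by move=> h; apply: (@fsmall_near _ _ 0 n0) => n /h ->; rewrite normr0 mul0r.
Qed.

Lemma natSXV_le m n M N : (m <= n)%N -> (M <= N)%N ->
  n.+1%:R ^- N <= m.+1%:R ^- M :> R.
Proof.
move=> hm hM; rewrite lef_pV2 ?posrE ?natSX_gt0 //.
apply: (@le_trans _ _ (n.+1%:R ^+ M)).
  by rewrite lerXn2r ?nnegrE // ler_nat.
by rewrite ler_weXn2l // ler1n.
Qed.

Lemma fsmall_le M N a : (M <= N)%N -> fsmall N a -> fsmall M a.
Proof.
move=> le [C C0 h]; exists C => // n; apply: (le_trans (h n)).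
by rewrite ler_wpM2l // natSXV_le.
Qed.

Lemma sum_inv_sqr m : \sum_(k < m) (k.+1%:R ^- 2 : R) <= 2.
Proof.
(* The sharper bound makes the induction telescope. *)
suff h : \sum_(k < m.+1) (k.+1%:R ^- 2 : R) <= 2 - m.+1%:R^-1.
  apply: (@le_trans _ _ (\sum_(k < m.+1) (k.+1%:R ^- 2 : R))).
    by rewrite big_ord_recr /= lerDl ltW // natSXV_gt0.
  by rewrite (le_trans h) // gerBl invr_ge0.
elim: m => [|m IH]; first by rewrite big_ord1 /= expr1n invr1; lra.
rewrite big_ord_recr /= (le_trans (lerD IH (lexx _))) //.
have x0 := natS_gt0 m; set x : R := m.+1%:R in x0 *.
have -> : m.+2%:R = x + 1 :> R by rewrite -natr1.
rewrite -subr_ge0.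
have -> : 2 - (x + 1)^-1 - (2 - x^-1 + (x + 1) ^- 2) = x^-1 * (x + 1) ^- 2.
  by field; rewrite !gt_eqF //; lra.
by rewrite mulr_ge0 // invr_ge0 ?ltW // exprn_gt0 //; lra.
Qed.

Lemma addX_le (x y : R) N : 0 <= x -> 0 <= y ->
  (x + y) ^+ N <= 2 ^+ N * (x ^+ N + y ^+ N).
Proof.
move=> x0 y0; wlog xy : x y x0 y0 / x <= y => [hw|].
  by case: (leP x y) => [|/ltW] h; [|rewrite addrC [x ^+ N + _]addrC]; exact: hw.
apply: (@le_trans _ _ ((2 * y) ^+ N)).
  rewrite lerXn2r ?nnegrE ?addr_ge0 ?mulr_ge0 //; lra.
by rewrite exprMn ler_wpM2l ?exprn_ge0 // lerDr exprn_ge0.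
Qed.

(** With u = k + 1 and v = n - k + 1, the sum u + v = n + 2 is fixed, so 1/(uv) = (1/u + 1/v)/(n +
    2). The N-th power of 1/u + 1/v is at most 2^N (u^-2 + v^-2) as N >= 2, and each of the two
    resulting sums over k is at most 2: this gives the constant 2^(N+2). *)
Lemma fboundM A B N a b : (2 <= N)%N -> 0 <= A -> 0 <= B ->
  fbound A N a -> fbound B N b -> fbound (2 ^+ N.+2 * A * B) N (a * b).
Proof.
move=> N2 A0 B0 ha hb n.
have step (k : 'I_n.+1) : `|a k * b (n - k)%N| <=
    A * B * (2 ^+ N * n.+1%:R ^- N) * (k.+1%:R ^- 2 + (n - k).+1%:R ^- 2).
  rewrite normrM (le_trans (ler_pM _ _ (ha k) (hb _))) //.
  rewrite mulrACA -[_ * B * _ * _]mulrA ler_wpM2l ?mulr_ge0 //.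
  have u0 := natS_gt0 k; have v0 := natS_gt0 (n - k).
  have e : k.+1%:R + (n - k).+1%:R = n.+2%:R :> R.
    by rewrite -natrD addSn addnS subnKC // leq_ord.
  rewrite -invfM -exprMn.
  set u : R := k.+1%:R in u0 e *; set v : R := (n - k).+1%:R in v0 e *.
  have -> : (u * v) ^- N = n.+2%:R ^- N * (u^-1 + v^-1) ^+ N.
    rewrite -e -!exprVn -exprMn; congr (_ ^+ N).
    by field; rewrite !gt_eqF //; lra.
  have iu0 : 0 <= u^-1 by rewrite invr_ge0 ltW.
  have iv0 : 0 <= v^-1 by rewrite invr_ge0 ltW.
  have w0 := natSXV_gt0 n.+1 N.
  apply: le_trans (ler_wpM2l (ltW w0) (addX_le N iu0 iv0)) _.
  rewrite mulrA [2 ^+ N * _]mulrC; apply: ler_pM.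
  - by rewrite mulr_ge0 ?exprn_ge0 // ltW.
  - by rewrite addr_ge0 // exprn_ge0.
  - by rewrite ler_wpM2r ?exprn_ge0 // natSXV_le.
  - by rewrite !exprVn lerD // /u /v natSXV_le.
rewrite fpsME (le_trans (ler_norm_sum _ _ _)) //.
rewrite (le_trans (ler_sum _ (fun k _ => step k))) // -mulr_sumr big_split /=.
have h : \sum_(k < n.+1) ((n - k).+1%:R ^- 2 : R) <= 2.
  rewrite (reindex_inj rev_ord_inj) /=.
  rewrite (eq_bigr (fun k : 'I_n.+1 => k.+1%:R ^- 2 : R)) ?sum_inv_sqr // => k _.
  by rewrite subSS subKn // leq_ord.
have -> : 2 ^+ N.+2 * A * B / n.+1%:R ^+ N =
   A * B * (2 ^+ N / n.+1%:R ^+ N) * (2 + 2) by rewrite !exprS; ring.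
apply: ler_wpM2l; last by rewrite lerD // sum_inv_sqr.
by rewrite !mulr_ge0 ?invr_ge0 ?exprn_ge0.
Qed.

Lemma fsmallM N a b : (2 <= N)%N -> fsmall N a -> fsmall N b -> fsmall N (a * b).
Proof.
move=> N2 [A A0 ha] [B B0 hb]; exists (2 ^+ N.+2 * A * B).
  by apply: mulr_ge0 => //; apply: mulr_ge0 => //; apply: exprn_ge0.
exact: fboundM.
Qed.

Lemma fsmallC N c : fsmall N (fpsC c).
Proof. by apply: (@fsmall_finite _ _ 1) => -[//|n]; rewrite fpsCE. Qed.

Lemma fsmall1 N : fsmall N 1.
Proof. by apply: (@fsmall_finite _ _ 1) => -[//|n]; rewrite fps1E. Qed.

Lemma fsmallXn N k : fsmall N (fpsXn k).
Proof.
by apply: (@fsmall_finite _ _ k.+1) => n h; rewrite fpsXnE gtn_eqF.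
Qed.

Lemma fsmallX N a j : (2 <= N)%N -> fsmall N a -> fsmall N (a ^+ j).
Proof.
move=> N2 h; elim: j => [|j IH]; first exact: fsmall1.
by rewrite exprS; apply: fsmallM.
Qed.

(** The discrete form of comparing a sum of inverse powers with an integral. *)
Lemma invX_gap (x y : R) M : 0 < x -> x + 1 <= y ->
  y ^- M.+2 <= x ^- M.+1 - y ^- M.+1.
Proof.
move=> x0 xy; rewrite -!exprVn.
have y0 : 0 < y by lra.
have v0 : 0 < y^-1 by rewrite invr_gt0.
have xy1 : x <= y by lra.
have vu : y^-1 <= x^-1 by rewrite lef_pV2 ?posrE.
have d : y^-1 ^+ 2 <= x^-1 - y^-1.
  rewrite -subr_ge0.
  have -> : x^-1 - y^-1 - y^-1 ^+ 2 = (y * (y - x - 1) + (y - x)) / (x * y ^+ 2).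
    by field; rewrite !gt_eqF.
  apply: divr_ge0; last by rewrite mulr_ge0 ?exprn_ge0 // ltW.
  by apply: addr_ge0; [apply: mulr_ge0|]; lra.
set u := x^-1 in vu d *; set v := y^-1 in v0 vu d *.
apply: (@le_trans _ _ (v ^+ M * (u - v))).
  by rewrite -addn2 exprD ler_wpM2l // exprn_ge0 // ltW.
rewrite !exprSr mulrBr lerD2r ler_wpM2r ?(le_trans _ vu) ?(ltW v0) //.
by rewrite lerXn2r ?nnegrE // ?(le_trans _ vu) ?(ltW v0).
Qed.

Lemma invX_telescope (n q M : nat) : (0 < q)%N -> (0 < M)%N ->
  (n + q).+1%:R ^- M.+1 <= n.+1%:R ^- M - (n + q).+1%:R ^- M :> R.
Proof.
move=> q0; case: M => // M _; apply: invX_gap => //.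
by rewrite natr1 ler_nat ltnS -addn1 leq_add2l.
Qed.

(* Dividing by [1 - z^q] costs one power of [n]: the quotient consists of the
   partial sums of [r] along residue classes mod [q], minus their limits; these
   limits are gathered in [g]. *)
Lemma fsmall_div q N r : (0 < q)%N -> (0 < N)%N -> fsmall N.+1 r ->
  exists g, [/\ forall n, (q <= n)%N -> g n = 0,
    (q = 1)%N -> series r @ \oo --> g 0%N &
    exists2 r', fsmall N r' & r = g + (1 - fpsXn q) * r'].
Proof.
move=> q0 N0 [C C0 hr].
pose s n k := \sum_(j < k.+1) r (n + j * q)%N.
have hs n : exists2 c, s n @ \oo --> c & forall k,
    `|s n k - c| <= C * (n + k * q).+1%:R ^- N.
  apply: tail_limit => k; last by rewrite mulr_ge0 ?invr_ge0 ?exprn_ge0.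
  rewrite /s big_ord_recr /= addrAC subrr add0r -mulrBr (le_trans (hr _)) //.
  by rewrite ler_wpM2l // mulSnr addnA invX_telescope.
pose c n := sval (cid2 (hs n)).
have [cl cb] : (forall n, s n @ \oo --> c n) /\
    forall n k, `|s n k - c n| <= C * (n + k * q).+1%:R ^- N.
  by split=> n; rewrite /c; case: cid2.
pose g : fps R := fun n => if (n < q)%N then c n else 0.
pose r' : fps R := fun n => s (n %% q)%N (n %/ q)%N - c (n %% q)%N.
exists g; split.
- by move=> n; rewrite /g ltnNge => ->.
- move=> q1; rewrite /g q0.
  rewrite -cvg_shiftS; suff <- : s 0%N = [sequence series r n.+1]_n by exact: cl.
  apply/funext => n; rewrite /s /series /= big_mkord; apply: eq_bigr => i _.
  by rewrite add0n q1 muln1.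
exists r'.
  exists C => // n; rewrite /r' (le_trans (cb _ _)) //.
  by rewrite addnC -divn_eq.
apply/funext => n; rewrite fpsDE mulrBl mul1r fpsBE fpsXnM /g /r'.
case: (ltnP n q) => h.
  rewrite subr0 modn_small // divn_small // /s big_ord1 mul0n addn0.
  by rewrite addrC subrK.
set m := (n - q)%N; have -> : n = (m + q)%N by rewrite subnK.
rewrite add0r modnDr divnDr // divnn q0 addn1.
rewrite opprB addrA subrK /s big_ord_recr /= addrAC subrr add0r.
by rewrite mulSnr addnA [(_ %% _ + _)%N]addnC -divn_eq.
Qed.

End Norms.

(** * The exponential of a formal power series *)

Definition pexp {R : realType} (X : fps R) (J : nat) : fps R :=
  \sum_(j < J) fpsC (j`!%:R^-1) * X ^+ j.

(* Locked: conversion on [fps] terms would otherwise unfold limits. *)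
HB.lock Definition fexp {R : realType} (X : fps R) : fps R :=
  fun n => limn (fun J => pexp X J n).

Section FormalExp.
Context {R : realType}.
Implicit Types (a b g X Y : fps R).

Lemma cvgn_sum (I : Type) (s : seq I) (F : I -> nat -> R) (l : I -> R) :
  (forall i, F i @ \oo --> l i) ->
  (fun J => \sum_(i <- s) F i J) @ \oo --> \sum_(i <- s) l i.
Proof.
move=> h; elim: s => [|i s IH].
  rewrite big_nil (_ : (fun _ => _) = cst 0); first exact: cvg_cst.
  by apply/funext => J; rewrite big_nil.
rewrite big_cons (_ : (fun _ => _) = F i \+ (fun J => \sum_(i <- s) F i J)).
  exact: cvgD.
by apply/funext => J; rewrite big_cons.
Qed.

Lemma cvgn_uniq (u : nat -> R) (l1 l2 : R) :
  u @ \oo --> l1 -> u @ \oo --> l2 -> l1 = l2.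
Proof. by move=> /cvg_lim <- // /cvg_lim <-. Qed.

Lemma pexpE X J n : pexp X J n = \sum_(j < J) (X ^+ j) n / j`!%:R.
Proof.
by rewrite /pexp fps_sumE; apply: eq_bigr => j _; rewrite fpsCM mulrC.
Qed.

Lemma pexpS X J n : pexp X J.+1 n = pexp X J n + (X ^+ J) n / J`!%:R.
Proof. by rewrite !pexpE big_ord_recr. Qed.

Definition exp_tail (D : R) J := expR D - series (exp_coeff D) J.

Lemma exp_tail_ge0 D J : 0 <= D -> 0 <= exp_tail D J.
Proof.
move=> D0; rewrite subr_ge0; apply: nondecreasing_cvgn_le.
  apply/nondecreasing_seqP => n; rewrite /series /= big_nat_recr //= lerDl.
  exact: exp_coeff_ge0.
exact: is_cvg_series_exp_coeff.
Qed.

Lemma exp_tailS D J : exp_tail D J - exp_tail D J.+1 = D ^+ J / J`!%:R.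
Proof.
rewrite /exp_tail /series /= big_nat_recr //= /exp_coeff /=.
ring.
Qed.

Lemma exp_tail_cvg D : exp_tail D @ \oo --> 0.
Proof.
rewrite -(subrr (expR D)); apply: cvgB; first exact: cvg_cst.
exact: is_cvg_series_exp_coeff.
Qed.

(** A nonzero constant term is allowed in [X], so each coefficient of the exponential is a true
    limit. The weight [w] is 1 for mere convergence, n^-N for decay of coefficients, and a power of
    y for the Taylor remainder of [expR]. *)
Lemma fexp_tail X n J0 D w : 0 <= D -> 0 <= w ->
  (forall j, (J0 <= j)%N -> `|(X ^+ j) n| <= D ^+ j * w) ->
  (fun J => pexp X J n) @ \oo --> fexp X n /\
  forall J, (J0 <= J)%N -> `|fexp X n - pexp X J n| <= exp_tail D J * w.
Proof.
move=> D0 w0 h.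
have [||c cc cb] := @tail_limit R (fun J => pexp X (J + J0) n)
  (fun J => exp_tail D (J + J0) * w).
- move=> k; rewrite addSn pexpS addrAC subrr add0r -mulrBl exp_tailS.
  rewrite normrM normfV normr_nat mulrAC.
  by rewrite ler_wpM2r ?invr_ge0 // h // leq_addl.
- by move=> k; rewrite mulr_ge0 // exp_tail_ge0.
have c1 : (fun J => pexp X J n) @ \oo --> c by rewrite -(cvg_shiftn J0).
have e : fexp X n = c by rewrite unlock; apply/cvg_lim.
split; first by rewrite e.
by move=> J hJ; rewrite e distrC -(subnK hJ).
Qed.

Lemma fps_pow_le X n j m : (m <= n)%N ->
  `|(X ^+ j) m| <= (\sum_(k < n.+1) `|X k|) ^+ j.
Proof.
elim: j m => [|j IH] m lemn.
  by rewrite !expr0 fps1E; case: (m == 0%N); rewrite ?normr1 ?normr0.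
rewrite !exprS fpsME (le_trans (ler_norm_sum _ _ _)) // mulr_suml.
apply: (@le_trans _ _ (\sum_(k < m.+1) `|X k| * (\sum_(k < n.+1) `|X k|) ^+ j)).
  apply: ler_sum => k _; rewrite normrM ler_wpM2l // IH //.
  exact: leq_trans (leq_subr _ _) lemn.
rewrite -!mulr_suml ler_wpM2r ?exprn_ge0 ?sumr_ge0 //.
by rewrite -!(big_mkord xpredT (fun k => `|X k|)) (big_cat_nat (n := m.+1) (p := n.+1)) //=
  lerDl sumr_ge0.
Qed.

Lemma fexp_cvg X n : (fun J => pexp X J n) @ \oo --> fexp X n.
Proof.
have [|//||//] := @fexp_tail X n 0 (\sum_(k < n.+1) `|X k|) 1.
- exact: sumr_ge0.
- by move=> j _; rewrite mulr1 fps_pow_le.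
Qed.

Lemma fexp_0 X : fexp X 0%N = expR (X 0%N).
Proof.
apply: (cvgn_uniq (@fexp_cvg X 0%N)).
rewrite (_ : (fun J => _) = series (exp_coeff (X 0%N))).
  exact: is_cvg_series_exp_coeff.
apply/funext => J; rewrite pexpE /series /= big_mkord; apply: eq_bigr => j _.
rewrite /exp_coeff /=; congr (_ / _).
elim: (j : nat) => [|i IH]; first by rewrite !expr0.
by rewrite !exprS fpsME big_ord1 IH.
Qed.

Lemma fpsD_exp X : fpsD (fexp X) = fpsD X * fexp X.
Proof.
(* The derivative of the truncation of order J + 1 is [fpsD X] times the truncation of order J, so
   both sides are limits of one sequence. *)
apply/funext => n; apply: (@cvgn_uniq (fun J => n%:R * pexp X J.+1 n)).
  apply: cvgM; first exact: cvg_cst.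
  by rewrite (cvg_shiftS (fun J => pexp X J n)); exact: fexp_cvg.
rewrite fpsME -(big_mkord xpredT (fun k => fpsD X k * fexp X (n - k)%N)).
rewrite (_ : (fun J => _) = fun J =>
    \sum_(0 <= k < n.+1) fpsD X k * pexp X J (n - k)%N).
  by apply: cvgn_sum => k; apply: cvgM; [exact: cvg_cst | exact: fexp_cvg].
apply/funext => J; rewrite big_mkord -fpsME.
rewrite /pexp mulr_sumr [in RHS]fps_sumE [in LHS]big_ord_recl expr0 mulr1.
rewrite [in LHS]fpsDE mulrDr.
rewrite (_ : n%:R * fpsC _ n = 0) ?add0r; last first.
  by have := congr1 (@^~ n) (fpsD_C (0`!%:R^-1 : R)).
rewrite [in LHS]fps_sumE mulr_sumr; apply: eq_bigr => j _.
rewrite -[LHS]/(fpsD (fpsC (j.+1`!%:R^-1) * X ^+ j.+1) n) fpsD_CM fpsD_X.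
have -> : fpsC (j.+1`!%:R^-1) * (j.+1%:R * X ^+ j * fpsD X) =
    fpsD X * (fpsC (j`!%:R^-1 : R) * X ^+ j).
  have -> : j`!%:R^-1 = j.+1`!%:R^-1 * j.+1%:R :> R.
    by rewrite factS natrM invfM mulrAC mulVf ?mul1r // pnatr_eq0.
  rewrite rmorphM /= (rmorph_nat fpsC).
  by move: (fpsC _) (X ^+ j) (fpsD X) => u v w; ring.
by [].
Qed.

(** The equation reads n a_n = sum_k k g_k a_(n-k), whose term k = 0 vanishes: it determines a_n
    from the earlier coefficients. Identities between exponentials are all reduced to this. *)
Lemma fexp_unique g a b : a 0%N = b 0%N ->
  fpsD a = fpsD g * a -> fpsD b = fpsD g * b -> a = b.
Proof.
move=> h0 ha hb; apply/funext => n.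
elim/ltn_ind: n => -[//|n] IH.
have n0 : n.+1%:R != 0 :> R by rewrite pnatr_eq0.
apply: (mulfI n0).
move: (congr1 (@^~ n.+1) ha) (congr1 (@^~ n.+1) hb); rewrite [LHS]fpsD_E [fpsD b n.+1]fpsD_E => -> ->.
rewrite !fpsME; apply: eq_bigr => -[[|k] hk] _ /=; first by rewrite !fpsD_E !mul0r.
by rewrite IH // subSS ltnS leq_subr.
Qed.

Lemma fexpD X Y : fexp (X + Y) = fexp X * fexp Y.
Proof.
apply: (@fexp_unique (X + Y)).
- by rewrite fexp_0 fpsME big_ord1 /= !fexp_0 expRD.
- exact: fpsD_exp.
- rewrite fpsDD fpsD_M (fpsD_exp X) (fpsD_exp Y).
  by move: (fpsD X) (fpsD Y) (fexp X) (fexp Y) => x y u v; ring.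
Qed.

Lemma fexp0 : fexp (0 : fps R) = 1.
Proof.
apply: (@fexp_unique 0); rewrite ?fexp_0 ?expR0 // ?fpsD_exp //.
by rewrite fpsD_1 mulr1; apply/funext => n; rewrite fpsD_E mulr0.
Qed.

Lemma fexp_C (c : R) : fexp (fpsC c) = fpsC (expR c).
Proof.
apply: (@fexp_unique (fpsC c)); rewrite ?fexp_0 ?fpsD_exp //.
by rewrite !fpsD_C mul0r.
Qed.

Lemma fexp_ext n X Y : (forall k, (k <= n)%N -> X k = Y k) ->
  fexp X n = fexp Y n.
Proof.
move=> h; rewrite unlock; congr (limn _); apply/funext => J.
rewrite !pexpE; apply: eq_bigr => j _; congr (_ / _).
suff: forall k, (k <= n)%N -> (X ^+ j) k = (Y ^+ j) k by apply.
elim: (j : nat) => [|i IH] k hk //; rewrite !exprS.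
by apply: fps_mul_ext => l hl; [apply: h | apply: IH]; apply: leq_trans hl hk.
Qed.

(** The series log (1 + c z^k). At n = 0 the convention 0^-1 = 0 gives the right constant term. *)
Definition flog_term (c : R) (k : nat) : fps R := fun n =>
  if (k %| n)%N then (-1) ^+ (n %/ k).-1 * c ^+ (n %/ k) / (n %/ k)%:R else 0.

Lemma fexp_log_term c k : (0 < k)%N ->
  fexp (flog_term c k) = 1 + fpsC c * fpsXn k.
Proof.
move=> k0; set m := 1 + _.
have D0 : fpsD m = fpsC (c *+ k) * fpsXn k.
  rewrite /m fpsDD fpsD_1 add0r fpsD_CM.
  by apply/funext => n; rewrite !fpsCM fpsD_E fpsXnE; case: eqP => [->|];
    rewrite ?mulr0 // !mulr1 mulr_natr.
apply: (@fexp_unique (flog_term c k)).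
- rewrite fexp_0 /flog_term dvdn0 div0n invr0 mulr0 expR0 /m fpsDE fpsCM.
  by rewrite fpsXnE (ltn_eqF k0) mulr0 addr0.
- exact: fpsD_exp.
rewrite D0 /m; clear m D0; have -> (u : fps R) :
    u * (1 + fpsC c * fpsXn k) = u + fpsC c * (fpsXn k * u) by ring.
apply/funext => n; rewrite fpsDE !fpsCM fpsXnM fpsXnE !fpsD_E /flog_term.
case: (ltnP n k) => h.
  rewrite (ltn_eqF h) !mulr0 addr0; case: ifP; rewrite ?mulr0 //.
  case: n h => [|n] h; first by rewrite mul0r.
  by move=> /(dvdn_leq (ltn0Sn _)); rewrite leqNgt h.
set j := (n - k)%N; have -> : n = (j + k)%N by rewrite subnK.
have -> : (j + k == k)%N = (j == 0)%N by rewrite -[in RHS](eqn_add2r k).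
rewrite dvdn_addl //.
case: ifP => [/dvdnP[i ->]|nd]; last first.
  by rewrite !mulr0 addr0; case: eqP nd => [->|]; rewrite ?dvdn0 ?mulr0.
rewrite -mulSnr !mulnK // muln_eq0 (gtn_eqF k0) orbF.
case: i => [|i] /=.
  by rewrite !mul0n !mul0r mulr0 addr0 mul1n expr0 expr1 mul1r divr1 mulr_natl mulr1.
rewrite mulr0 !natrM !exprS; field.
by rewrite nat1r -natrD !pnatr_eq0.
Qed.

(** Although [X] itself may be large, smallness of the powers from J to 2J - 1 propagates through
    X^j = X^J X^(j-J), each factor X^J costing a constant. *)
Lemma fpow_bound N J X : (2 <= N)%N -> (0 < J)%N ->
  (forall j, (J <= j < J + J)%N -> fsmall N (X ^+ j)) ->
  exists2 D : R, 0 <= D & forall j, (J <= j)%N -> fbound (D ^+ j) N (X ^+ j).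
Proof.
move=> N2 J0 h.
have [B B1 hB] : exists2 B : R, 1 <= B & forall j, (J <= j < J + J)%N -> fbound B N (X ^+ j).
  have : forall m, exists2 B : R, 1 <= B &
      forall j, (J <= j < J + m)%N -> fbound B N (X ^+ j) \/ (J + J <= j)%N.
    elim=> [|m [B B1 hB]]; first by exists 1 => // j; rewrite addn0 ltnNge => /andP[->].
    case: (ltnP (J + m) (J + J)) => hm; last first.
      exists B => // j /andP[h1]; rewrite addnS ltnS leq_eqVlt => /orP[/eqP->|h2].
        by right.
      by apply: hB; rewrite h1.
    have [|C C0 hC] := h (J + m)%N; first by rewrite leq_addr.
    exists (B + C) => [|j /andP[h1]]; first by lra.
    have le1 : B <= B + C by lra.
    have le2 : C <= B + C by lra.
    rewrite addnS ltnS leq_eqVlt => /orP[/eqP->|h2].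
      by left=> n; rewrite (le_trans (hC n)) // ler_wpM2r ?invr_ge0 ?exprn_ge0.
    have [|hb|] := hB j; [by rewrite h1| |by right].
    by left=> n; rewrite (le_trans (hb n)) // ler_wpM2r ?invr_ge0 ?exprn_ge0.
  move=> /(_ J)[B B1 hB]; exists B => // j hj.
  by have [//|] := hB j hj; move: hj => /andP[_]; rewrite ltnNge => /negbTE ->.
pose K : R := 2 ^+ N.+2; have K1 : 1 <= K by rewrite exprn_ege1 // ler1n.
have B0 : 0 <= B by lra.
have KB1 : 1 <= K * B by rewrite mulr_ege1.
exists (K * B); first by lra.
move=> j; elim/ltn_ind: j => j IH hj.
case: (ltnP j (J + J)) => hj2.
  move=> n; rewrite (le_trans (hB j _ n)) ?hj ?hj2 //.
  rewrite ler_wpM2r ?invr_ge0 ?exprn_ge0 //.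
  apply: (@le_trans _ _ (K * B)); first by rewrite ler_peMl.
  by rewrite ler_eXnr // (leq_trans J0).
have hjJ : (J <= j - J)%N by rewrite leq_subRL.
have hlt : (j - J < j)%N by rewrite ltn_subrL J0 (leq_trans J0).
have bJ := hB J; have bj := IH _ hlt hjJ.
rewrite -{2}(subnKC hj) exprD => n.
have KB0 : 0 <= (K * B) ^+ (j - J) by rewrite exprn_ge0 //; lra.
have := fboundM N2 B0 KB0 (bJ _) bj; rewrite leqnn -{1}[J]addn0 ltn_add2l J0.
move=> /(_ isT n) hh; apply: (le_trans hh).
rewrite ler_wpM2r ?invr_ge0 ?exprn_ge0 // -[X in _ <= _ ^+ X](subnKC hj) exprD.
rewrite -/K ler_wpM2r // ler_eXnr //.
Qed.

(** The truncation error has order N with a constant tending to 0; this uniformity later allows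
    limits to be exchanged with [eps]. *)
Lemma fexp_small N J X : (2 <= N)%N -> (0 < J)%N ->
  (forall j, (J <= j < J + J)%N -> fsmall N (X ^+ j)) ->
  exists2 C : nat -> R, C @ \oo --> 0 & forall I, (J <= I)%N ->
    0 <= C I /\ fbound (C I) N (fexp X - pexp X I).
Proof.
move=> N2 J0 h; have [D D0 hD] := fpow_bound N2 J0 h.
exists (exp_tail D); first exact: exp_tail_cvg.
move=> I hI; split; first exact: exp_tail_ge0.
move=> n; rewrite fpsBE.
have [|//|_ hh] := @fexp_tail X n J D (n.+1%:R ^- N) D0.
- by rewrite invr_ge0 exprn_ge0.
- by move=> j hj; apply: hD.
exact: hh.
Qed.

Lemma fsmall_fexp N X : (2 <= N)%N -> fsmall N X -> fsmall N (fexp X).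
Proof.
move=> N2 h; have [|C _ /(_ 1%N)[//|C0 hC]] := @fexp_small N 1 X N2 isT.
  by move=> j _; apply: fsmallX.
have -> : fexp X = (fexp X - pexp X 1) + pexp X 1 by rewrite subrK.
apply: fsmallD; first by exists (C 1%N).
apply: fsmall_sum => j _; apply: fsmallCM; exact: fsmallX.
Qed.

End FormalExp.

(** * Asymptotic expansions in powers of [n^(-1/2)] and [log n] *)

Section Asymptotics.
Context {R : realType}.
Implicit Types (f g u : nat -> R) (k : bool) (q N : nat).

Definition xs (n : nat) : R := (Num.sqrt n%:R)^-1.

Lemma xs_ge0 n : 0 <= xs n.
Proof. by rewrite invr_ge0 sqrtr_ge0. Qed.

Lemma xs_gt0 n : (0 < n)%N -> 0 < xs n.
Proof. by move=> n0; rewrite invr_gt0 sqrtr_gt0 ltr0n. Qed.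

Lemma xs_sqr n : xs n ^+ 2 = n%:R^-1.
Proof. by rewrite exprVn sqr_sqrtr. Qed.

Lemma xs_le1 n : xs n <= 1.
Proof.
case: n => [|n]; first by rewrite /xs sqrtr0 invr0.
by rewrite invf_le1 ?sqrtr_gt0 ?ltr0n // -[leLHS]sqrtr1 ler_wsqrtr // ler1n.
Qed.

Lemma xsX_ge0 n N : 0 <= xs n ^+ N. Proof. exact/exprn_ge0/xs_ge0. Qed.

Lemma near_gt0 : \forall n \near \oo, (0 < n)%N.
Proof. by exists 1%N. Qed.

Lemma xs_cvg0 : xs @ \oo --> 0.
Proof.
apply/cvgrPdist_le => e e0.
have e2 : 0 < e ^+ 2 by rewrite exprn_gt0.
near=> n; rewrite sub0r normrN ger0_norm ?xs_ge0 //.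
have n0 : (0 < n)%N by near: n; exact: near_gt0.
rewrite -(@ler_pXn2r _ 2) ?nnegrE ?xs_ge0 ?(ltW e0) // xs_sqr.
rewrite invf_ple ?posrE ?ltr0n //; near: n; exact: nbhs_infty_ger.
Unshelve. all: by end_near. Qed.

Lemma near_xs_le e : 0 < e -> \forall n \near \oo, xs n <= e.
Proof.
move=> e0; have /cvgrPdist_le/(_ e e0) := xs_cvg0.
by apply: filterS => n; rewrite sub0r normrN ger0_norm ?xs_ge0.
Qed.

(** The index counts half powers: this is O(n^(-N/2)). *)
Definition bigO N f := exists C : R, \forall n \near \oo, `|f n| <= C * xs n ^+ N.

Lemma bigO_pos N f : bigO N f ->
  exists2 C : R, 0 < C & \forall n \near \oo, `|f n| <= C * xs n ^+ N.
Proof.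
move=> [C h]; exists (`|C| + 1); first by rewrite ltr_wpDl.
apply: filterS h => n h; rewrite (le_trans h) // ler_wpM2r ?xsX_ge0 //.
by rewrite (le_trans (ler_norm C)) // lerDl.
Qed.

Lemma bigO_near N f g : (\forall n \near \oo, f n = g n) -> bigO N f -> bigO N g.
Proof.
by move=> e [C h]; exists C; apply: filterS2 e h => n -> .
Qed.

Lemma bigOD N f g : bigO N f -> bigO N g -> bigO N (fun n => f n + g n).
Proof.
move=> [C hf] [D hg]; exists (C + D); apply: filterS2 hf hg => n hf hg.
by rewrite mulrDl (le_trans (ler_normD _ _)) // lerD.
Qed.

Lemma bigON N f : bigO N f -> bigO N (fun n => - f n).
Proof. by move=> [C h]; exists C; apply: filterS h => n; rewrite normrN. Qed.

Lemma bigOB N f g : bigO N f -> bigO N g -> bigO N (fun n => f n - g n).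
Proof. by move=> hf /bigON; apply: bigOD. Qed.

Lemma bigOM M N f g : bigO M f -> bigO N g -> bigO (M + N) (fun n => f n * g n).
Proof.
move=> [C hf] [D hg]; exists (C * D); apply: filterS2 hf hg => n hf hg.
by rewrite normrM exprD mulrACA ler_pM.
Qed.

Lemma bigO_le M N f : (M <= N)%N -> bigO N f -> bigO M f.
Proof.
move=> le /bigO_pos[C C0 h]; exists C; apply: filterS h => n h.
by rewrite (le_trans h) // ler_pM2l // ler_wiXn2l ?xs_ge0 ?xs_le1.
Qed.

Lemma bigO_xs N : bigO N (fun n => xs n ^+ N).
Proof.
by exists 1; apply: nearW => n; rewrite mul1r ger0_norm ?xsX_ge0.
Qed.

Lemma bigO_cst c : bigO 0 (fun=> c).
Proof. by exists `|c|; apply: nearW => n; rewrite expr0 mulr1. Qed.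

Lemma bigO0 N : bigO N (fun=> 0).
Proof. by exists 0; apply: nearW => n; rewrite mul0r normr0. Qed.

Lemma bigO_sum N (I : Type) (s : seq I) (F : I -> nat -> R) :
  (forall i, bigO N (F i)) -> bigO N (fun n => \sum_(i <- s) F i n).
Proof.
move=> h; elim: s => [|i s IH].
  by apply: bigO_near (bigO0 N); apply: nearW => n; rewrite big_nil.
apply: bigO_near (bigOD (h i) IH); apply: nearW => n; by rewrite big_cons.
Qed.

Lemma bigO_cvg0 f : bigO 1 f -> f @ \oo --> 0.
Proof.
move=> /bigO_pos[C C0 h]; apply/cvgrPdist_le => e e0.
near=> n; rewrite sub0r normrN.
have hn : `|f n| <= C * xs n ^+ 1 by near: n.
rewrite (le_trans hn) // expr1 mulrC -ler_pdivlMr //.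
near: n; apply: near_xs_le; exact: divr_gt0.
Unshelve. all: by end_near. Qed.

Definition lam k (n : nat) : R := if k then ln n%:R else 0.

(** With y = (ln n)/2, the single term y^j / j! of the exponential series is at most e^y =
    n^(1/2). *)
Lemma lam_growth k j : bigO 0 (fun n => xs n * lam k n ^+ j).
Proof.
case: k; last first.
  exists 1; apply: nearW => n; rewrite /lam expr0 mulr1; case: j => [|j].
    by rewrite expr0 mulr1 ger0_norm ?xs_ge0 ?xs_le1.
  by rewrite exprS mul0r mulr0 normr0.
exists (2 ^+ j * j`!%:R); rewrite /lam; near=> n.
have n0 : (0 < n)%N by near: n; exact: near_gt0.
have l0 : 0 <= ln n%:R :> R by apply: ln_ge0; rewrite ler1n.
pose y : R := ln n%:R / 2; have y0 : 0 <= y by rewrite divr_ge0.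
have ey : expR y = Num.sqrt n%:R.
  apply/eqP; rewrite -(eqrXn2 (_ : 0 < 2)%N) ?expR_ge0 ?sqrtr_ge0 //.
  rewrite sqr_sqrtr // -expRM_natl -/y.
  by rewrite mulrC divfK // lnK // posrE ltr0n.
have hy : y ^+ j / j`!%:R <= expR y.
  have := exp_tail_ge0 j.+1 y0; rewrite subr_ge0; apply: le_trans.
  rewrite /series /= big_nat_recr //= lerDr sumr_ge0 // => i _.
  exact: exp_coeff_ge0.
rewrite expr0 mulr1 ger0_norm; last by rewrite mulr_ge0 ?xs_ge0 ?exprn_ge0.
have -> : ln n%:R = 2 * y by rewrite mulrC divfK.
rewrite exprMn mulrCA ler_wpM2l ?exprn_ge0 //.
have f0 : 0 < j`!%:R :> R by rewrite ltr0n fact_gt0.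
rewrite /xs -ey mulrC ler_pdivrMr ?expR_gt0 // mulrC.
by rewrite -ler_pdivrMr.
Unshelve. all: by end_near. Qed.

(* The outer variable stands for [n^(-1/2)], the inner one for [log n], or for
   [0] when [k] is false: log-free expansions are the case [k = false]. *)
Definition ev k (p : {poly {poly R}}) n : R := p.[(xs n)%:P].[lam k n].

Lemma evD k p1 p2 n : ev k (p1 + p2) n = ev k p1 n + ev k p2 n.
Proof. by rewrite /ev !hornerD. Qed.

Lemma evM k p1 p2 n : ev k (p1 * p2) n = ev k p1 n * ev k p2 n.
Proof. by rewrite /ev !hornerM. Qed.

Lemma evB k p1 p2 n : ev k (p1 - p2) n = ev k p1 n - ev k p2 n.
Proof. by rewrite /ev !hornerD !hornerN. Qed.

Lemma evC k c n : ev k c%:P%:P n = c.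
Proof. by rewrite /ev !hornerC. Qed.

Lemma evX k n : ev k 'X n = xs n.
Proof. by rewrite /ev hornerX hornerC. Qed.

Lemma ev_coef k p n :
  ev k p n = \sum_(i < size p) (p`_i).[lam k n] * xs n ^+ i.
Proof.
rewrite /ev (horner_coef p) horner_sum; apply: eq_bigr => i _.
by rewrite hornerM -rmorphXn /= hornerC.
Qed.

Lemma ev_growth k p : bigO 0 (fun n => xs n * ev k p n).
Proof.
have h (c : {poly R}) : bigO 0 (fun n => xs n * c.[lam k n]).
  apply: (@bigO_near _ (fun n => \sum_(j < size c) c`_j * (xs n * lam k n ^+ j))).
    apply: nearW => n; rewrite horner_coef mulr_sumr; apply: eq_bigr => j _.
    by rewrite mulrCA.
  apply: bigO_sum => j; exact: (bigOM (bigO_cst _) (lam_growth k j)).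
apply: (@bigO_near _ (fun n => \sum_(i < size p) (xs n * (p`_i).[lam k n]) * xs n ^+ i)).
  apply: nearW => n; rewrite ev_coef mulr_sumr; apply: eq_bigr => j _.
  by rewrite mulrA.
apply: bigO_sum => i; apply: (@bigO_le _ (0 + i)) => //.
exact: bigOM (h _) (bigO_xs _).
Qed.

Definition periodic (T : Type) q (p : nat -> T) := forall n, p (n + q)%N = p n.

Lemma periodic_mod (T : Type) q (p : nat -> T) n : periodic q p ->
  p n = p (n %% q)%N.
Proof.
move=> h; rewrite {1}(divn_eq n q) addnC; elim: (n %/ q)%N => [|j IH].
  by rewrite mul0n addn0.
by rewrite mulSnr addnA h.
Qed.

Lemma periodicM (T : Type) q m (p : nat -> T) : periodic q p ->
  periodic (m * q) p.
Proof.
move=> h n; elim: m => [|m IH]; first by rewrite mul0n addn0.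
by rewrite mulSnr addnA h.
Qed.

(** Only q values of [p] occur, so the sum over one period dominates. *)
Lemma bigO_periodic N q (T : Type) (p : nat -> T) (F : T -> nat -> R) :
  (0 < q)%N -> periodic q p -> (forall c, bigO N (F c)) ->
  bigO N (fun n => F (p n) n).
Proof.
move=> q0 hp h.
have [C hC] : bigO N (fun n => \sum_(r < q) `|F (p r) n|).
  apply: bigO_sum => r; have [C hC] := h (p r); exists C.
  by apply: filterS hC => n; rewrite normr_id.
exists C; apply: filterS hC => n; apply: le_trans.
apply: (le_trans _ (ler_norm _)); rewrite (periodic_mod n hp).
by rewrite (bigD1 (Ordinal (ltn_pmod n q0))) //= lerDl sumr_ge0.
Qed.

(** The period is a parameter because it may depend on the precision, as it does for
    [distinct_series]; [asym] below asks for one period valid at all precisions. *)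
Definition osc k q N f := exists2 p : nat -> {poly {poly R}},
  periodic q p & bigO N (fun n => f n - ev k (p n) n).

Definition asym k q f := forall N, osc k q N f.

Lemma osc_near k q N f g : (\forall n \near \oo, f n = g n) ->
  osc k q N f -> osc k q N g.
Proof.
move=> e [p hp h]; exists p => //; apply: bigO_near h.
by apply: filterS e => n ->.
Qed.

Lemma osc_le k q M N f : (M <= N)%N -> osc k q N f -> osc k q M f.
Proof. by move=> le [p hp h]; exists p => //; apply: bigO_le h. Qed.

Lemma osc_bigO k q N f g : osc k q N f -> bigO N (fun n => f n - g n) ->
  osc k q N g.
Proof.
move=> [p hp h] hg; exists p => //.
by apply: bigO_near (bigOB h hg); apply: nearW => n; ring.
Qed.

Lemma oscD k q N f g : osc k q N f -> osc k q N g ->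
  osc k q N (fun n => f n + g n).
Proof.
move=> [p hp hf] [p' hp' hg]; exists (fun n => p n + p' n).
  by move=> n; rewrite hp hp'.
apply: bigO_near (bigOD hf hg); apply: nearW => n; rewrite evD; ring.
Qed.

Lemma osc_growth k q N f : (0 < q)%N -> osc k q N f ->
  bigO 0 (fun n => xs n * f n).
Proof.
move=> q0 [p hp h].
have h1 : bigO 0 (fun n => xs n * ev k (p n) n).
  by apply: (@bigO_periodic 0 q _ p (fun c n => xs n * ev k c n)) => // c; exact: ev_growth.
have h2 := bigOM (bigO_xs 1) h.
have h3 := bigOD h1 (bigO_le (leq0n _) h2).
by apply: bigO_near h3; apply: nearW => n; rewrite expr1; ring.
Qed.

(** Each factor may grow like a power of log n, which is only bounded by n^(1/2); hence the loss of
    one half power. *)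
Lemma oscM k q N f g : (0 < q)%N -> osc k q N.+1 f -> osc k q N.+1 g ->
  osc k q N (fun n => f n * g n).
Proof.
move=> q0 hf hg; have gf := osc_growth q0 hf; have gg := osc_growth q0 hg.
case: hf hg => [p hp hf] [p' hp' hg]; exists (fun n => p n * p' n).
  by move=> n; rewrite hp hp'.
have gp : bigO 0 (fun n => xs n * ev k (p n) n).
  by apply: (@bigO_periodic 0 q _ p (fun c n => xs n * ev k c n)) => // c; exact: ev_growth.
have hd N' (a b : nat -> R) : bigO N'.+1 a -> bigO 0 (fun n => xs n * b n) ->
    bigO N' (fun n => a n * b n).
  move=> /bigO_pos[C C0 ha] /bigO_pos[D D0 hb]; exists (C * D); near=> n.
  have n0 : (0 < n)%N by near: n; exact: near_gt0.
  have han : `|a n| <= C * xs n ^+ N'.+1 by near: n.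
  have hbn : `|xs n * b n| <= D * xs n ^+ 0 by near: n.
  rewrite -(ler_pM2r (xs_gt0 n0)).
  have -> : `|a n * b n| * xs n = `|a n| * `|xs n * b n|.
    by rewrite !normrM (ger0_norm (xs_ge0 n)); ring.
  apply: (le_trans (ler_pM _ _ han hbn)) => //.
  by rewrite expr0 mulr1 exprSr !mulrA [C * _ * _ * D]mulrAC [C * _ * D]mulrAC.
have h1 := hd _ _ _ hf gg; have h2 := hd _ _ _ hg gp.
by apply: bigO_near (bigOD h1 h2); apply: nearW => n; rewrite evM; ring.
Unshelve. all: by end_near. Qed.

Lemma osc_cst k q N c : osc k q N (fun=> c).
Proof.
exists (fun=> c%:P%:P) => //; apply: bigO_near (bigO0 N).
by apply: nearW => n; rewrite evC subrr.
Qed.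

Lemma asym_near k q f g : (\forall n \near \oo, f n = g n) ->
  asym k q f -> asym k q g.
Proof. by move=> e h N; apply: osc_near e (h N). Qed.

Lemma asym_bigO k q f : (forall N, bigO N f) -> asym k q f.
Proof.
move=> h N; exists (fun=> 0) => //; apply: bigO_near (h N).
by apply: nearW => n; rewrite /ev !horner0 subr0.
Qed.

Lemma asym_cst k q c : asym k q (fun=> c).
Proof. by move=> N; exact: osc_cst. Qed.

Lemma asym_xs k q : asym k q xs.
Proof.
move=> N; exists (fun=> 'X) => //; apply: bigO_near (bigO0 N).
by apply: nearW => n; rewrite evX subrr.
Qed.

Lemma asym_lam k q : asym k q (lam k).
Proof.
move=> N; exists (fun=> 'X%:P) => //; apply: bigO_near (bigO0 N).
by apply: nearW => n; rewrite /ev hornerC hornerX subrr.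
Qed.

Lemma asym_periodic k q c : periodic q c -> asym k q c.
Proof.
move=> h N; exists (fun n => (c n)%:P%:P) => [n|]; first by rewrite h.
by apply: bigO_near (bigO0 N); apply: nearW => n; rewrite evC subrr.
Qed.

Lemma asymD k q f g : asym k q f -> asym k q g -> asym k q (fun n => f n + g n).
Proof. by move=> hf hg N; apply: oscD. Qed.

Lemma asymM k q f g : (0 < q)%N -> asym k q f -> asym k q g ->
  asym k q (fun n => f n * g n).
Proof. by move=> q0 hf hg N; apply: oscM. Qed.

Lemma asymCM k q c f : (0 < q)%N -> asym k q f -> asym k q (fun n => c * f n).
Proof. by move=> q0; apply: asymM => //; exact: asym_cst. Qed.

Lemma asymN k q f : (0 < q)%N -> asym k q f -> asym k q (fun n => - f n).
Proof.
move=> q0 /(asymCM (-1) q0); apply: asym_near; apply: nearW => n.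
by rewrite mulN1r.
Qed.

Lemma asymB k q f g : (0 < q)%N -> asym k q f -> asym k q g ->
  asym k q (fun n => f n - g n).
Proof. by move=> q0 hf /(asymN q0); apply: asymD. Qed.

Lemma asymX k q f j : (0 < q)%N -> asym k q f -> asym k q (fun n => f n ^+ j).
Proof.
move=> q0 h; elim: j => [|j IH]; first exact: asym_cst.
by apply: asym_near (asymM q0 h IH); apply: nearW => n; rewrite exprS.
Qed.

Lemma asym_sum k q (I : Type) (s : seq I) (F : I -> nat -> R) :
  (forall i, asym k q (F i)) -> asym k q (fun n => \sum_(i <- s) F i n).
Proof.
move=> h; elim: s => [|i s IH].
  by apply: asym_near (asym_cst k q 0); apply: nearW => n; rewrite big_nil.
by apply: asym_near (asymD (h i) IH); apply: nearW => n; rewrite big_cons.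
Qed.

Lemma asym_horner k q (c : {poly R}) u : (0 < q)%N -> asym k q u ->
  asym k q (fun n => c.[u n]).
Proof.
move=> q0 h; apply: (@asym_near _ _ (fun n => \sum_(i < size c) c`_i * u n ^+ i)).
  by apply: nearW => n; rewrite horner_coef.
by apply: asym_sum => i; apply: asymCM => //; apply: asymX.
Qed.

Lemma asym_ev k q (p : {poly {poly R}}) u v : (0 < q)%N -> asym k q u ->
  asym k q v -> asym k q (fun n => p.[(u n)%:P].[v n]).
Proof.
move=> q0 hu hv.
apply: (@asym_near _ _ (fun n => \sum_(i < size p) (p`_i).[v n] * u n ^+ i)).
  apply: nearW => n; rewrite (horner_coef p) horner_sum; apply: eq_bigr => i _.
  by rewrite hornerM -rmorphXn /= hornerC.
apply: asym_sum => i; apply: asymM => //; last exact: asymX.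
exact: asym_horner.
Qed.

Lemma asym_dvd k q m f : (q %| m)%N -> asym k q f -> asym k m f.
Proof.
move=> /dvdnP[j ->] h N; have [p hp hf] := h N.
by exists p => //; exact: periodicM.
Qed.

(** Without logarithms the inner variable is evaluated at 0, so each inner polynomial may be
    replaced by its constant coefficient. *)
Lemma asym_free k q f : asym false q f -> asym k q f.
Proof.
move=> h N; have [p hp hf] := h N.
pose phi : {rmorphism {poly R} -> {poly R}} := polyC \o horner_eval 0.
exists (fun n => map_poly phi (p n)) => [n|]; first by rewrite hp.
apply: bigO_near hf; apply: nearW => n; congr (_ - _); rewrite /ev.
have -> : (xs n)%:P = phi (xs n)%:P by rewrite /phi /= /horner_eval hornerC.
by rewrite horner_map /= /horner_eval !hornerC.
Qed.

Definition taylor0 (h : R -> R) (a : nat -> R) := forall M,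
  exists2 C : R, 0 <= C & exists2 d : R, 0 < d &
  forall y, `|y| <= d -> `|h y - \sum_(i < M) a i * y ^+ i| <= C * `|y| ^+ M.

(** As u = O(n^(-1/4)), a Taylor polynomial with 2N terms leaves an error O(n^(-N/2)). *)
Lemma asym_comp k q h a u : (0 < q)%N -> taylor0 h a -> asym k q u ->
  bigO 1 (fun n => u n ^+ 2) -> asym k q (fun n => h (u n)).
Proof.
move=> q0 th hu u2 N; have [C C0 [d d0 hc]] := th (2 * N)%N.
have hs : asym k q (fun n => \sum_(i < 2 * N) a i * u n ^+ i).
  by apply: asym_sum => i; apply: asymCM => //; apply: asymX.
apply: osc_bigO (hs N) _.
have [D D0 hD] := bigO_pos u2.
exists (C * D ^+ N); near=> n.
have h2 : u n ^+ 2 <= D * xs n.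
  have : `|u n ^+ 2| <= D * xs n ^+ 1 by near: n.
  by rewrite expr1 ger0_norm ?sqr_ge0.
have hd : `|u n| <= d.
  rewrite -(@ler_pXn2r _ 2) ?nnegrE ?(ltW d0) //.
  rewrite real_normK ?num_real // (le_trans h2) // mulrC -ler_pdivlMr //.
  by near: n; apply: near_xs_le; rewrite divr_gt0 // exprn_gt0.
rewrite distrC (le_trans (hc _ hd)) // -mulrA ler_wpM2l //.
rewrite exprM real_normK ?num_real // -exprMn.
by rewrite lerXn2r ?nnegrE ?sqr_ge0 ?mulr_ge0 ?xs_ge0 // ltW.
Unshelve. all: by end_near. Qed.

End Asymptotics.

(** * Taylor expansions of exp, 1/(1 - y) and log *)

Section Taylor.
Context {R : realType}.
Implicit Types (y t : R).

Lemma taylor0_exp : taylor0 (@expR R) (fun j => j`!%:R^-1).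
Proof.
move=> M; exists (exp_tail 1 M); first exact: exp_tail_ge0.
exists 1 => // y y1.
have [||j hj|_ /(_ M (leqnn M))] := @fexp_tail R (fpsC y) 0 M 1 (`|y| ^+ M).
- exact: ler01.
- exact: exprn_ge0.
- rewrite -rmorphXn /= fpsCE expr1n mul1r normrX ler_wiXn2l //.
rewrite fexp_0 fpsCE /= pexpE => h; apply: le_trans h.
rewrite (eq_bigr (fun j : 'I_M => (fpsC y ^+ j) 0%N / j`!%:R)) // => j _.
by rewrite -rmorphXn /= fpsCE mulrC.
Qed.

Lemma geometric_sum_norm (M : nat) t : `|t| <= 2^-1 ->
  `|(1 - t)^-1 - \sum_(i < M) t ^+ i| <= 2 * `|t| ^+ M.
Proof.
move=> ht; have h1 : 2^-1 <= 1 - t by have := ler_norm t; lra.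
have n0 : 1 - t != 0 by apply: lt0r_neq0; lra.
have -> : (1 - t)^-1 - \sum_(i < M) t ^+ i = t ^+ M / (1 - t).
  apply: (mulfI n0); rewrite mulrBr mulfV // [in RHS]mulrC divfK //.
  by rewrite -[RHS](subrK 1) subrX1; ring.
rewrite normrM normrX mulrC ler_wpM2r ?exprn_ge0 // normfV ger0_norm; last by lra.
by rewrite invf_ple ?posrE //; lra.
Qed.

Lemma taylor0_inv : taylor0 (fun y : R => (1 - y)^-1) (fun=> 1).
Proof.
move=> M; exists 2 => //; exists 2^-1 => // y hy.
rewrite (eq_bigr (fun i : 'I_M => y ^+ i)) ?geometric_sum_norm //.
by move=> i _; rewrite mul1r.
Qed.

(** The mean value theorem is applied to [ln] minus its Taylor polynomial at 1: the derivative of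
    the difference is the remainder of a geometric sum, and the length of the interval provides the
    missing factor y. The term j = 0 is 0 by the convention 0^-1 = 0. *)
Lemma taylor0_ln :
  taylor0 (fun y : R => ln (1 + y)) (fun j => (-1) ^+ j.-1 / j%:R).
Proof.
move=> [|M].
  exists 2 => //; exists 2^-1 => // y hy; rewrite big_ord0 subr0 expr0 mulr1.
  move: hy; rewrite ler_norml => /andP[h1 h2].
  rewrite ler_norml; apply/andP; split; last first.
    by rewrite (le_trans (le_ln1Dx _)) //; lra.
  have z0 : 0 < (1 + y)^-1 by rewrite invr_gt0; lra.
  have := @le_ln1Dx R ((1 + y)^-1 - 1).
  rewrite [X in ln X]addrC subrK.
  have -> : -1 < (1 + y)^-1 - 1 by lra.
  move=> /(_ isT).
  rewrite lnV ?posrE; last by lra.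
  have : (1 + y)^-1 <= 2 by rewrite invf_ple ?posrE //; lra.
  by lra.
pose c : {poly R} := \poly_(j < M.+1) ((-1) ^+ j.-1 / j%:R).
pose qp : {poly R} := c \Po ('X - 1%:P).
pose f : R -> R := @ln R \- horner qp; pose df x := x^-1 - (qp^`()).[x].
have dc t : (c^`()).[t] = \sum_(i < M) (- t) ^+ i.
  have -> : c^`() = \poly_(i < M) (-1) ^+ i.
    apply/polyP => i; rewrite coef_deriv !coef_poly ltnS; case: ifP => _.
      by rewrite -[LHS]mulr_natr divfK // pnatr_eq0.
    by rewrite mul0rn.
  rewrite horner_poly; apply: eq_bigr => i _.
  by rewrite -exprMn mulN1r.
have hq (x : R) : (qp^`()).[x] = \sum_(i < M) (- (x - 1)) ^+ i.
  by rewrite /qp deriv_comp hornerM derivB derivX derivC subr0 hornerC mulr1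
    horner_comp dc !hornerE.
have f1 : f 1 = 0.
  rewrite /f /= ln1 /qp horner_comp !hornerE subrr /c horner_poly.
  rewrite big1 ?oppr0 ?subr0 // => -[[|j] hj] _ /=; first by rewrite invr0 mulr0 mul0r.
  by rewrite exprS mul0r mulr0.
have fd (x : R) : 0 < x -> is_derive x 1 f (df x).
  by move=> x0; apply: is_deriveB; exact: is_derive1_ln.
have bound (x : R) : `|x - 1| <= 2^-1 -> `|df x| <= 2 * `|x - 1| ^+ M.
  move=> hx; rewrite /df hq -(normrN (x - 1)).
  have e : 1 - - (x - 1) = x by ring.
  have := @geometric_sum_norm M (- (x - 1)); rewrite e; apply.
  by rewrite normrN.
exists 2 => //; exists 2^-1 => // y hy.
have fE : f (1 + y) = ln (1 + y) - c.[y].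
  by rewrite /f /= /qp horner_comp !hornerE [1 + y]addrC addrK.
(* An ordered pair covers both [1, 1 + y] and, for negative y, [1 + y, 1]. *)
have main (a b : R) : a <= b -> `|a - 1| <= `|y| -> `|b - 1| <= `|y| -> b - a = `|y| ->
    `|f b - f a| <= 2 * `|y| ^+ M.+1.
  move=> ab ha hb hba.
  have pos (x : R) : a <= x <= b -> 0 < x /\ `|x - 1| <= `|y|.
    move=> /andP[ax xb].
    have : `|x - 1| <= `|y|.
      move: ha hb; rewrite !ler_norml => /andP[h1 h2] /andP[h3 h4]; lra.
    by move=> h; split => //; move: (le_trans h hy); rewrite ler_norml => /andP[h1 h2]; lra.
  have [||x hx ->] := @MVT_segment R f df a b ab.
  - move=> x; rewrite in_itv /= => /andP[h1 h2]; apply: fd.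
    by have [] := pos x; rewrite ?(ltW h1) ?(ltW h2).
  - apply: continuous_in_subspaceT => x; rewrite inE /= in_itv /= => hx.
    have [x0 _] := pos x hx; apply: differentiable_continuous.
    by apply/derivable1_diffP; have := fd x x0 => -[].
  have [x0 xy] := pos x hx.
  rewrite normrM hba normr_id exprSr mulrA ler_wpM2r //.
  apply: (le_trans (bound x (le_trans xy hy))).
  by rewrite ler_pM2l // lerXn2r // nnegrE.
have <- : c.[y] = \sum_(i < M.+1) (-1) ^+ i.-1 / i%:R * y ^+ i.
  by rewrite /c horner_poly.
have e1 : 1 + y - 1 = y by ring.
have e2 : 1 - (1 + y) = - y by ring.
rewrite -fE -[f _]subr0 -f1; case: (leP 0 y) => y0.
  by apply: main; rewrite ?e1 ?subrr ?normr0 ?lerDl // ger0_norm.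
rewrite distrC.
by apply: main; rewrite ?e1 ?e2 ?subrr ?normr0 ?gerDl ?(ltW y0) // ltr0_norm.
Qed.

End Taylor.

Ltac asym_tac :=
  lazymatch goal with
  | |- asym ?k ?q (fun n => @?f n - @?g n) => apply: (@asymB _ k q f g) => //; asym_tac
  | |- asym ?k ?q (fun n => @?f n + @?g n) => apply: (@asymD _ k q f g) => //; asym_tac
  | |- asym ?k ?q (fun n => @?f n * @?g n) => apply: (@asymM _ k q f g) => //; asym_tac
  | |- asym ?k ?q (fun n => @?f n ^+ ?j) => apply: (@asymX _ k q f j) => //; asym_tac
  | |- asym ?k ?q (fun n => ?c) => exact: asym_cst
  | |- asym ?k ?q (@xs _) => exact: asym_xs
  | |- asym ?k ?q (lam ?k) => exact: asym_lam
  | |- _ => assumption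
  end.

(** * Summation of expansions and first-order recurrences *)

Section Summation.
Context {R : realType}.
Implicit Types (f g u c d w : nat -> R) (k : bool) (N : nat).
Notation x := (@xs R).
Notation lam := (@lam R).

Lemma xs2_small (V : nat -> R) e : bigO 0 V -> 0 < e ->
  \forall n \near \oo, `|x n ^+ 2 * V n| <= e.
Proof.
move=> /bigO_pos[C C0 hC] e0; near=> n.
have hV : `|V n| <= C * x n ^+ 0 by near: n.
have hx : x n <= e / C by near: n; apply: near_xs_le; exact: divr_gt0.
rewrite expr0 mulr1 in hV.
rewrite normrM ger0_norm ?xsX_ge0 //.
apply: (@le_trans _ _ (x n * C)); last by rewrite -ler_pdivlMr.
apply: ler_pM => //; first exact: xsX_ge0.
by rewrite expr2 ler_piMl ?xs_ge0 ?xs_le1.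
Unshelve. all: by end_near. Qed.

(** The Taylor remainder at V/n, divided by n^-m, still has an expansion: the next j Taylor terms,
    collected in [T j], describe it up to O(n^-j). *)
Lemma taylor_quotient h a (V : nat -> R) m : taylor0 h a -> asym false 1 V ->
  bigO 0 V ->
  exists H : nat -> R, [/\ asym false 1 H, bigO 0 H &
    \forall n \near \oo, h (x n ^+ 2 * V n) =
      \sum_(i < m) a i * (x n ^+ 2 * V n) ^+ i + (x n ^+ 2) ^+ m * H n].
Proof.
move=> th hV bV.
pose S j n := \sum_(i < j) a i * (x n ^+ 2 * V n) ^+ i.
pose H n := (h (x n ^+ 2 * V n) - S m n) / (x n ^+ 2) ^+ m.
pose T j n := \sum_(i < j) a (m + i)%N * (x n ^+ 2) ^+ i * V n ^+ (m + i).
have x0 n : (0 < n)%N -> x n ^+ 2 != 0.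
  by move=> n0; rewrite expf_neq0 // gt_eqF // xs_gt0.
have ST j n : S (m + j)%N n = S m n + (x n ^+ 2) ^+ m * T j n.
  rewrite /S big_split_ord /=; congr (_ + _); rewrite /T mulr_sumr.
  apply: eq_bigr => i _; rewrite exprMn [(x n ^+ 2) ^+ (m + i)]exprD; ring.
have HT j : bigO (2 * j) (fun n => H n - T j n).
  have [C C0 [e e0 hC]] := th (m + j)%N.
  have [D D0 hD] := bigO_pos bV.
  exists (C * D ^+ (m + j)); near=> n.
  have n0 : (0 < n)%N by near: n; exact: near_gt0.
  have hDn : `|V n| <= D * x n ^+ 0 by near: n.
  rewrite expr0 mulr1 in hDn.
  have hy : `|x n ^+ 2 * V n| <= e by near: n; exact: xs2_small.
  have -> : H n - T j n = (h (x n ^+ 2 * V n) - S (m + j)%N n) / (x n ^+ 2) ^+ m.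
    rewrite ST /H opprD addrA [RHS]mulrBl; congr (_ - _).
    by rewrite mulrAC mulfV ?mul1r // expf_neq0 // x0.
  have xp : 0 < (x n ^+ 2) ^+ m by rewrite !exprn_gt0 // xs_gt0.
  rewrite normrM normfV (gtr0_norm xp) ler_pdivrMr //.
  apply: (le_trans (hC _ hy)); have -> : C * D ^+ (m + j) * x n ^+ (2 * j) * (x n ^+ 2) ^+ m =
    C * (D ^+ (m + j) * (x n ^+ (2 * j) * (x n ^+ 2) ^+ m)) by ring.
  rewrite ler_wpM2l // normrM (ger0_norm (xsX_ge0 n 2)) exprMn mulrC; apply: ler_pM.
  - exact: exprn_ge0.
  - by apply: exprn_ge0; apply: xsX_ge0.
  - by rewrite lerXn2r // nnegrE // ltW.
  - by rewrite -!exprM -exprD -mulnDr addnC.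
have aT j : asym false 1 (T j).
  apply: asym_sum => i; apply: asymM => //; last exact: asymX.
  by apply: asymCM => //; apply: asymX => //; apply: asymX => //; exact: asym_xs.
exists H; split.
- move=> N; apply: osc_bigO (aT N N) _.
  apply: (@bigO_le _ _ (2 * N)); first by rewrite leq_pmull.
  by apply: bigO_near (bigON (HT N)); apply: nearW => n; rewrite opprB.
- by apply: bigO_near (HT 0%N); apply: nearW => n; rewrite /T big_ord0 subr0.
near=> n; have n0 : (0 < n)%N by near: n; exact: near_gt0.
have -> : (x n ^+ 2) ^+ m * H n = h (x n ^+ 2 * V n) - S m n.
  by rewrite mulrC divfK // expf_neq0 // x0.
by rewrite /S addrC subrK.
Unshelve. all: by end_near. Qed.

Lemma ln_xs n : ln (x n) = - (ln n%:R / 2).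
Proof.
case: n => [|n]; first by rewrite /xs sqrtr0 invr0 ln0 // mul0r oppr0.
have p0 : 0 < x n.+1 by apply: xs_gt0.
have : ln (x n.+1 ^+ 2) = - ln n.+1%:R.
  by rewrite xs_sqr lnV // posrE ltr0n.
by rewrite lnXn // mulr2n => h; apply/eqP; rewrite -subr_eq0 -[X in _ == X](mulr0 2^-1);
  apply/eqP; lra.
Qed.

Lemma ln_shift (n : nat) : (0 < n)%N ->
  ln n.+1%:R = ln n%:R + ln (1 + x n ^+ 2 * 1) :> R.
Proof.
move=> n0; have n1 : 0 < n%:R :> R by rewrite ltr0n.
have p : 0 < 1 + x n ^+ 2 * 1 by rewrite ltr_wpDr ?ltr01 // mulr1 xsX_ge0.
rewrite -lnM ?posrE //; congr ln.
by rewrite mulr1 xs_sqr mulrDr mulr1 divff ?gt_eqF // natr1.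
Qed.

Lemma ln_shift_expansion : exists B : nat -> R, [/\ asym false 1 B, bigO 0 B &
  \forall n \near \oo,
    ln (1 + x n ^+ 2 * 1) = x n ^+ 2 + x n ^+ 4 * B n].
Proof.
have [//|B [aB bB hB]] := taylor_quotient 2 (@taylor0_ln R) (asym_cst false 1 1).
  exact: bigO_cst.
exists B; split => //; apply: filterS hB => n ->.
rewrite !big_ord_recl big_ord0 /= expr0 expr1 invr0 invr1; ring.
Qed.

Lemma xs_shift_expansion i : exists2 A : nat -> R, asym false 1 A &
  \forall n \near \oo, x n.+1 ^+ i =
    x n ^+ i * (1 - i%:R / 2 * x n ^+ 2 + x n ^+ 4 * A n).
Proof.
have [B [aB bB hB]] := ln_shift_expansion.
pose V n := - (i%:R / 2) * (1 + x n ^+ 2 * B n).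
have aV : asym false 1 V.
  apply: asymCM => //; apply: asymD; first exact: asym_cst.
  by apply: asymM => //; apply: asymX => //; exact: asym_xs.
have bV : bigO 0 V.
  apply: (bigOM (bigO_cst (- (i%:R / 2)))); apply: bigOD; first exact: bigO_cst.
  exact: (@bigO_le _ 0 2 _ isT (bigOM (bigO_xs 2) bB)).
have [//|H [aH bH hH]] := taylor_quotient 2 (@taylor0_exp R) aV.
exists (fun n => - (i%:R / 2) * B n + H n).
  by apply: asymD => //; apply: asymCM.
near=> n; have n0 : (0 < n)%N by near: n; exact: near_gt0.
have eB : ln (1 + x n ^+ 2 * 1) = x n ^+ 2 + x n ^+ 4 * B n by near: n.
have eH : expR (x n ^+ 2 * V n) = \sum_(j < 2) j`!%:R^-1 * (x n ^+ 2 * V n) ^+ j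
   + (x n ^+ 2) ^+ 2 * H n by near: n.
have -> : x n.+1 ^+ i = x n ^+ i * expR (x n ^+ 2 * V n).
  have hx m : (0 < m)%N -> x m ^+ i = expR (- (i%:R / 2) * ln m%:R).
    move=> m0; rewrite -[LHS]lnK ?posrE ?exprn_gt0 ?xs_gt0 //.
    by rewrite lnXn ?xs_gt0 // ln_xs -mulr_natl; congr expR; ring.
  rewrite !hx // -expRD ln_shift // eB /V; congr expR; ring.
rewrite eH !big_ord_recl big_ord0 /= expr0 expr1 fact0 invr1 /V; ring.
Unshelve. all: by end_near. Qed.

(** The factor [k%:R], 0 or 1, treats expansions with and without logarithms at once. *)
Lemma lam_shift_expansion k l : exists2 D : nat -> R, asym k 1 D &
  \forall n \near \oo, lam k n.+1 ^+ l = lam k n ^+ l +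
    k%:R * l%:R * lam k n ^+ l.-1 * x n ^+ 2 + x n ^+ 4 * D n.
Proof.
have [B [aB bB hB]] := ln_shift_expansion.
have {}aB : asym k 1 B by apply: asym_free.
elim: l => [|l [D aD hD]].
  exists (fun=> 0); first exact: asym_cst.
  by apply: nearW => n; rewrite !expr0; ring.
exists (fun n => lam k n * D n + k%:R * (k%:R * l%:R * lam k n ^+ l.-1)
  + k%:R * x n ^+ 2 * D n + k%:R * B n * (lam k n ^+ l +
    k%:R * l%:R * lam k n ^+ l.-1 * x n ^+ 2 + x n ^+ 4 * D n)).
  have aX := asym_xs k 1; have aL := asym_lam k 1; asym_tac.
near=> n; have n0 : (0 < n)%N by near: n; exact: near_gt0.
have eB : ln (1 + x n ^+ 2 * 1) = x n ^+ 2 + x n ^+ 4 * B n by near: n.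
have e1 : lam k n.+1 = lam k n + k%:R * (x n ^+ 2 + x n ^+ 4 * B n).
  by rewrite /lam -eB; case: (k); rewrite ?mul0r ?addr0 // mul1r ln_shift.
have eD : lam k n.+1 ^+ l = lam k n ^+ l +
    k%:R * l%:R * lam k n ^+ l.-1 * x n ^+ 2 + x n ^+ 4 * D n by near: n.
have el : lam k n * (l%:R * lam k n ^+ l.-1) = l%:R * lam k n ^+ l.
  by case: (l) => [|m]; rewrite ?mul0r ?mulr0 //= exprS; ring.
rewrite exprS eD e1 /= -natr1 [lam k n ^+ l.+1]exprS.
apply/eqP; rewrite -subr_eq0; apply/eqP.
transitivity (k%:R * x n ^+ 2 * (lam k n * (l%:R * lam k n ^+ l.-1) - l%:R * lam k n ^+ l)).
  by ring.
by rewrite el subrr mulr0.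
Unshelve. all: by end_near. Qed.

Lemma monomial_shift k i l : exists2 d : nat -> R, asym k 1 d &
  \forall n \near \oo,
    x n.+1 ^+ i * lam k n.+1 ^+ l - x n ^+ i * lam k n ^+ l =
    x n ^+ (i + 2) * (- (i%:R / 2) * lam k n ^+ l + k%:R * l%:R * lam k n ^+ l.-1)
    + x n ^+ (i + 4) * d n.
Proof.
have [A aA hA] := xs_shift_expansion i; have [D aD hD] := lam_shift_expansion k l.
have {}aA : asym k 1 A by apply: asym_free.
exists (fun n => A n * (lam k n ^+ l + k%:R * l%:R * lam k n ^+ l.-1 * x n ^+ 2
     + x n ^+ 4 * D n) + (1 - i%:R / 2 * x n ^+ 2) * D n
     - i%:R / 2 * (k%:R * l%:R * lam k n ^+ l.-1)).
  have aX := asym_xs k 1; have aL := asym_lam k 1; asym_tac.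
apply: filterS2 hA hD => n -> ->; rewrite !exprD; ring.
Qed.

(** An expandable discrete antiderivative, up to an error O(n^(-N/2)). *)
Definition antidiff N k f := exists2 Phi : nat -> R, asym k 1 Phi &
  bigO N (fun n => Phi n.+1 - Phi n - f n).

Lemma antidiff_bigO N k f g : bigO N (fun n => f n - g n) ->
  antidiff N k f -> antidiff N k g.
Proof.
move=> h [Phi aP hP]; exists Phi => //.
by apply: bigO_near (bigOD hP h); apply: nearW => n; ring.
Qed.

Lemma antidiff_near N k f g : (\forall n \near \oo, f n = g n) ->
  antidiff N k f -> antidiff N k g.
Proof.
move=> h; apply: antidiff_bigO; apply: bigO_near (bigO0 N).
by apply: filterS h => n ->; rewrite subrr.
Qed.

Lemma antidiffD N k f g : antidiff N k f -> antidiff N k g ->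
  antidiff N k (fun n => f n + g n).
Proof.
move=> [F aF hF] [G aG hG]; exists (fun n => F n + G n); first exact: asymD.
by apply: bigO_near (bigOD hF hG); apply: nearW => n; ring.
Qed.

Lemma antidiffCM N k (c0 : R) f : antidiff N k f -> antidiff N k (fun n => c0 * f n).
Proof.
move=> [F aF hF]; exists (fun n => c0 * F n); first exact: asymCM.
by apply: bigO_near (bigOM (bigO_cst c0) hF); apply: nearW => n; ring.
Qed.

Lemma antidiff0 N k f : bigO N f -> antidiff N k f.
Proof.
move=> h; exists (fun=> 0); first exact: asym_cst.
by apply: bigO_near (bigON h); apply: nearW => n; ring.
Qed.

Lemma antidiff_sum N k (I : Type) (s : seq I) (F : I -> nat -> R) :
  (forall i, antidiff N k (F i)) -> antidiff N k (fun n => \sum_(i <- s) F i n).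
Proof.
move=> h; elim: s => [|i s IH].
  apply: antidiff_near (antidiff0 k (bigO0 N)).
  by apply: nearW => n; rewrite big_nil.
by apply: antidiff_near (antidiffD (h i) IH); apply: nearW => n; rewrite big_cons.
Qed.

Lemma antidiff_asym N k i d :
  (forall a b, antidiff N k (fun n => x n ^+ (i + a) * lam k n ^+ b)) ->
  asym k 1 d -> antidiff N k (fun n => x n ^+ i * d n).
Proof.
move=> h aD; have [p hp hd] := aD N.
apply: (@antidiff_bigO _ _ (fun n => x n ^+ i * ev k (p 0%N) n)).
  apply: (@bigO_le _ _ (i + N)); first exact: leq_addl.
  apply: bigO_near (bigON (bigOM (bigO_xs i) hd)); apply: nearW => n.
  by rewrite (periodic_mod n hp) modn1; ring.
apply: (@antidiff_near _ _ (fun n => \sum_(a < size (p 0%N))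
   \sum_(b < size (p 0%N)`_a) (p 0%N)`_a`_b * (x n ^+ (i + a) * lam k n ^+ b))).
  apply: nearW => n; rewrite ev_coef mulr_sumr; apply: eq_bigr => a _.
  rewrite horner_coef mulr_suml mulr_sumr; apply: eq_bigr => b _.
  by rewrite exprD; ring.
apply: antidiff_sum => a; apply: antidiff_sum => b.
by apply: antidiffCM; apply: h.
Qed.

Lemma bigO_monomial k i l : bigO i (fun n => x n ^+ i.+1 * lam k n ^+ l).
Proof.
apply: bigO_near (bigOM (lam_growth k l) (bigO_xs i)); apply: nearW => n.
by rewrite exprS; ring.
Qed.

(** Up to higher order, the difference of n^(-i/2) log^l n is n^(-i/2-1) (-(i/2) log^l n + l
    log^(l-1) n), which is inverted by induction on l. For i = 0 the first term disappears and log^l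
    n / n comes from log^(l+1) n / (l + 1): logarithms are then unavoidable. *)
Lemma antidiff_monomial N k i l : (~~ k <= i)%N ->
  antidiff N k (fun n => x n ^+ (i + 2) * lam k n ^+ l).
Proof.
have : (N <= i + N)%N by exact: leq_addl.
(* [m] bounds the number of orders between [i] and the precision; the remainder of a difference lies
   two orders further and falls under the induction hypothesis. *)
move: {2}N => m; elim: m i l => [|m IHm] i l.
  rewrite addn0 => hN _; apply: antidiff0.
  apply: (@bigO_le _ _ i.+1); first exact: leqW.
  by apply: bigO_near (bigO_monomial k i.+1 l); apply: nearW => n; rewrite addn2.
move=> hN ki; have IHd d : asym k 1 d -> antidiff N k (fun n => x n ^+ (i + 4) * d n).
  apply: antidiff_asym => a b; rewrite (_ : i + 4 + a = i + 2 + a + 2)%N; last by lia.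
  by apply: IHm; lia.
case: (posnP i) => [i0|i0].
  have kT : k = true by move: ki; rewrite i0; case: (k).
  have [d aD hd] := monomial_shift k 0 l.+1.
  have [F aF hF] := IHd _ aD.
  exists (fun n => l.+1%:R^-1 * (lam k n ^+ l.+1 - F n)).
    apply: asymCM => //; apply: asymB => //; apply: asymX => //; exact: asym_lam.
  apply: bigO_near (bigOM (bigO_cst (- l.+1%:R^-1)) hF).
  apply: filterS hd => n; rewrite i0 kT !expr0 !mul1r mul0r oppr0 mul0r add0r /= => hd.
  have -> : l.+1%:R^-1 * (lam true n.+1 ^+ l.+1 - F n.+1)
     - l.+1%:R^-1 * (lam true n ^+ l.+1 - F n) =
     l.+1%:R^-1 * ((lam true n.+1 ^+ l.+1 - lam true n ^+ l.+1) - (F n.+1 - F n)).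
    by ring.
  rewrite hd; field.
  by rewrite nat1r pnatr_eq0.
elim: l => [|l IHl].
  have [d aD hd] := monomial_shift k i 0.
  have [F aF hF] := IHd _ aD.
  exists (fun n => - (2 / i%:R) * (x n ^+ i - F n)).
    apply: asymCM => //; apply: asymB => //; apply: asymX => //; exact: asym_xs.
  apply: bigO_near (bigOM (bigO_cst (2 / i%:R)) hF).
  apply: filterS hd => n; rewrite /= !expr0 !mulr1 mulr0 addr0 => hd.
  have -> : - (2 / i%:R) * (x n.+1 ^+ i - F n.+1) - - (2 / i%:R) * (x n ^+ i - F n)
     = - (2 / i%:R) * ((x n.+1 ^+ i - x n ^+ i) - (F n.+1 - F n)) by ring.
  rewrite hd; field.
  by rewrite pnatr_eq0 -lt0n.
have [d aD hd] := monomial_shift k i l.+1.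
have [F aF hF] := IHd _ aD.
have [G aG hG] := antidiffCM (k%:R * l.+1%:R) IHl.
exists (fun n => - (2 / i%:R) * (x n ^+ i * lam k n ^+ l.+1 - F n - G n)).
  apply: asymCM => //; apply: asymB => //; apply: asymB => //; apply: asymM => //;
    apply: asymX => //; [exact: asym_xs | exact: asym_lam].
apply: bigO_near (bigOM (bigO_cst (2 / i%:R)) (bigOD hF hG)).
apply: filterS hd => n /= hd.
have -> : - (2 / i%:R) * (x n.+1 ^+ i * lam k n.+1 ^+ l.+1 - F n.+1 - G n.+1) -
      - (2 / i%:R) * (x n ^+ i * lam k n ^+ l.+1 - F n - G n) =
   - (2 / i%:R) * ((x n.+1 ^+ i * lam k n.+1 ^+ l.+1 - x n ^+ i * lam k n ^+ l.+1)
     - (F n.+1 - F n) - (G n.+1 - G n)) by ring.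
rewrite hd; field.
by rewrite pnatr_eq0 -lt0n.
Qed.

Lemma bigO_limit N (e : nat -> R) : bigO (2 * N.+2) (fun n => e n.+1 - e n) ->
  exists c : R, bigO (2 * N.+1) (fun n => e n - c).
Proof.
move=> /bigO_pos[C C0 [n0 _ hC]].
pose w m := C * 2 ^+ N.+2 * m.+1%:R ^- N.+1 : R.
have w0 m : 0 <= w m.
  by apply: mulr_ge0; [apply: mulr_ge0; [exact: ltW | exact: exprn_ge0] |
    rewrite invr_ge0 exprn_ge0].
have [||c _ hc] := @tail_limit R (fun m => e (m + n0.+1)%N) (fun m => w (m + n0)%N).
- move=> m; rewrite addSn addSn.
  have hn : (n0 <= m + n0.+1)%N by rewrite -addSnnS leq_addl.
  apply: (le_trans (hC _ hn)); rewrite exprM xs_sqr addnS.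
  set j := (m + n0)%N; rewrite /w -mulrBr -mulrA ler_wpM2l ?(ltW C0) //.
  have g := @invX_telescope R j 1 N.+1 isT isT.
  rewrite addn1 in g.
  apply: (@le_trans _ _ (2 ^+ N.+2 * j.+2%:R ^- N.+2)); last by rewrite ler_wpM2l ?exprn_ge0.
  rewrite -exprVn -exprMn exprVn -exprVn lerXn2r ?nnegrE ?mulr_ge0 ?invr_ge0 //.
  rewrite ler_pdivlMr ?ltr0n // mulrC ler_pdivrMr ?ltr0n // -natrM ler_nat; lia.
- by move=> m; exact: w0.
exists c; exists (C * 2 ^+ N.+2); exists n0.+1 => // n /= hn.
have -> : n = (n - n0.+1 + n0.+1)%N by rewrite subnK.
by rewrite (le_trans (hc _)) // exprM xs_sqr addnS exprVn.
Qed.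

(** If F is an approximate antiderivative of the differences, c - F has small differences, hence a
    limit, which supplies the constant term. Without logarithms the differences must be O(n^(-3/2)),
    since 1/n sums to log n. *)
Lemma asym_summation k c d : asym k 1 d ->
  (\forall n \near \oo, c n.+1 - c n = x n ^+ (2 + ~~ k) * d n) -> asym k 1 c.
Proof.
move=> aD hc N.
have [|F aF hF] := @antidiff_asym (2 * N.+2) k (2 + ~~ k)%N d _ aD.
  move=> a b; rewrite (_ : 2 + ~~ k + a = (~~ k + a) + 2)%N; last by lia.
  by apply: antidiff_monomial; exact: leq_addr.
have [|L hL] := @bigO_limit N (fun n => c n - F n).
  apply: bigO_near (bigON hF); apply: filterS hc => n hc; rewrite -hc; ring.
apply: (@osc_bigO _ _ _ _ (fun n => F n + L)).
  by apply: oscD; [exact: aF | exact: osc_cst].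
apply: (@bigO_le _ _ (2 * N.+1)); first by rewrite mulnS; lia.
by apply: bigO_near (bigON hL); apply: nearW => n; ring.
Qed.

Lemma ev_free_bounded p : bigO 0 (ev false p : nat -> R).
Proof.
apply: (@bigO_near _ _ (fun n => \sum_(i < size p) (p`_i).[0] * x n ^+ i)).
  by apply: nearW => n; rewrite ev_coef.
apply: bigO_sum => i; apply: (@bigO_le _ _ (0 + i)) => //.
exact: bigOM (bigO_cst _) (bigO_xs i).
Qed.

Lemma asym_free_bounded f : asym false 1 f -> bigO 0 f.
Proof.
move=> h; have [p hp hf] := h 0%N.
apply: bigO_near (bigOD hf (ev_free_bounded (p 0%N))); apply: nearW => n.
by rewrite (periodic_mod n hp) modn1 subrK.
Qed.

Lemma asym_free_limit f : asym false 1 f -> exists c : R, bigO 1 (fun n => f n - c).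
Proof.
move=> h; have [p hp hf] := h 1%N.
suff [c hc] : exists c : R, bigO 1 (fun n => ev false (p 0%N) n - c).
  exists c; apply: bigO_near (bigOD hf hc); apply: nearW => n.
  by rewrite (periodic_mod n hp) modn1; ring.
elim/poly_ind: (p 0%N) => [|p1 c0 _].
  by exists 0; apply: bigO_near (bigO0 1); apply: nearW => n; rewrite /ev !horner0 subr0.
exists c0.[0]; apply: bigO_near (bigOM (ev_free_bounded p1) (bigO_xs 1)).
apply: nearW => n; rewrite evD evM evX expr1 {3}/ev hornerC.
by rewrite /lam addrK.
Qed.

Lemma expR_ln_xs i (n : nat) : (0 < n)%N -> expR (- (i%:R / 2) * ln n%:R) = x n ^+ i.
Proof.
move=> n0; rewrite -[RHS]lnK ?posrE ?exprn_gt0 ?xs_gt0 //.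
by rewrite lnXn ?xs_gt0 // ln_xs -mulr_natl; congr expR; ring.
Qed.

(* First-order recurrence satisfied by the coefficients of [(1-z)^(i/2)]; the
   solution is [n^(-i/2-1)] times the exponential of a convergent sum. *)
Lemma homogeneous_asym i (a : nat -> R) :
  (\forall n \near \oo, n.+1%:R * a n.+1 = (n%:R - i%:R / 2) * a n) ->
  (\forall n \near \oo, a n != 0) ->
  exists w (c : R), [/\ asym false 1 w, c != 0, bigO 1 (fun n => w n - c) &
    \forall n \near \oo, a n = x n ^+ i.+2 * w n].
Proof.
move=> ha a0; pose s : R := i%:R / 2.
have s0 : 0 <= s by rewrite divr_ge0.
(* The recurrence makes ln |a_n| decrease by (s + 1)/n up to O(n^-2), so the differences of [u] are
   O(n^-2). *)
pose u n := ln `|a n| + (s + 1) * ln n%:R.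
have [B [aB bB hB]] := ln_shift_expansion.
have [|B1 [aB1 bB1 hB1]] := taylor_quotient 2 (@taylor0_ln R) (asym_cst false 1 (- s)).
  exact: bigO_cst.
have near_s : \forall n \near \oo, s < n%:R.
  near=> n; apply: (@lt_le_trans _ _ (s + 1)); first by rewrite ltrDl.
  near: n; exact: nbhs_infty_ger.
have near_ratio : \forall n \near \oo, a n.+1 = (n%:R - s) / n.+1%:R * a n.
  near=> n; have n1 : n.+1%:R != 0 :> R by rewrite pnatr_eq0.
  have e : n.+1%:R * a n.+1 = (n%:R - i%:R / 2) * a n by near: n.
  by apply: (mulfI n1); rewrite e mulrA mulrCA divff // mulr1.
have au : asym false 1 u.
  apply: (@asym_summation _ _ (fun n => x n * (B1 n + s * B n))); first by
    apply: asymM => //; [exact: asym_xs | apply: asymD => //; apply: asymCM].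
  near=> n; have n0 : (0 < n)%N by near: n; exact: near_gt0.
  have sn : s < n%:R by near: n.
  have er : a n.+1 = (n%:R - s) / n.+1%:R * a n by near: n.
  have an : a n != 0 by near: n.
  have eB : ln (1 + x n ^+ 2 * 1) = x n ^+ 2 + x n ^+ 4 * B n by near: n.
  have eB1 : ln (1 + x n ^+ 2 * - s) =
    \sum_(j < 2) (-1) ^+ j.-1 / j%:R * (x n ^+ 2 * - s) ^+ j + (x n ^+ 2) ^+ 2 * B1 n.
    by near: n.
  have n1 : 0 < n%:R :> R by rewrite ltr0n.
  have pr : 0 < (n%:R - s) / n.+1%:R by rewrite divr_gt0 ?subr_gt0.
  have el : ln ((n%:R - s) / n.+1%:R) = ln (1 + x n ^+ 2 * - s) - ln (1 + x n ^+ 2 * 1).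
    have p1 : 0 < 1 + x n ^+ 2 * 1 by rewrite ltr_wpDr ?ltr01 // mulr1 xsX_ge0.
    have p2 : 0 < 1 + x n ^+ 2 * - s.
      by rewrite xs_sqr mulrN subr_gt0 mulrC ltr_pdivrMr // mul1r.
    rewrite -ln_div ?posrE //; congr ln; rewrite xs_sqr -natr1; field.
    by rewrite natr1 !gt_eqF // ltr0n.
  rewrite /u er normrM (gtr0_norm pr) lnM ?posrE ?normr_gt0 // el.
  rewrite (ln_shift n0) eB eB1 !big_ord_recl big_ord0 /= expr0 expr1 invr0 invr1; ring.
have [C hC] := asym_free_limit au.
(* The ratio of consecutive terms is eventually positive, so the sign of a_n is eventually
   constant. *)
have [e [e2 he]] : exists e : R, e ^+ 2 = 1 /\ \forall n \near \oo, a n = e * `|a n|.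
  have [m _ hm] : \forall n \near \oo, a n != 0 /\ exists2 r, 0 < r & a n.+1 = r * a n.
    near=> n; split; first by near: n.
    exists ((n%:R - s) / n.+1%:R); last by near: n.
    by rewrite divr_gt0 // subr_gt0; near: n.
  exists (Num.sg (a m)); split; first by rewrite sqr_sg (hm m (leqnn m)).1.
  exists m => // n /= mn; rewrite [LHS]numEsg; congr (_ * _).
  rewrite -(subnK mn); elim: (n - m)%N => [|j IH]; first by rewrite add0n.
  rewrite addSn; have [_ [r r0 ->]] := hm (j + m)%N (leq_addl _ _).
  by rewrite sgrM gtr0_sg // mul1r.
pose w n := e * expR C * expR (u n - C).
have hw : bigO 1 (fun n => expR (u n - C) - 1).
  have [K K0 [d d0 hK]] := @taylor0_exp R 1%N.
  have [D D0 hD] := bigO_pos hC.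
  exists (K * D); near=> n.
  have hn : `|u n - C| <= D * x n ^+ 1 by near: n.
  have hd : `|u n - C| <= d.
    rewrite (le_trans hn) // expr1 mulrC -ler_pdivlMr //.
    by near: n; apply: near_xs_le; rewrite divr_gt0.
  have := hK _ hd; rewrite big_ord1 expr0 fact0 invr1 mulr1 => h.
  by rewrite (le_trans h) // -mulrA ler_wpM2l.
exists w, (e * expR C); split.
- apply: asymCM => //; apply: asym_comp => //; first exact: taylor0_exp.
    by apply: asymB => //; exact: asym_cst.
  by apply: (@bigO_le _ _ (1 + 1)) => //; apply: bigO_near (bigOM hC hC);
    apply: nearW => n; rewrite expr2.
- apply: mulf_neq0; last by rewrite gt_eqF ?expR_gt0.
  apply/eqP => e0.
  by move: e2; rewrite e0 expr0n => /eqP; rewrite eq_sym oner_eq0.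
- apply: bigO_near (bigOM (bigO_cst (e * expR C)) hw); apply: nearW => n.
  by rewrite /w; ring.
near=> n; have n0 : (0 < n)%N by near: n; exact: near_gt0.
have an : a n != 0 by near: n.
have -> : a n = e * `|a n| by near: n.
rewrite /w -mulrA -expRD addrC subrK mulrCA; congr (_ * _).
have n1 : 0 < n%:R :> R by rewrite ltr0n.
rewrite /u expRD lnK ?posrE ?normr_gt0 // mulrCA -expR_ln_xs // -expRD.
rewrite (_ : - (i.+2%:R / 2) * ln n%:R + (s + 1) * ln n%:R = 0) ?expR0 ?mulr1 //.
by rewrite /s -natr1 -natr1; field.
Unshelve. all: by end_near. Qed.

(** Variation of constants: the quotient a/p has differences t c_n / (n - i/2). Their order 1/n is
    what creates logarithms. *)
Lemma inhomogeneous_asym i (p a b : nat -> R) (t : R) (c : nat -> R) :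
  (\forall n \near \oo, n.+1%:R * p n.+1 = (n%:R - i%:R / 2) * p n) ->
  (\forall n \near \oo, p n != 0) ->
  (\forall n \near \oo, n.+1%:R * a n.+1 = (n%:R - i%:R / 2) * a n + t * b n) ->
  asym true 1 c -> (\forall n \near \oo, b n = p n * c n) ->
  exists2 c', asym true 1 c' & \forall n \near \oo, a n = p n * c' n.
Proof.
move=> hp p0 ha ac hb; pose s : R := i%:R / 2; exists (fun n => a n / p n); last first.
  by apply: filterS p0 => n pn; rewrite mulrC divfK.
have [|G [aG bG hG]] := taylor_quotient 0 (@taylor0_inv R) (asym_cst false 1 s).
  exact: bigO_cst.
apply: (@asym_summation _ _ (fun n => t * c n * G n)).
  by apply: asymM => //; [apply: asymCM | apply: asym_free].
have p1 : \forall n \near \oo, p n.+1 != 0.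
  by case: p0 => m _ h; exists m => // n mn; apply: h; exact: leqW.
near=> n; have n0 : (0 < n)%N by near: n; exact: near_gt0.
have pn : p n != 0 by near: n.
have pn1 : p n.+1 != 0 by near: n.
have n1 : n%:R != 0 :> R by rewrite pnatr_eq0 -lt0n.
have n2 : n.+1%:R != 0 :> R by rewrite pnatr_eq0.
have ep : n.+1%:R * p n.+1 = (n%:R - s) * p n by near: n.
have ea : n.+1%:R * a n.+1 = (n%:R - s) * a n + t * b n by near: n.
have eb : b n = p n * c n by near: n.
have eG : (1 - x n ^+ 2 * s)^-1 = \sum_(j < 0) 1 * (x n ^+ 2 * s) ^+ j
  + (x n ^+ 2) ^+ 0 * G n by near: n.
rewrite big_ord0 add0r expr0 mul1r in eG.
have ns : n%:R - s != 0.
  by apply/eqP => e; move/eqP: ep; rewrite e mul0r mulf_eq0 (negbTE n2) (negbTE pn1).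
apply: (mulfI (mulf_neq0 n2 pn1)); rewrite mulrBr.
have -> : n.+1%:R * p n.+1 * (a n.+1 / p n.+1) = n.+1%:R * a n.+1.
  by rewrite mulrCA -[X in _ = X]mulr1; field.
rewrite ep ea eb -eG /= xs_sqr; field.
by rewrite pn n1 ns.
Unshelve. all: by end_near. Qed.

End Summation.

(** * The square-root singularity *)

Section SingularSeries.
Context {R : realType}.
Implicit Types (a b y r : fps R).
Notation x := (@xs R).

Definition tcat : fps R :=
  fun n => n%:R^-1 * 'C(2 * n - 2, n - 1)%:R * 4 ^- n.

Lemma tcat0 : tcat 0%N = 0.
Proof. by rewrite /tcat invr0 !mul0r. Qed.

Lemma tcat1 : tcat 1%N = 4^-1.
Proof. by rewrite /tcat bin0 expr1 invr1 !mul1r. Qed.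

Lemma central_binS m :
  (m.+1 * 'C(2 * m.+1, m.+1) = 2 * (2 * m).+1 * 'C(2 * m, m))%N.
Proof.
apply/eqP; rewrite -(eqn_pmul2l (ltn0Sn m)); apply/eqP.
have e1 := mul_bin_diag (2 * m).+2 m; have e2 := mul_bin_diag (2 * m).+1 m.
have e3 : 'C((2 * m).+1, m) = 'C((2 * m).+1, m.+1).
  by rewrite -bin_sub; [congr 'C(_, _); lia | lia].
rewrite /= in e1 e2; rewrite mulnS add2n.
nia.
Qed.

Lemma tcatS n : (0 < n)%N -> n.+1%:R * tcat n.+1 = (n%:R - 2^-1) * tcat n.
Proof.
case: n => // m _; rewrite /tcat.
have -> : (2 * m.+2 - 2 = 2 * m.+1)%N by lia.
have -> : (m.+2 - 1 = m.+1)%N by lia.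
have -> : (2 * m.+1 - 2 = 2 * m)%N by lia.
have -> : (m.+1 - 1 = m)%N by lia.
have h : m.+1%:R * 'C(2 * m.+1, m.+1)%:R = 2 * (2 * m%:R + 1) * 'C(2 * m, m)%:R :> R.
  by have := congr1 (fun k => k%:R : R) (central_binS m); rewrite !natrM -[(2 * m).+1%:R]natr1 natrM.
have m1 : m.+1%:R != 0 :> R by rewrite pnatr_eq0.
have m2 : m.+2%:R != 0 :> R by rewrite pnatr_eq0.
apply: (mulfI m1).
transitivity ((m.+1%:R * 'C(2 * m.+1, m.+1)%:R) * 4 ^- m.+2 : R).
  by move: ('C(_, _)%:R : R) (4 ^- m.+2 : R) => u v; field; rewrite -natrD pnatr_eq0.
rewrite h exprSr invfM -natr1.
move: ('C(_, _)%:R : R) (4 ^- m.+1 : R) => u v; field.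
by rewrite nat1r.
Qed.

Lemma tcat_gt0 n : (0 < n)%N -> 0 < tcat n.
Proof.
move=> n0; rewrite /tcat divr_gt0 ?exprn_gt0 // mulr_gt0 ?invr_gt0 ?ltr0n //.
by rewrite bin_gt0; lia.
Qed.

Lemma tcat_ge0 n : 0 <= tcat n.
Proof. by case: n => [|n]; rewrite ?tcat0 // ltW // tcat_gt0. Qed.

(** By the recurrence, n t_n does not increase. The bound is far from n^(-3/2), but its powers decay
    in n and geometrically in m at once. *)
Lemma tcat_le n : (0 < n)%N -> tcat n <= (4 * n%:R)^-1.
Proof.
case: n => // n _; elim: n => [|n IH]; first by rewrite tcat1 mulr1.
have n1 : 0 < n.+1%:R :> R by rewrite ltr0n.
have n2 : 0 < n.+2%:R :> R by rewrite ltr0n.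
have e (m : R) : 0 < m -> m * (4 * m)^-1 = 4^-1.
  by move=> m0; field; rewrite gt_eqF.
rewrite -(ler_pM2l n2) tcatS // e //.
apply: (@le_trans _ _ (n.+1%:R * tcat n.+1)).
  by rewrite ler_wpM2r ?tcat_ge0 // gerBl.
by rewrite -(ler_pM2l n1) e in IH.
Qed.

End SingularSeries.

HB.lock Definition sqrt1z {R : realType} : fps R := 1 - fpsC 2 * tcat.
HB.lock Definition log1z {R : realType} : fps R := fun n => - n%:R^-1.

Section SqrtLog.
Context {R : realType}.
Implicit Types (a b y r : fps R).
Notation x := (@xs R).
Notation P := (@sqrt1z R).
Notation L := (@log1z R).
Notation Z := (@fpsXn R 1).

Lemma sqrt1zE n : P n.+1 = - 2 * tcat n.+1.
Proof. by rewrite unlock fpsBE fps1E fpsCM sub0r mulNr. Qed.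

Lemma sqrt1z0 : P 0%N = 1.
Proof. by rewrite unlock fpsBE fps1E fpsCM tcat0 mulr0 subr0. Qed.

Lemma sqrt1zS n : n.+1%:R * P n.+1 = (n%:R - 2^-1) * P n.
Proof.
case: n => [|n]; first by rewrite sqrt1zE sqrt1z0 tcat1; field.
by rewrite !sqrt1zE mulrCA tcatS // mulrCA.
Qed.

Lemma fpsXn1M a n : (Z * a) n.+1 = a n.
Proof. by rewrite fpsXnM subn1. Qed.

Lemma fpsXn1M0 a : (Z * a) 0%N = 0.
Proof. by rewrite fpsXnM. Qed.

Lemma sqrt1z_ode : (1 - Z) * fpsD P = - (fpsC 2^-1 * (Z * P)).
Proof.
apply/funext => -[|n]; rewrite mulrBl mul1r fpsBE fpsNE fpsCM.
  by rewrite !fpsXn1M0 fpsD_E mul0r subrr mulr0 oppr0.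
by rewrite !fpsXn1M !fpsD_E sqrt1zS; ring.
Qed.

Lemma log1z_ode : (1 - Z) * fpsD L = - Z.
Proof.
apply/funext => -[|n]; rewrite mulrBl mul1r fpsBE fpsNE.
  by rewrite !fpsXn1M0 fpsD_E mul0r fpsXnE subrr oppr0.
rewrite !fpsXn1M !fpsD_E fpsXnE eqSS unlock !mulrN mulfV ?pnatr_eq0 //.
rewrite opprK; case: n => [|n]; first by rewrite mul0r addr0.
by rewrite mulfV ?pnatr_eq0 // addNr oppr0.
Qed.

(** Derivation lowers the power of [L] and keeps that of [P]: at fixed i the recurrences form a
    triangular system in j. *)
Lemma singular_ode i j :
  (1 - Z) * fpsD (P ^+ i * L ^+ j) =
  - (fpsC (i%:R / 2) * (Z * (P ^+ i * L ^+ j))) -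
    fpsC j%:R * (Z * (P ^+ i * L ^+ j.-1)).
Proof.
have hP : (1 - Z) * fpsD (P ^+ i) = - (fpsC (i%:R / 2) * (Z * P ^+ i)).
  case: i => [|i]; first by rewrite mul0r raddf0 mul0r oppr0 fpsD_1 mulr0.
  rewrite fpsD_X exprS.
  have := sqrt1z_ode; rewrite rmorphM /= (rmorph_nat fpsC).
  move: (fpsD P) (fpsC _) => D c h.
  transitivity (i.+1%:R * P ^+ i * ((1 - Z) * D)); first by ring.
  by rewrite h; ring.
have hL : (1 - Z) * fpsD (L ^+ j) = - (fpsC j%:R * (Z * L ^+ j.-1)).
  case: j => [|j]; first by rewrite raddf0 mul0r oppr0 fpsD_1 mulr0.
  rewrite fpsD_X (rmorph_nat fpsC) /=.
  have := log1z_ode; move: (fpsD L) => D h.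
  transitivity (j.+1%:R * L ^+ j * ((1 - Z) * D)); first by ring.
  by rewrite h; ring.
rewrite fpsD_M; move: hP hL.
move: (fpsD (P ^+ i)) (fpsD (L ^+ j)) (fpsC _) (fpsC _) => D D' c c' h h'.
transitivity (L ^+ j * ((1 - Z) * D) + P ^+ i * ((1 - Z) * D')); first by ring.
by rewrite h h'; ring.
Qed.

Lemma singular_rec i j n :
  n.+1%:R * (P ^+ i * L ^+ j) n.+1 =
  (n%:R - i%:R / 2) * (P ^+ i * L ^+ j) n - j%:R * (P ^+ i * L ^+ j.-1) n.
Proof.
have := congr1 (@^~ n.+1) (singular_ode i j).
rewrite mulrBl mul1r fpsBE fpsXn1M !fpsD_E fpsBE fpsNE !fpsCM !fpsXn1M => h.
apply/eqP; rewrite -subr_eq0; apply/eqP; move/eqP: h; rewrite -subr_eq0 => /eqP <-.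
by ring.
Qed.

Lemma sqrt1z_rec i n :
  n.+1%:R * (P ^+ i) n.+1 = (n%:R - i%:R / 2) * (P ^+ i) n.
Proof. by have := singular_rec i 0 n; rewrite expr0 mulr1 mul0r subr0. Qed.

Lemma sqrt1zX_0 i : (P ^+ i) 0%N = 1.
Proof.
by elim: i => [|i IH]; rewrite ?expr0 // exprS fpsME big_ord1 /= IH sqrt1z0 mulr1.
Qed.

(** For i = 2 the recurrence has the factor n - 1, which annihilates the coefficient of z^2 and with
    it all later ones. *)
Lemma sqrt1z_sqr : P ^+ 2 = 1 - Z.
Proof.
have h n : (P ^+ 2) n.+2 = 0.
  elim: n => [|n IH].
    have := sqrt1z_rec 2 1; rewrite divff ?pnatr_eq0 // subrr mul0r => /eqP.
    by rewrite mulf_eq0 pnatr_eq0 /= => /eqP.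
  have := sqrt1z_rec 2 n.+2; rewrite IH mulr0 => /eqP.
  by rewrite mulf_eq0 pnatr_eq0 /= => /eqP.
apply/funext => -[|[|n]]; rewrite fpsBE fps1E fpsXnE ?h ?sqrt1zX_0 ?subr0 //=.
by have := sqrt1z_rec 2 0; rewrite sqrt1zX_0 mul1r divff ?pnatr_eq0 // mulr1.
Qed.

Lemma sqrt1z_odd_neq0 i n : odd i -> (P ^+ i) n != 0.
Proof.
move=> oi; elim: n => [|n IH]; first by rewrite sqrt1zX_0 oner_eq0.
have : n.+1%:R * (P ^+ i) n.+1 != 0.
  rewrite sqrt1z_rec mulf_neq0 // subr_eq0; apply/eqP => e.
  have : (2 * n = i)%N.
    by apply/eqP; rewrite -(eqr_nat R) natrM e mulrC divfK // pnatr_eq0.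
  by move=> e2; move: oi; rewrite -e2 oddM.
by rewrite mulf_eq0 negb_or => /andP[].
Qed.

Lemma sqrt1z_even_coef m n : ((P ^+ (2 * m)) n == 0) = (m < n)%N.
Proof.
have e : (2 * m)%:R / 2 = m%:R :> R by rewrite natrM mulrC mulKf // pnatr_eq0.
elim: n => [|n IH]; first by rewrite sqrt1zX_0 oner_eq0.
have := sqrt1z_rec (2 * m) n; rewrite e => h.
rewrite -[LHS]orFb -[X in X || _](pnatr_eq0 R n.+1 : _ = false) -mulf_eq0 h.
by rewrite mulf_eq0 IH subr_eq0 eqr_nat ltnS [RHS]leq_eqVlt eq_sym.
Qed.

Lemma sqrt1z_even_zero m : \forall n \near \oo, (P ^+ (2 * m)) n = 0.
Proof.
by exists m.+1 => // n /= mn; apply/eqP; rewrite sqrt1z_even_coef.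
Qed.

(* Odd powers of [P], and even ones times [L], are the log-free singular
   series. *)
Definition free_series i : fps R := P ^+ i * L ^+ (~~ odd i).

Lemma free_series_rec i : \forall n \near \oo,
  n.+1%:R * free_series i n.+1 = (n%:R - i%:R / 2) * free_series i n.
Proof.
rewrite /free_series; case: (boolP (odd i)) => oi /=.
  by apply: nearW => n; rewrite expr0 mulr1 sqrt1z_rec.
have e : i = (2 * i./2)%N by rewrite mul2n even_halfK.
have := sqrt1z_even_zero i./2; rewrite -e; apply: filterS => n hn.
by rewrite singular_rec /= expr0 mulr1 hn mulr0 subr0.
Qed.

(** For odd i the factor n - i/2 never vanishes. For even i it vanishes at n = i/2, where the last
    nonzero coefficient of the polynomial P^i acts as source; after that the coefficients stay
    nonzero. *)
Lemma free_series_neq0 i : \forall n \near \oo, free_series i n != 0.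
Proof.
rewrite /free_series; case: (boolP (odd i)) => oi /=.
  by apply: nearW => n; rewrite expr0 mulr1 sqrt1z_odd_neq0.
have e : i = (2 * i./2)%N by rewrite mul2n even_halfK.
have em : i%:R / 2 = i./2%:R :> R.
  by rewrite {1}e natrM mulrC mulKf // pnatr_eq0.
exists i./2.+1 => // n /= hn; rewrite -(subnK hn).
elim: (n - i./2.+1)%N => [|j IH].
  rewrite add0n; have := singular_rec i 1 i./2.
  rewrite em subrr mul0r sub0r mul1r /= expr0 mulr1 => h.
  have : i./2.+1%:R * (P ^+ i * L ^+ 1) i./2.+1 != 0.
    by rewrite h oppr_eq0 {1}e sqrt1z_even_coef ltnn.
  by rewrite mulf_eq0 negb_or => /andP[].
rewrite addSn; set m := (j + i./2.+1)%N.
have := singular_rec i 1 m; rewrite /= expr0 mulr1.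
have -> : (P ^+ i) m = 0 by apply/eqP; rewrite e sqrt1z_even_coef /m; lia.
rewrite mulr0 subr0 em => h.
have : m.+1%:R * (P ^+ i * L ^+ 1) m.+1 != 0.
  rewrite h mulf_neq0 // subr_eq0 eqr_nat /m; lia.
by rewrite mulf_eq0 negb_or => /andP[].
Qed.

Lemma free_series_asym i : exists w (c : R), [/\ asym false 1 w, c != 0,
  bigO 1 (fun n => w n - c) &
  \forall n \near \oo, free_series i n = x n ^+ i.+2 * w n].
Proof.
by apply: homogeneous_asym; [exact: free_series_rec | exact: free_series_neq0].
Qed.

(** Induction on j by variation of constants, relative to the free series, which solves the
    homogeneous recurrence. For even i it starts at j = 1, because P^i is a polynomial. *)
Lemma singular_asym i j : exists2 c, asym true 1 c &
  \forall n \near \oo, (P ^+ i * L ^+ j) n = x n ^+ i.+2 * c n.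
Proof.
have [w [c0 [aw _ _ hw]]] := free_series_asym i.
suff [c ac hc] : exists2 c, asym true 1 c &
    \forall n \near \oo, (P ^+ i * L ^+ j) n = free_series i n * c n.
  exists (fun n => w n * c n); first by apply: asymM => //; apply: asym_free.
  by apply: filterS2 hw hc => n hw ->; rewrite hw mulrA.
have step j' : (exists2 c, asym true 1 c &
      \forall n \near \oo, (P ^+ i * L ^+ j') n = free_series i n * c n) ->
    exists2 c, asym true 1 c &
      \forall n \near \oo, (P ^+ i * L ^+ j'.+1) n = free_series i n * c n.
  move=> [c ac hc].
  apply: (@inhomogeneous_asym _ i _ _ (P ^+ i * L ^+ j') (- j'.+1%:R) c) => //.
  - exact: free_series_rec.
  - exact: free_series_neq0.
  - by apply: nearW => n; rewrite singular_rec mulNr.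
have base : exists2 c, asym true 1 c & \forall n \near \oo,
    (P ^+ i * L ^+ (~~ odd i)) n = free_series i n * c n.
  by exists (fun=> 1); [exact: asym_cst | apply: nearW => n; rewrite mulr1].
case: j => [|j].
  case: (boolP (odd i)) base => oi //= _; exists (fun=> 0); first exact: asym_cst.
  have e : i = (2 * i./2)%N by rewrite mul2n even_halfK.
  have := sqrt1z_even_zero i./2; rewrite -e; apply: filterS => n hn.
  by rewrite expr0 mulr1 hn mulr0.
elim: j => [|j IH]; last exact: step.
by case: (boolP (odd i)) base => oi //=; exact: step.
Qed.

End SqrtLog.

(** * Series in z^q and residue classes *)

Section Dilation.
Context {R : realType}.
Implicit Types (a b y rho : fps R) (k : bool) (q r : nat).
Notation x := (@xs R).
Notation lam := (@lam R).

Lemma bigO_fsmall N a : bigO (2 * N) a -> fsmall N a.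
Proof.
move=> /bigO_pos[C C0 [n0 _ hC]].
apply: (@fsmall_near _ _ _ (C * 2 ^+ N) n0.+1) => n hn.
apply: (le_trans (hC n (ltnW hn))); rewrite exprM xs_sqr -mulrA ler_wpM2l ?(ltW C0) //.
have n1 : 0 < n%:R :> R by rewrite ltr0n (leq_trans _ hn).
rewrite -[_ ^- N]exprVn -exprMn lerXn2r ?nnegrE ?mulr_ge0 ?invr_ge0 //.
rewrite ler_pdivlMr ?ltr0n // mulrC ler_pdivrMr // -natrM ler_nat; lia.
Qed.

Lemma fsmall_bigO N a : fsmall N a -> bigO (2 * N) a.
Proof.
move=> [C C0 h]; exists C; near=> n.
have n0 : (0 < n)%N by near: n; exact: near_gt0.
apply: (le_trans (h n)); rewrite ler_wpM2l // exprM xs_sqr exprVn.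
rewrite lef_pV2 ?posrE ?exprn_gt0 ?ltr0n //.
by rewrite lerXn2r ?nnegrE // ler_nat.
Unshelve. all: by end_near. Qed.

(** The series z^r a(z^q), supported on the class of r mod q. *)
Definition dil q r a : fps R := fpsXn r * fpsub q a.

Definition in_class q r (n : nat) : R := (n == r %[mod q])%:R.

Lemma in_class_periodic q r : periodic q (in_class q r).
Proof. by move=> n; rewrite /in_class modnDr. Qed.

Lemma dilE q r a n : (r <= n)%N ->
  dil q r a n = in_class q r n * a ((n - r) %/ q)%N.
Proof.
move=> rn; rewrite /dil fpsXnM rn fpsubE /in_class eqn_mod_dvd //.
by case: ifP; rewrite ?mul1r ?mul0r.
Qed.

(** For n > r this is (1 - r/n)^(-1/2), written as the exponential of 1/n times a bounded sequence
    to fit [taylor_quotient]. *)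
Definition shift_ratio r (n : nat) : R :=
  expR (x n ^+ 2 * (- 2^-1 * (ln (1 + x n ^+ 2 * - r%:R) / x n ^+ 2))).

Lemma shift_ratio_asym r : asym false 1 (shift_ratio r).
Proof.
have [|H [aH bH hH]] := taylor_quotient 1 (@taylor0_ln R) (asym_cst false 1 (- r%:R)).
  exact: bigO_cst.
have e : \forall n \near \oo, H n = ln (1 + x n ^+ 2 * - r%:R) / x n ^+ 2.
  near=> n; have n0 : (0 < n)%N by near: n; exact: near_gt0.
  have -> : ln (1 + x n ^+ 2 * - r%:R) = \sum_(i < 1) (-1) ^+ i.-1 / i%:R *
    (x n ^+ 2 * - r%:R) ^+ i + (x n ^+ 2) ^+ 1 * H n by near: n.
  rewrite big_ord1 /= invr0 mulr0 mul0r add0r expr1 mulrC mulKf //.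
  by rewrite expf_neq0 // gt_eqF // xs_gt0.
have [||G [aG bG hG]] := @taylor_quotient R _ _ (fun n => - 2^-1 * H n) 0 (@taylor0_exp R).
- exact: asymCM.
- exact: (bigOM (bigO_cst _) bH).
apply: asym_near aG; apply: filterS2 hG e => n hG e.
by rewrite /shift_ratio -e hG big_ord0 add0r expr0 mul1r.
Unshelve. all: by end_near. Qed.

Section Class.
Variables (q r : nat).
Hypothesis q0 : (0 < q)%N.

Lemma class_pos n : (r < n)%N -> 0 < 1 + x n ^+ 2 * - r%:R.
Proof.
move=> rn; have n0 : 0 < n%:R :> R by rewrite ltr0n (leq_trans _ rn).
rewrite xs_sqr mulrN subr_gt0 mulrC ltr_pdivrMr // mul1r ltr_nat //.
Qed.

Lemma shift_ratioE n : (r < n)%N ->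
  shift_ratio r n = expR (- (2^-1 * ln (1 + x n ^+ 2 * - r%:R))).
Proof.
move=> rn; rewrite /shift_ratio; congr expR.
have xn : x n != 0 by rewrite gt_eqF // xs_gt0 // (leq_trans _ rn).
by move: (ln _) => l; field.
Qed.

Lemma shift_ratio_ge1 n : (r < n)%N -> 1 <= shift_ratio r n.
Proof.
move=> rn; rewrite shift_ratioE // -[leLHS]expR0 ler_expR oppr_ge0.
rewrite pmulr_rle0 ?invr_gt0 //; apply: ln_le0.
by rewrite -lerBrDl subrr mulrN oppr_le0 mulr_ge0 // xsX_ge0.
Qed.

Lemma class_quot n : (r < n)%N -> n = r %[mod q] ->
  ((n - r) %/ q)%:R = (n%:R - r%:R) / q%:R :> R.
Proof.
move=> rn e; have qn : q%:R != 0 :> R by rewrite pnatr_eq0 -lt0n.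
apply: (mulIf qn); rewrite divfK // -natrM -natrB ?(ltnW rn) // divnK //.
by rewrite -eqn_mod_dvd ?(ltnW rn) //; apply/eqP.
Qed.

Lemma class_xs n : (r < n)%N -> n = r %[mod q] ->
  x ((n - r) %/ q) = Num.sqrt q%:R * x n * shift_ratio r n.
Proof.
move=> rn e; have p := class_pos rn.
have n0 : 0 < n%:R :> R by rewrite ltr0n (leq_trans _ rn).
have q1 : 0 < q%:R :> R by rewrite ltr0n.
apply/eqP; rewrite -(@eqrXn2 _ 2) ?xs_ge0 //; last first.
  by rewrite !mulr_ge0 ?sqrtr_ge0 ?xs_ge0 ?expR_ge0.
rewrite !exprMn !xs_sqr class_quot // sqr_sqrtr ?(ltW q1) // shift_ratioE //.
rewrite -expRM_natl (_ : _ * - _ = - ln (1 + x n ^+ 2 * - r%:R)); last by field.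
rewrite expRN lnK ?posrE // xs_sqr; apply/eqP; field.
rewrite !gt_eqF //= subr_gt0 ltr_nat //.
Qed.

Lemma class_lam k n : (r < n)%N -> n = r %[mod q] ->
  lam k ((n - r) %/ q) = lam k n + k%:R * (ln (1 + x n ^+ 2 * - r%:R) - ln q%:R).
Proof.
move=> rn e; rewrite /lam; case: k; last by rewrite mul0r addr0.
have n0 : 0 < n%:R :> R by rewrite ltr0n (leq_trans _ rn).
have q1 : 0 < q%:R :> R by rewrite ltr0n.
have p := class_pos rn.
rewrite mul1r class_quot // addrA -lnM ?posrE // -ln_div ?posrE ?mulr_gt0 //.
by congr ln; rewrite xs_sqr; field; rewrite !gt_eqF.
Qed.

(** Powers and logarithms of (n - r)/q re-expand in those of n. The last conclusion holds because
    [s n >= 1] once n > r; it prevents the leading coefficient from being lost on the class of r. *)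
Lemma dil_asym k m a (g : nat -> R) : asym k 1 g ->
  (\forall n \near \oo, a n = x n ^+ m * g n) ->
  exists G : nat -> R, [/\ asym k q G,
    \forall n \near \oo, dil q r a n = x n ^+ m * (in_class q r n * G n) &
    \forall n \near \oo, n = r %[mod q] -> `|g ((n - r) %/ q)%N| <= `|G n| ].
Proof.
move=> ag [n1 _ ha].
pose s n := Num.sqrt q%:R * shift_ratio r n.
have as_ k' q' : asym k' q' s.
  apply: (@asym_dvd _ _ 1 q' _ (dvd1n _)); apply: asym_free.
  by apply: asymCM => //; exact: shift_ratio_asym.
pose G n := in_class q r n * s n ^+ m * g ((n - r) %/ q)%N.
have near_big j : \forall n \near \oo, (r < n)%N /\ (j <= (n - r) %/ q)%N.
  exists (r + j * q).+1 => // n /= hn; split; first by lia.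
  by rewrite leq_divRL //; lia.
exists G; split.
- move=> N; have [p hp [C [n2 _ hC]]] := ag N.
  pose La n := lam k n + k%:R * (ln (1 + x n ^+ 2 * - r%:R) - ln q%:R).
  pose Gt n := in_class q r n * s n ^+ m * (p 0%N).[(x n * s n)%:P].[La n].
  have aG : asym k q Gt.
    apply: asymM => //.
      apply: asymM => //; last exact: asymX.
      apply: asym_periodic; exact: in_class_periodic.
    apply: asym_ev => //; first by apply: asymM => //; exact: asym_xs.
    apply: asymD; first exact: asym_lam.
    apply: asymCM => //; apply: asymB => //; last exact: asym_cst.
    apply: (@asym_dvd _ _ 1 q _ (dvd1n _)); apply: asym_free.
    have [|H [aH _ hH]] := taylor_quotient 0 (@taylor0_ln R) (asym_cst false 1 (- r%:R)).
      exact: bigO_cst.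
    apply: asym_near aH; apply: filterS hH => n ->.
    by rewrite big_ord0 add0r expr0 mul1r.
  apply: osc_bigO (aG N) _.
  have /bigO_pos[D D0 hD] : bigO 0 s by apply: asym_free_bounded; exact: as_.
  exists (D ^+ m * (`|C| * D ^+ N)); near=> n.
  have [rn kn] : (r < n)%N /\ (n2 <= (n - r) %/ q)%N by near: n.
  have sD : `|s n| <= D * x n ^+ 0 by near: n.
  rewrite expr0 mulr1 in sD.
  rewrite distrC /G /Gt -mulrBr !normrM /in_class.
  have [e|e] := boolP (n == r %[mod q]); last first.
    rewrite normr0 !mul0r mulr_ge0 ?xsX_ge0 // !mulr_ge0 ?exprn_ge0 //; exact: ltW.
  move/eqP in e; rewrite normr1 mul1r -!mulrA; apply: ler_pM => //.
    by rewrite normrX lerXn2r ?nnegrE // ltW.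
  have h := hC _ kn; rewrite /= (periodic_mod _ hp) modn1 /ev class_xs // class_lam // in h.
  rewrite -mulrA [Num.sqrt _ * (_ * _)]mulrCA -/(s n) in h.
  apply: (le_trans h); rewrite exprMn.
  apply: (@le_trans _ _ (`|C| * (x n ^+ N * s n ^+ N))).
    rewrite ler_wpM2r ?ler_norm // mulr_ge0 ?xsX_ge0 // exprn_ge0 //.
    by rewrite mulr_ge0 ?sqrtr_ge0 ?expR_ge0.
  rewrite ler_wpM2l // mulrC ler_wpM2r ?xsX_ge0 // lerXn2r ?nnegrE ?(ltW D0) //.
    by rewrite mulr_ge0 ?sqrtr_ge0 ?expR_ge0.
  exact: (le_trans (ler_norm _)).
- near=> n; have [rn kn] : (r < n)%N /\ (n1 <= (n - r) %/ q)%N by near: n.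
  rewrite dilE ?(ltnW rn) // /G /in_class.
  have [e|e] := boolP (n == r %[mod q]); last by rewrite !mul0r mulr0.
  move/eqP in e; rewrite !mul1r ha // class_xs // -mulrA mulrCA exprMn /s.
  by rewrite mulrA.
near=> n => e; have [rn _] : (r < n)%N /\ (0 <= (n - r) %/ q)%N by near: n.
rewrite /G /in_class e eqxx mul1r normrM ler_peMl // normrX exprn_ege1 //.
rewrite normrM !ger0_norm ?sqrtr_ge0 ?expR_ge0 //.
rewrite mulr_ege1 ?shift_ratio_ge1 // -[leLHS]sqrtr1 ler_wsqrtr // ler1n //.
Unshelve. all: by end_near. Qed.

End Class.
End Dilation.

Lemma horner_xs_limit (R : realType) (v : {poly R}) :
  bigO 1 (fun n => v.[xs n] - v`_0).
Proof.
elim/poly_ind: v => [|p c _].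
  by apply: bigO_near (bigO0 1); apply: nearW => n; rewrite horner0 coef0 subrr.
have hp : bigO 0 (fun n => p.[xs n]).
  by apply: asym_free_bounded; apply: asym_horner => //; exact: asym_xs.
apply: bigO_near (bigOM hp (bigO_xs 1)); apply: nearW => n.
by rewrite hornerMXaddC coefD coefMX coefC /= add0r addrK expr1.
Qed.

Lemma double_le_absurd (R : realType) (s t : R) :
  0 < s -> s <= t -> 2 * t <= s -> False.
Proof. lra. Qed.

(** * Exponentials of singular series *)

Section SingularAlgebra.
Context {R : realType}.
Variable q : nat.
Hypothesis q0 : (0 < q)%N.
Implicit Types (a b y rho : fps R).
Notation x := (@xs R).
Notation P := (@sqrt1z R).
Notation L := (@log1z R).
Notation Pq := (fpsub q P).

(** The algebra generated over polynomials by P(z^q) and log (1 - z^q), presented as a linear span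
    so that asymptotics need only be checked on monomials. *)
Inductive alg : fps R -> Prop :=
| alg_monomial c r i j : alg (fpsC c * dil q r (P ^+ i * L ^+ j))
| alg_add y y' : alg y -> alg y' -> alg (y + y').

Lemma alg_sum (I : Type) (s : seq I) (F : I -> fps R) :
  (forall i, alg (F i)) -> alg (\sum_(i <- s) F i).
Proof.
move=> h; elim: s => [|i s IH]; last by rewrite big_cons; apply: alg_add.
by rewrite big_nil -[0](mul0r (dil q 0 (P ^+ 0 * L ^+ 0))) -(raddf0 fpsC); apply: alg_monomial.
Qed.

Lemma alg_mul y y' : alg y -> alg y' -> alg (y * y').
Proof.
move=> ay ay'; elim: ay => [c r i j|y1 y2 _ h1 _ h2]; last first.
  by rewrite mulrDl; apply: alg_add.
elim: ay' => [c' r' i' j'|y1 y2 _ h1 _ h2]; last first.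
  by rewrite mulrDr; apply: alg_add.
have -> : fpsC c * dil q r (P ^+ i * L ^+ j) * (fpsC c' * dil q r' (P ^+ i' * L ^+ j')) =
    fpsC (c * c') * dil q (r + r') (P ^+ (i + i') * L ^+ (j + j')).
  rewrite /dil rmorphM fpsXnD /= !exprD.
  rewrite (_ : P ^+ i * P ^+ i' * (L ^+ j * L ^+ j') =
    (P ^+ i * L ^+ j) * (P ^+ i' * L ^+ j')); last by ring.
  rewrite (fpsubM (P ^+ i * L ^+ j) (P ^+ i' * L ^+ j') q0).
  move: (fpsub q _) (fpsub q _) (fpsC c) (fpsC c') (fpsXn r) (fpsXn r') => ? ? ? ? ? ?.
  by ring.
exact: alg_monomial.
Qed.

Lemma alg_mono c r : alg (fpsC c * fpsXn r).
Proof.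
have := alg_monomial c r 0 0.
by rewrite !expr0 mulr1 /dil fpsub1 // mulr1.
Qed.

Lemma alg_C c : alg (fpsC c).
Proof. by have := alg_mono c 0; rewrite fpsXn0 mulr1. Qed.

Lemma alg_1 : alg 1.
Proof. by rewrite -(rmorph1 fpsC); apply: alg_C. Qed.

Lemma alg_P : alg Pq.
Proof.
have := alg_monomial 1 0 1 0.
by rewrite rmorph1 mul1r expr0 mulr1 expr1 /dil fpsXn0 mul1r.
Qed.

Lemma alg_X y j : alg y -> alg (y ^+ j).
Proof.
move=> h; elim: j => [|j IH]; first exact: alg_1.
by rewrite exprS; apply: alg_mul.
Qed.

Lemma alg_finite g : (forall n, (q <= n)%N -> g n = 0) -> alg g.
Proof.
move=> h; have -> : g = \sum_(r < q) fpsC (g r) * fpsXn r.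
  apply/funext => n; rewrite fps_sumE; case: (ltnP n q) => hn.
    rewrite (bigD1 (Ordinal hn)) //= fpsCM fpsXnE eqxx mulr1 big1 ?addr0 // => i ne.
    rewrite fpsCM fpsXnE; case: eqP => e; rewrite ?mulr0 //.
    by move: ne; rewrite -val_eqE /= e eqxx.
  rewrite h // big1 // => i _; rewrite fpsCM fpsXnE; case: eqP => e; rewrite ?mulr0 //.
  by have := ltn_ord i; rewrite -e ltnNge hn.
by apply: alg_sum => i; apply: alg_mono.
Qed.

(** The factor [Pq ^+ i] raises the power of P in every monomial to at least i, and the coefficients
    of P^j L^l start at order n^(-j/2-1). *)
Lemma alg_asym i y : alg y ->
  exists2 G : nat -> R, asym true q G &
  \forall n \near \oo, (Pq ^+ i * y) n = x n ^+ i.+2 * G n.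
Proof.
move=> ay; elim: ay => [c r i' j|y1 y2 _ [G1 a1 h1] _ [G2 a2 h2]]; last first.
  exists (fun n => G1 n + G2 n); first exact: asymD.
  by apply: filterS2 h1 h2 => n e1 e2; rewrite mulrDr fpsDE e1 e2 mulrDr.
have [g ag hg] := @singular_asym R (i + i') j.
have [G [aG hG _]] := dil_asym r q0 ag hg.
exists (fun n => c * x n ^+ i' * (in_class q r n * G n)).
  apply: asymM => //; first by apply: asymCM => //; apply: asymX => //; exact: asym_xs.
  apply: asymM => //; apply: asym_periodic; exact: in_class_periodic.
apply: filterS hG => n hG.
have -> : Pq ^+ i * (fpsC c * dil q r (P ^+ i' * L ^+ j)) =
    fpsC c * dil q r (P ^+ (i + i') * L ^+ j).
  rewrite /dil exprD -mulrA (fpsubM (P ^+ i) _ q0) (fpsubX P i q0).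
  move: (fpsub q (P ^+ i' * _)) (Pq ^+ i) (fpsC c) (fpsXn r) => ? ? ? ?; ring.
rewrite fpsCM hG (_ : (i + i').+2 = i.+2 + i')%N; last by lia.
by rewrite exprD; ring.
Qed.

Lemma alg_bigO i y : alg y -> bigO i.+1 (Pq ^+ i * y : nat -> R).
Proof.
move=> /(alg_asym i)[G aG hG].
have h := bigOM (bigO_xs i.+1) (osc_growth q0 (aG 0%N)).
rewrite addn0 in h; apply: bigO_near h; apply: filterS hG => n ->.
by rewrite [x n ^+ i.+2]exprSr; ring.
Qed.

Lemma alg_small N i y : (2 * N <= i.+1)%N -> alg y -> fsmall N (Pq ^+ i * y).
Proof. by move=> hN ay; apply: bigO_fsmall; apply: bigO_le (alg_bigO i ay). Qed.

Lemma Pq_sqr : Pq ^+ 2 = 1 - fpsXn q.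
Proof.
by rewrite -fpsubX // sqrt1z_sqr fpsubD fpsub1 // fpsubN fpsubXn // mul1n.
Qed.

(** Since 1 - z^q = [Pq ^+ 2], dividing m times trades m orders of decay for the factor
    P(z^q)^(2m). *)
Lemma fsmall_expand N m r : (0 < N)%N -> fsmall (N + m) r ->
  exists g r', [/\ alg g, fsmall N r' & r = g + Pq ^+ (2 * m) * r'].
Proof.
move=> N0; elim: m r => [|m IH] r hr.
  exists 0, r; rewrite addn0 in hr; split=> //.
    by rewrite -(raddf0 fpsC); exact: alg_C.
  by rewrite expr0 mul1r add0r.
rewrite addnS in hr.
have [|g [hg _ [r1 hr1 ->]]] := fsmall_div q0 _ hr; first by rewrite ltn_addr.
have [g' [r' [ag' hr' ->]]] := IH _ hr1.
exists (g + Pq ^+ 2 * g'), r'; split => //.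
  apply: alg_add; first exact: alg_finite.
  by apply: alg_mul => //; apply: alg_X; exact: alg_P.
rewrite -Pq_sqr mulnS exprD.
by move: (Pq ^+ 2) (Pq ^+ (2 * m)) => u v; ring.
Qed.

(* The factor [Pq] makes [a] small in the sense that the powers of its main part
   have coefficients of arbitrarily high decay, so that [exp] can be truncated. *)
Definition inA N a := exists y rho, [/\ alg y, fsmall N rho & a = Pq * y + rho].

Lemma alg0 : alg 0. Proof. by rewrite -(raddf0 fpsC); exact: alg_C. Qed.

Lemma inA_small N a : fsmall N a -> inA N a.
Proof. by move=> h; exists 0, a; rewrite mulr0 add0r; split => //; exact: alg0. Qed.

Lemma inA_alg N y : alg y -> inA N (Pq * y).
Proof. by move=> h; exists y, 0; rewrite addr0; split => //; exact: fsmall0. Qed.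

Lemma inAD N a b : inA N a -> inA N b -> inA N (a + b).
Proof.
move=> [y [r [ay hr ->]]] [y' [r' [ay' hr' ->]]]; exists (y + y'), (r + r').
by split; [exact: alg_add | exact: fsmallD | ring].
Qed.

Lemma inACM N c a : inA N a -> inA N (fpsC c * a).
Proof.
move=> [y [r [ay hr ->]]]; exists (fpsC c * y), (fpsC c * r).
split; [by apply: alg_mul => //; exact: alg_C | exact: fsmallCM |].
by move: (fpsC c) => u; ring.
Qed.

Lemma inA_sum N (I : Type) (s : seq I) (F : I -> fps R) :
  (forall i, inA N (F i)) -> inA N (\sum_(i <- s) F i).
Proof.
move=> h; elim: s => [|i s IH]; first by rewrite big_nil; apply: inA_small; exact: fsmall0.
by rewrite big_cons; apply: inAD.
Qed.

(** The factor P(z^q)^(2N) extracted from [r] is absorbed by [Pq * y], which becomes small of order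
    N; the rest of [r] lies in the algebra. *)
Lemma inA_mul_small N y r : (2 <= N)%N -> alg y -> fsmall (2 * N) r ->
  inA N (Pq * y * r).
Proof.
move=> N2 ay hr; have N0 : (0 < N)%N by apply: leq_trans N2.
rewrite mul2n -addnn in hr.
have [g [r' [ag hr' ->]]] := fsmall_expand N0 hr.
have -> : Pq * y * (g + Pq ^+ (2 * N) * r') =
    Pq * (y * g) + (Pq ^+ (2 * N) * (Pq * y)) * r'.
  by move: (Pq ^+ (2 * N)) => u; ring.
apply: inAD; first by apply: inA_alg; exact: alg_mul.
apply: inA_small; apply: fsmallM => //; apply: alg_small; first exact: leqnSn.
by apply: alg_mul => //; exact: alg_P.
Qed.

Lemma inA_fexp N a : (2 <= N)%N -> inA (2 * N) a -> inA N (fexp a).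
Proof.
move=> N2 [y [rho [ay hr ->]]]; have N4 : (2 <= 2 * N)%N by lia.
rewrite fexpD; set E := fexp rho; have hE : fsmall (2 * N) E by apply: fsmall_fexp.
(* From j = 4N on, the factor P(z^q)^j makes the j-th power small of order 2N, so the truncated
   exponential suffices. *)
have [||C _ hC] := @fexp_small _ (2 * N) (4 * N) (Pq * y) N4; first by lia.
  move=> j /andP[hj _]; rewrite exprMn; apply: alg_small; first by lia.
  exact: alg_X.
have [C0 ht] := hC _ (leqnn _); set tau := fexp (Pq * y) - _ in ht.
have -> : fexp (Pq * y) = pexp (Pq * y) (4 * N) + tau by rewrite addrC subrK.
have [y' ay' ->] : exists2 y', alg y' & pexp (Pq * y) (4 * N) = 1 + Pq * y'.
  have: (0 < 4 * N)%N by lia.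
  case: (4 * N)%N => // J _.
  exists (\sum_(j < J) fpsC (j.+1`!%:R^-1) * (Pq ^+ j * y ^+ j.+1)).
    apply: alg_sum => j; apply: alg_mul; first exact: alg_C.
    by apply: alg_mul; apply: alg_X => //; exact: alg_P.
  rewrite /pexp big_ord_recl /= expr0 mulr1 fact0 invr1 rmorph1; congr (_ + _).
  rewrite mulr_sumr; apply: eq_bigr => j _; rewrite /bump /= add1n exprMn exprS.
  by move: (fpsC _) (Pq ^+ j) (y ^+ j.+1) => ? ? ?; ring.
have htau : fsmall (2 * N) tau by exists (C (4 * N)%N).
have -> : (1 + Pq * y' + tau) * E = (E + tau * E) + Pq * y' * E by ring.
apply: inAD; last exact: inA_mul_small.
apply: inA_small; apply: (@fsmall_le _ _ (2 * N)); first by lia.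
by apply: fsmallD => //; apply: fsmallM.
Qed.

Lemma inA_osc N a : inA N a -> osc true q (2 * N) a.
Proof.
move=> [y [rho [ay hr ->]]]; have [G aG hG] := alg_asym 1 ay.
apply: (@osc_bigO _ _ _ _ (Pq * y)).
  apply: (@osc_near _ _ _ _ (fun n => x n ^+ 3 * G n)).
    by apply: filterS hG => n; rewrite expr1.
  have : asym true q (fun n => x n ^+ 3 * G n).
    by apply: asymM => //; apply: asymX => //; exact: asym_xs.
  exact.
apply: bigO_near (bigON (fsmall_bigO hr)); apply: nearW => n.
by rewrite fpsDE opprD addrA subrr add0r.
Qed.

(* Descending induction on [i]: the series [z^r P^(i-2)(z^q)], times
   [log (1 - z^q)] if [i] is even, starts with a nonzero multiple of
   [n^(-i/2)] on the class of [r], and its next terms have larger [i]. *)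
Lemma inA_monomial N i r : (3 <= i)%N ->
  inA N (fun n => in_class q r n * x n ^+ i : R).
Proof.
have : (2 * N <= i + 2 * N)%N by exact: leq_addl.
(* [m] bounds the number of half powers between [i] and the precision. *)
move: {2}(2 * N)%N => m; elim: m i => [|m IH] i hm hi.
  apply: inA_small; apply: bigO_fsmall; rewrite addn0 in hm.
  apply: (@bigO_le _ _ i) => //.
  exists 1; apply: nearW => n; rewrite mul1r normrM (ger0_norm (xsX_ge0 n i)).
  rewrite ler_piMl ?xsX_ge0 // /in_class.
  by case: (_ == _); rewrite ?normr1 ?normr0.
have ei : (i - 2).+2 = i by lia.
have [w [c [aw c0 hw hb]]] := @free_series_asym R (i - 2).
have [G [aG hG hGw]] := dil_asym r q0 aw hb.
rewrite ei in hG.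
have [p hp hpG] := aG (2 * N).+1.
pose v : {poly R} := map_poly (horner_eval 0) (p r).
have ev_v n : ev false (p r) n = v.[x n].
  have -> : x n = horner_eval 0 (x n)%:P by rewrite /horner_eval hornerC.
  by rewrite /v horner_map.
have pE n : n = r %[mod q] -> p n = p r.
  by move=> e; rewrite (periodic_mod n hp) e -(periodic_mod r hp).
(* Otherwise G would tend to 0 along the class of r, although |G| there is at least a value of |w|,
   which tends to |c| > 0. *)
have v0 : v`_0 != 0.
  apply/eqP => v0; have := horner_xs_limit v; rewrite v0 => hv.
  have [C C0 hC] := bigO_pos hpG; have [D D0 hD] := bigO_pos hv.
  have [E E0 hE] := bigO_pos hw.
  have c2 : 0 < `|c| / 2 by rewrite divr_gt0 // normr_gt0.
  have [m1 _ hm1] : \forall n \near \oo, `|c| / 2 <= `|w n|.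
    near=> n; have h : `|w n - c| <= E * x n ^+ 1 by near: n.
    have hx : x n <= (`|c| / 2) / E by near: n; apply: near_xs_le; rewrite divr_gt0.
    have {}h : `|w n - c| <= `|c| / 2.
      by rewrite (le_trans h) // expr1 mulrC -ler_pdivlMr.
    by have := ler_distD (w n) c 0; rewrite !subr0 distrC; lra.
  have near_k : \forall n \near \oo, (m1 <= (n - r) %/ q)%N.
    by exists (r + m1 * q)%N => // n /= hn; rewrite leq_divRL //; lia.
  have [m2 _ hm2] : \forall n \near \oo, n = r %[mod q] -> False.
    near=> n => e.
    have h1 : `|G n - ev false (p n) n| <= C * x n ^+ (2 * N).+1 by near: n.
    have h2 : `|v.[x n] - 0| <= D * x n ^+ 1 by near: n.
    have h3 : n = r %[mod q] -> `|w ((n - r) %/ q)%N| <= `|G n| by near: n.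
    have h4 : (m1 <= (n - r) %/ q)%N by near: n.
    have hx : x n <= `|c| / 2 / (2 * (C + D)).
      by near: n; apply: near_xs_le; rewrite divr_gt0 // mulr_gt0 // addr_gt0.
    have h5 := le_trans (hm1 _ h4) (h3 e).
    rewrite pE // ev_v in h1; rewrite subr0 expr1 in h2.
    have h6 : C * x n ^+ (2 * N).+1 <= C * x n.
      by rewrite ler_pM2l // exprSr ler_piMl ?xs_ge0 // exprn_ile1 ?xs_ge0 ?xs_le1.
    have h7 : `|G n| <= (C + D) * x n.
      have -> : G n = (G n - v.[x n]) + v.[x n] by rewrite subrK.
      rewrite (le_trans (ler_normD _ _)) // mulrDl lerD //; exact: le_trans h6.
    rewrite ler_pdivlMr ?mulr_gt0 ?addr_gt0 // in hx.
    have h8 : `|c| / 2 <= (C + D) * x n by exact: le_trans h7.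
    have h9 : x n * (2 * (C + D)) = 2 * ((C + D) * x n) by ring.
    by rewrite h9 in hx; exact: double_le_absurd c2 h8 hx.
  by apply: (hm2 (r + m2 * q)%N); [rewrite /= (leq_trans _ (leq_addl _ _)) // leq_pmulr
    | rewrite addnC modnMDl].
pose b := dil q r (free_series (i - 2)) : fps R.
have hbA : inA N b.
  have -> : b = Pq * dil q r (P ^+ (i - 3) * L ^+ (~~ odd (i - 2))).
    rewrite /b /free_series /dil (_ : (i - 2 = (i - 3).+1)%N) /=; last by lia.
    rewrite exprS -[P * _ * _]mulrA (fpsubM P _ q0).
    by move: (fpsub q _) => u; ring.
  apply: inA_alg; have := alg_monomial 1 r (i - 3) (~~ odd (i - 2)).
  by rewrite rmorph1 mul1r.
(* The terms of the expansion of [b] after the leading one, covered by the induction hypothesis. *)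
pose S : fps R := \sum_(j < (size v).-1)
  fpsC (v`_j.+1) * (fun n => in_class q r n * x n ^+ (i + j.+1)).
have hS : inA N S.
  by apply: inA_sum => j; apply: inACM; apply: IH; lia.
pose e : fps R := fun n => v`_0 * (in_class q r n * x n ^+ i) - b n + S n.
have he : inA N e.
  apply: inA_small; apply: bigO_fsmall; have [C hC] := hpG.
  exists `|C|; near=> n.
  have hb1 : b n = x n ^+ i * (in_class q r n * G n) by near: n.
  have h1 : `|G n - ev false (p n) n| <= C * x n ^+ (2 * N).+1 by near: n.
  have -> : e n = x n ^+ i * (in_class q r n * (v.[x n] - G n)).
    rewrite /e hb1 /S fps_sumE (horner_coef_wide _ (leqSpred _)).
    rewrite big_ord_recl expr0 mulr1 /=.
    rewrite (eq_bigr (fun j : 'I_(size v).-1 => in_class q r n * x n ^+ i *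
      (v`_j.+1 * x n ^+ j.+1))); last first.
      by move=> j _; rewrite fpsCM exprD; ring.
    rewrite -mulr_sumr; under [in RHS]eq_bigr => j _ do rewrite /bump /= add1n.
    by move: (\sum_(_ < _) _) => u; ring.
  rewrite /in_class; have [e0|_] := boolP (n == r %[mod q]); last first.
    by rewrite mul0r mulr0 normr0; apply: mulr_ge0 => //; exact: xsX_ge0.
  rewrite pE ?(eqP e0) // ev_v in h1.
  rewrite mul1r normrM distrC (ger0_norm (xsX_ge0 n i)).
  apply: (@le_trans _ _ (1 * (C * x n ^+ (2 * N).+1))).
    apply: ler_pM => //; first exact: xsX_ge0.
    by rewrite exprn_ile1 ?xs_ge0 ?xs_le1.
  rewrite mul1r; apply: (@le_trans _ _ (`|C| * x n ^+ (2 * N).+1)).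
    by rewrite ler_wpM2r ?xsX_ge0 // ler_norm.
  by rewrite ler_wpM2l // ler_wiXn2l ?xs_ge0 ?xs_le1.
have -> : (fun n => in_class q r n * x n ^+ i) =
    fpsC (v`_0)^-1 * (b + fpsC (-1) * S + e).
  apply/funext => n; rewrite fpsCM !fpsDE fpsCM mulN1r /e.
  move: (S n) (b n) => u u'; field.
  exact: v0.
by apply: inACM; apply: inAD => //; apply: inAD => //; apply: inACM.
Unshelve. all: by end_near. Qed.

(** The converse of [alg_asym], up to a small error: the powers of t_n, known only through their
    expansions, enter the algebra in this way. *)
Lemma inA_of_asym N a (f : nat -> R) : asym false q f ->
  (\forall n \near \oo, a n = x n ^+ 3 * f n) -> inA N a.
Proof.
move=> af ha; have [p hp hf] := af (2 * N)%N.
pose M : fps R := \sum_(r < q) \sum_(j < size (p r))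
  fpsC ((p r)`_j).[0] * (fun n => in_class q r n * x n ^+ (3 + j)).
have hM : inA N M.
  apply: inA_sum => r; apply: inA_sum => j; apply: inACM; apply: inA_monomial; lia.
have -> : a = M + (a - M) by rewrite addrC subrK.
apply: inAD => //; apply: inA_small; apply: bigO_fsmall.
apply: (@bigO_le _ _ (3 + 2 * N)); first by lia.
apply: bigO_near (bigOM (bigO_xs 3) hf); apply: filterS ha => n ha.
rewrite fpsBE ha mulrBr; congr (_ - _).
rewrite /M fps_sumE (bigD1 (Ordinal (ltn_pmod n q0))) //=.
rewrite [X in _ + X]big1 ?addr0 => [|r ne].
  rewrite fps_sumE (periodic_mod n hp) ev_coef mulr_sumr; apply: eq_bigr => j _.
  by rewrite fpsCM /in_class modn_mod eqxx mul1r exprD /lam; ring.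
rewrite fps_sumE big1 // => j _; rewrite fpsCM /in_class.
rewrite (_ : (n == r %[mod q]) = false) ?mul0r ?mulr0 //.
apply/negbTE; apply: contra ne => /eqP e; rewrite -val_eqE /= e modn_small //.
Qed.

End SingularAlgebra.

(** * Values at z = 1 and the leading term *)

Section ValueAtOne.
Context {R : realType}.
Implicit Types (a b h : fps R).
Notation x := (@xs R).
Notation P := (@sqrt1z R).
Notation Z := (@fpsXn R 1).

(* The value of the series at [z = 1]. *)
Definition eps a : R := limn (series a).

Lemma fpsXn1_div N a : (0 < N)%N -> fsmall N.+1 a ->
  series a @ \oo --> eps a /\
  exists2 a', fsmall N a' & a = fpsC (eps a) + (1 - Z) * a'.
Proof.
move=> N0 ha; have [g [g0 g1 [a' ha' e]]] := fsmall_div (ltn0Sn 0) N0 ha.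
have c := g1 erefl; have ee : eps a = g 0%N by apply/cvg_lim.
rewrite ee; split => //; exists a' => //; rewrite {1}e; congr (_ + _).
by apply/funext => -[|n]; rewrite fpsCE //= g0.
Qed.

Lemma eps_cvg a : fsmall 2 a -> series a @ \oo --> eps a.
Proof. by move=> h; have [] := @fpsXn1_div 1 a isT h. Qed.

Lemma eps_bound a C : 0 <= C -> fbound C 2 a -> `|eps a| <= C * 2.
Proof.
move=> C0 h; have c : series a @ \oo --> eps a by apply: eps_cvg; exists C.
have b n : `|series a n| <= C * 2.
  rewrite /series /= big_mkord (le_trans (ler_norm_sum _ _ _)) //.
  apply: (@le_trans _ _ (\sum_(k < n) C * k.+1%:R ^- 2)).
    by apply: ler_sum => k _; exact: h.
  by rewrite -mulr_sumr ler_wpM2l // sum_inv_sqr.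
rewrite ler_norml; apply/andP; split.
  apply: limr_ge; first exact: cvgP c.
  by apply: nearW => n; have := b n; rewrite ler_norml => /andP[].
apply: limr_le; first exact: cvgP c.
by apply: nearW => n; have := b n; rewrite ler_norml => /andP[].
Qed.

Lemma epsP a (l : R) : series a @ \oo --> l -> eps a = l.
Proof. by move=> h; apply/cvg_lim. Qed.

Lemma seriesD a b n : series (a + b : fps R) n = series a n + series b n.
Proof. by rewrite /series /= -big_split. Qed.

Lemma epsD a b : fsmall 2 a -> fsmall 2 b -> eps (a + b) = eps a + eps b.
Proof.
move=> /eps_cvg ha /eps_cvg hb; apply: epsP.
rewrite (_ : series _ = series a \+ series b); first exact: cvgD.
by apply/funext => n; rewrite seriesD.
Qed.

Lemma epsCM c a : fsmall 2 a -> eps (fpsC c * a) = c * eps a.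
Proof.
move=> /eps_cvg ha; apply: epsP.
rewrite (_ : series _ = fun n => c * series a n); first by apply: cvgM => //; exact: cvg_cst.
apply/funext => n; rewrite /series /= mulr_sumr.
by apply: eq_bigr => i _; rewrite fpsCM.
Qed.

Lemma epsN a : fsmall 2 a -> eps (- a) = - eps a.
Proof. by move=> h; rewrite -mulN1r -(rmorphN1 fpsC) epsCM // mulN1r. Qed.

Lemma eps0 : eps 0 = 0.
Proof.
apply: epsP; rewrite (_ : series _ = cst 0); first exact: cvg_cst.
by apply/funext => n; rewrite /series /= big1.
Qed.

Lemma eps_sum (I : Type) (s : seq I) (F : I -> fps R) :
  (forall i, fsmall 2 (F i)) -> eps (\sum_(i <- s) F i) = \sum_(i <- s) eps (F i).
Proof.
move=> h; elim: s => [|i s IH]; first by rewrite !big_nil eps0.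
by rewrite !big_cons epsD ?IH //; apply: fsmall_sum.
Qed.

(** The partial sums of (1 - z) a are the coefficients of a. *)
Lemma eps_telescope a : a @ \oo --> 0 -> eps ((1 - Z) * a) = 0.
Proof.
move=> h; apply: epsP; rewrite -cvg_shiftS.
rewrite (_ : (fun n => _) = a) // ; apply/funext => n.
rewrite /series /=; elim: n => [|n IH].
  by rewrite big_nat1 mulrBl mul1r fpsBE fpsXn1M0 subr0.
by rewrite big_nat_recr //= IH mulrBl mul1r fpsBE fpsXn1M addrC subrK.
Qed.

Lemma fsmall_cvg0 N a : (0 < N)%N -> fsmall N a -> a @ \oo --> 0.
Proof.
move=> N0 /fsmall_bigO h; apply: bigO_cvg0; apply: bigO_le h; lia.
Qed.

Lemma eps_C c : eps (fpsC c) = c.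
Proof.
apply: epsP; rewrite -cvg_shiftS (_ : (fun n => _) = cst c); first exact: cvg_cst.
apply/funext => n; rewrite /series /= big_nat_recl //.
by rewrite big1 ?addr0 ?fpsCE // => i _; rewrite fpsCE.
Qed.

(** Writing a = eps a + (1 - z) a', and b likewise, the product is the constant eps a eps b plus a
    multiple of 1 - z, on which [eps] vanishes. The order 3 leaves a' and b' of order 2 after
    division. *)
Lemma epsM a b : fsmall 3 a -> fsmall 3 b -> eps (a * b) = eps a * eps b.
Proof.
move=> /(@fpsXn1_div 2 _ isT)[_ [a' ha' ea]] /(@fpsXn1_div 2 _ isT)[_ [b' hb' eb]].
set al := eps a in ea *; set be := eps b in eb *.
set s := fpsC al * b' + fpsC be * a' + (1 - Z) * (a' * b').
have hs : fsmall 2 s.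
  apply: fsmallD; first by apply: fsmallD; apply: fsmallCM.
  apply: fsmallM => //; last exact: fsmallM.
  by apply: fsmallD; [exact: fsmall1 | apply: fsmallN; exact: fsmallXn].
have -> : a * b = fpsC (al * be) + (1 - Z) * s.
  by rewrite ea eb /s rmorphM /=; move: (fpsC al) (fpsC be) => u v; ring.
have hs2 : fsmall 2 ((1 - Z) * s).
  apply: fsmallM => //.
  by apply: fsmallD; [exact: fsmall1 | apply: fsmallN; exact: fsmallXn].
rewrite epsD; [|exact: fsmallC|exact: hs2].
rewrite eps_C eps_telescope ?addr0 //.
exact: (@fsmall_cvg0 2).
Qed.

Lemma fsmall_sub N a b : fsmall N a -> fsmall N b -> fsmall N (a - b).
Proof. by move=> ha hb; apply: fsmallD => //; apply: fsmallN. Qed.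

(** By multiplicativity [eps] maps truncated exponentials to partial sums of [expR]; the vanishing
    constants of [fexp_small] permit passing to the limit. *)
Lemma eps_fexp h : fsmall 3 h -> eps (fexp h) = expR (eps h).
Proof.
move=> hh.
have hX j : fsmall 3 (h ^+ j) by apply: fsmallX.
have epsX j : eps (h ^+ j) = eps h ^+ j.
  elim: j => [|j IH]; first by rewrite !expr0 -(rmorph1 fpsC) eps_C.
  by rewrite !exprS epsM // IH.
have f2 a : fsmall 3 a -> fsmall 2 a by apply: fsmall_le.
have hp J : fsmall 3 (pexp h J) by apply: fsmall_sum => j _; apply: fsmallCM.
have ep J : eps (pexp h J) = series (exp_coeff (eps h)) J.
  rewrite /pexp eps_sum => [|j]; last by apply: f2; apply: fsmallCM.
  rewrite /series /= big_mkord; apply: eq_bigr => j _.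
  by rewrite epsCM ?epsX 1?mulrC //; apply: f2.
have [|C C0 hC] := @fexp_small _ 3 1 h isT isT; first by move=> j _.
have hf : fsmall 3 (fexp h) by apply: fsmall_fexp.
have c1 : (fun J => eps (pexp h J)) @ \oo --> expR (eps h).
  rewrite (_ : (fun J => _) = series (exp_coeff (eps h))).
    exact: is_cvg_series_exp_coeff.
  by apply/funext => J; rewrite ep.
have c2 : (fun J => eps (pexp h J)) @ \oo --> eps (fexp h).
  have c3 : (fun J => C J * 2) @ \oo --> 0.
    by rewrite -(mul0r 2); apply: cvgM => //; exact: cvg_cst.
  apply/cvgrPdist_le => e e0; move/cvgrPdist_le: c3 => /(_ e e0) c3.
  near=> J; have J1 : (1 <= J)%N by near: J; exact: nbhs_infty_ge.
  have [C0J hCJ] := hC J J1.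
  have -> : eps (fexp h) - eps (pexp h J) = eps (fexp h - pexp h J).
    by rewrite epsD ?epsN //; apply: f2 => //; apply: fsmallN.
  have b2 : fbound (C J) 2 (fexp h - pexp h J).
    move=> n; apply: (le_trans (hCJ n)); rewrite ler_wpM2l //; exact: natSXV_le.
  apply: (le_trans (eps_bound C0J b2)).
  have : `|0 - C J * 2| <= e by near: J.
  by rewrite sub0r normrN; apply: le_trans; exact: ler_norm.
exact: cvgn_uniq c2 c1.
Unshelve. all: by end_near. Qed.

Notation t := (@tcat R).

Lemma tcat_sqrt1z : t = fpsC 2^-1 - fpsC 2^-1 * P.
Proof.
apply/funext => -[|n]; rewrite fpsBE fpsCM fpsCE.
  by rewrite sqrt1z0 tcat0 mulr1 subrr.
by rewrite sqrt1zE /=; field.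
Qed.

Lemma sqrt1z_cube_small : fsmall 2 (P ^+ 3).
Proof.
apply: bigO_fsmall.
have := @alg_bigO R 1 isT 3 1 (@alg_1 R 1 isT).
rewrite mulr1 (_ : fpsub 1 P = P) //.
by apply/funext => n; rewrite fpsubE dvd1n divn1.
Qed.

(* Transfer at the dominant singularity: [h] is regular enough at [z = 1] to
   be replaced there by its value. *)
Lemma fexp_lead h : fsmall 3 h ->
  fsmall 2 (fexp (t + h) - fpsC (expR (2^-1 + eps h)) * t).
Proof.
move=> hh; set X := - (fpsC 2^-1 * P).
have eX j : X ^+ j = fpsC ((- 2^-1) ^+ j) * P ^+ j.
  by rewrite /X -mulNr -rmorphN exprMn rmorphXn.
have P2 : fsmall 2 (P ^+ 2).
  by rewrite sqrt1z_sqr; apply: fsmall_sub; [exact: fsmall1 | exact: fsmallXn].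
have P1 : fpsub 1 P = P by apply/funext => n; rewrite fpsubE dvd1n divn1.
have [|C _ hC] := @fexp_small _ 2 4 X isT isT.
  move=> j /andP[j4 _]; rewrite eX; apply: fsmallCM.
  have := @alg_small R 1 isT 2 j 1 _ (@alg_1 R 1 isT).
  by rewrite mulr1 P1; apply; apply: leqW.
have [C0 htau] := hC 4%N (leqnn 4); set tau := fexp X - _ in htau.
have stau : fsmall 2 tau by exists (C 4%N).
(* exp (-P/2) without its linear term. As P^2 is a polynomial and P^3 has coefficients O(n^-2), only
   -P/2 has coefficients of order n^(-3/2). *)
set A := 1 + fpsC 8^-1 * P ^+ 2 + (fpsC (- 48^-1) * P ^+ 3 + tau).
have sA : fsmall 2 A.
  apply: fsmallD; first by apply: fsmallD; [exact: fsmall1 | exact: fsmallCM].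
  by apply: fsmallD => //; apply: fsmallCM; exact: sqrt1z_cube_small.
have eF : fexp X = X + A.
  have -> : fexp X = pexp X 4 + tau by rewrite addrC subrK.
  have e j : fpsC (j`!%:R^-1) * X ^+ j = fpsC (j`!%:R^-1 * (- 2^-1) ^+ j) * P ^+ j.
    by rewrite eX mulrA -rmorphM.
  rewrite /pexp !big_ord_recr big_ord0 /= add0r (e 0%N) (e 1%N) (e 2) (e 3) expr0 mulr1 /X /A.
  have -> : 0`!%:R^-1 * (- 2^-1) ^+ 0 = 1 :> R by rewrite expr0 mulr1; apply: invr1.
  have -> : 1`!%:R^-1 * (- 2^-1) ^+ 1 = - 2^-1 :> R.
    by rewrite expr1 -[RHS]mul1r; congr (_ * _); apply: invr1.
  have -> : 2`!%:R^-1 * (- 2^-1) ^+ 2 = 8^-1 :> R by rewrite (_ : 2`! = 2)%N //; field.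
  have -> : 3`!%:R^-1 * (- 2^-1) ^+ 3 = - 48^-1 :> R by rewrite (_ : 3`! = 6)%N //; field.
  rewrite rmorph1 !rmorphN /=.
  by move: (fpsC 2^-1) (fpsC 8^-1) (fpsC 48^-1) => u v w; ring.
have hF : fsmall 3 (fexp h) by apply: fsmall_fexp.
have [_ [b' hb' eh]] := @fpsXn1_div 2 _ isT hF.
rewrite eps_fexp // in eh.
have eT : t + h = fpsC 2^-1 + (X + h) by rewrite tcat_sqrt1z /X; ring.
rewrite eT !fexpD fexp_C expRD rmorphM /= eF eh tcat_sqrt1z -sqrt1z_sqr /X.
set c1 := fpsC (expR 2^-1); set ce := fpsC (expR (eps h)); set ch := fpsC 2^-1.
have -> : c1 * ((- (ch * P) + A) * (ce + P ^+ 2 * b')) - c1 * ce * (ch - ch * P) =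
    c1 * (ce * A + (A * P ^+ 2 * b' - ch * (P ^+ 3 * b') - ce * ch)).
  by move: c1 ce ch => u v w; ring.
apply: fsmallCM; apply: fsmallD; first exact: fsmallCM.
apply: fsmall_sub; last by apply: fsmallCM; exact: fsmallC.
apply: fsmall_sub; first by apply: fsmallM => //; apply: fsmallM.
by apply: fsmallCM; apply: fsmallM => //; exact: sqrt1z_cube_small.
Qed.

End ValueAtOne.

(** * Infinite sums of dilated series *)

Section Combination.
Context {R : realType}.
Implicit Types (a : nat -> fps R).
Notation x := (@xs R).

Lemma pow_le_exp2 N : exists2 K : R, 0 <= K & forall m, m.+1%:R ^+ N <= K * 2 ^+ m.
Proof.
have l2 : 0 < ln 2 :> R by apply: ln_gt0; rewrite ltr1n.
exists (2 * N`!%:R / ln 2 ^+ N); first by rewrite !mulr_ge0 ?invr_ge0 ?exprn_ge0 // ltW.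
move=> m; have y0 : 0 <= m.+1%:R * ln 2 :> R by rewrite mulr_ge0 // ltW.
have h : (m.+1%:R * ln 2) ^+ N / N`!%:R <= 2 ^+ m.+1 :> R.
  have -> : 2 ^+ m.+1 = expR (m.+1%:R * ln 2) :> R.
    by rewrite expRM_natl lnK // posrE.
  have := exp_tail_ge0 N.+1 y0; rewrite subr_ge0; apply: le_trans.
  rewrite /series /= big_nat_recr //= lerDr sumr_ge0 // => i _.
  exact: exp_coeff_ge0.
rewrite ler_pdivrMr ?ltr0n ?fact_gt0 // exprMn -ler_pdivlMr ?exprn_gt0 // in h.
rewrite (_ : _ * 2 ^+ m = 2 ^+ m.+1 * N`!%:R / ln 2 ^+ N) //.
by rewrite exprS; ring.
Qed.

Lemma geometric_tail M J : (M <= J)%N ->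
  \sum_(M <= m < J) (2 ^- m : R) <= 2 * 2 ^- M.
Proof.
move=> MJ; suff h : \sum_(M <= m < J) (2 ^- m : R) <= 2 * 2 ^- M - 2 * 2 ^- J.
  by rewrite (le_trans h) // gerBl mulr_ge0 // invr_ge0 exprn_ge0.
rewrite -(subnK MJ); elim: (J - M)%N => [|i IH]; first by rewrite add0n big_geq // subrr.
rewrite addSn big_nat_recr ?leq_addl //= (le_trans (lerD IH (lexx _))) //.
have -> : 2 * 2 ^- (i + M).+1 = 2 ^- (i + M) :> R.
  by rewrite exprS invfM mulrA divff ?pnatr_eq0 // mul1r.
by move: (2 ^- M : R) (2 ^- (i + M) : R) => u v; lra.
Qed.

(* The series [sum_(m >= M) a_m(z^m)]; the sum defining a coefficient is finite
   as [a_m] will have no constant term. *)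
Definition hcomb a (M : nat) : fps R :=
  fun k => \sum_(M <= m < k.+1) fpsub m (a m) k.

Definition dbound (C : R) (N M : nat) a := forall m, (M <= m)%N ->
  forall n, (0 < n)%N -> `|a m n| <= C * n%:R ^- N * 4 ^- m.

Section Fixed.
Variable a : nat -> fps R.
Hypothesis a0 : forall m, (0 < m)%N -> a m 0%N = 0.

(** The factor 4^-m is split into two factors 2^-m: one compensates the loss m^N incurred in passing
    from n^-N to (nm)^-N, the other sums geometrically over m >= M. *)
Lemma hcomb_bound C N : 0 <= C -> exists2 K : R, 0 <= K &
  forall M, (0 < M)%N -> dbound C N M a -> fbound (K * 2 ^- M) N (hcomb a M).
Proof.
move=> C0; have [K K0 hK] := pow_le_exp2 N.
exists (C * 2 ^+ N * K * 2); first by rewrite !mulr_ge0 ?exprn_ge0.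
move=> M M0 h k; rewrite /hcomb; case: (leqP M k.+1) => hMk; last first.
  rewrite big_geq ?(ltnW hMk) // normr0 !mulr_ge0 ?invr_ge0 ?exprn_ge0 //.
apply: (le_trans (ler_norm_sum _ _ _)).
apply: (@le_trans _ _ (\sum_(M <= m < k.+1) C * 2 ^+ N * K * k.+1%:R ^- N * 2 ^- m)).
  apply: ler_sum_nat => m /andP[Mm mk]; rewrite fpsubE.
  have m0 : (0 < m)%N by apply: leq_trans Mm.
  have rhs0 : 0 <= C * 2 ^+ N * K * k.+1%:R ^- N * 2 ^- m.
    by rewrite !mulr_ge0 ?invr_ge0 ?exprn_ge0.
  case: ifP => [/dvdnP[n ek]|]; last by rewrite normr0.
  rewrite ek in rhs0 *; rewrite mulnK //.
  case: n {ek} rhs0 => [|n] rhs0; first by rewrite a0 // normr0.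
  apply: (le_trans (h m Mm _ (ltn0Sn n))).
  set n1 := n.+1; have s0 := natSX_gt0 (R := R) (n1 * m) N.
  have hs : (n1 * m).+1%:R ^+ N <= 2 ^+ N * (K * 2 ^+ m) * n1%:R ^+ N :> R.
    apply: (@le_trans _ _ ((2 * m%:R * n1%:R) ^+ N)).
      rewrite lerXn2r ?nnegrE ?mulr_ge0 // -!natrM ler_nat; lia.
    rewrite !exprMn ler_wpM2r ?exprn_ge0 // ler_wpM2l ?exprn_ge0 //.
    case: m m0 {Mm rhs0 s0 h mk} => // m _; apply: (le_trans (hK m)).
    by rewrite ler_wpM2l // ler_weXn2l // ?ler1n.
  have e4 : 4 ^- m = 2 ^- m * 2 ^- m :> R.
    by rewrite -invfM -exprMn -natrM.
  have n10 : n1%:R != 0 :> R by rewrite pnatr_eq0.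
  have two0 : 2 ^+ m != 0 :> R by rewrite expf_neq0 // pnatr_eq0.
  have n1N : n1%:R ^+ N != 0 :> R by rewrite expf_neq0.
  rewrite -!mulrA ler_wpM2l // !mulrA e4.
  rewrite -(ler_pM2r s0) [leRHS](_ : _ = 2 ^+ N * K * 2 ^- m); last first.
    by field; rewrite two0 /= gt_eqF // -natrM nat1r ltr0n.
  apply: (le_trans (ler_wpM2l _ hs)); first by rewrite !mulr_ge0 ?invr_ge0 ?exprn_ge0.
  rewrite [leLHS](_ : _ = 2 ^+ N * K * 2 ^- m) //; field.
  by rewrite n1N two0.
rewrite -mulr_sumr (le_trans (ler_wpM2l _ (geometric_tail hMk))) //.
  by rewrite !mulr_ge0 ?invr_ge0 ?exprn_ge0.
rewrite le_eqVlt; apply/orP; left; apply/eqP; ring.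
Qed.

Lemma hcomb_rec M : (0 < M)%N -> hcomb a M = fpsub M (a M) + hcomb a M.+1.
Proof.
move=> M0; apply/funext => k; rewrite fpsDE /hcomb; case: (leqP M k) => h.
  by rewrite big_ltn.
rewrite !big_geq // ?addr0; last exact: ltnW.
rewrite fpsubE; case: ifP => // /dvdnP[n e]; case: n e => [|n] e.
  by rewrite e mul0n div0n a0.
by move: h; rewrite e mulSn ltnNge leq_addr.
Qed.

Lemma hcomb_split M J : (0 < M)%N -> (M <= J)%N ->
  hcomb a M = \sum_(M <= m < J) fpsub m (a m) + hcomb a J.
Proof.
move=> M0 MJ; rewrite -(subnK MJ); elim: (J - M)%N => [|i IH].
  by rewrite add0n big_geq // add0r.
rewrite addSn big_nat_recr ?leq_addl //= IH hcomb_rec ?addrA //.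
by rewrite (leq_trans M0) // leq_addl.
Qed.

Lemma hcomb_small C N M : 0 <= C -> (0 < M)%N -> dbound C N M a ->
  fsmall N (hcomb a M).
Proof.
move=> C0 M0 h; have [K K0 hK] := hcomb_bound N C0.
exists (K * 2 ^- M); last exact: hK.
by rewrite mulr_ge0 // invr_ge0 exprn_ge0.
Qed.

Lemma dboundW C N M M' : (M <= M')%N -> dbound C N M a -> dbound C N M' a.
Proof. by move=> le h m hm; apply: h; apply: leq_trans hm. Qed.

Lemma fpsub_small C N m : 0 <= C -> (0 < m)%N -> dbound C N m a ->
  fsmall N (fpsub m (a m)).
Proof.
move=> C0 m0 h; have e := hcomb_rec m0.
have -> : fpsub m (a m) = hcomb a m - hcomb a m.+1 by rewrite e addrK.
by apply: fsmall_sub; apply: (hcomb_small C0) => //; apply: dboundW h.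
Qed.

Lemma eps_fpsub C m : 0 <= C -> (0 < m)%N -> dbound C 2 m a ->
  series (a m) @ \oo --> eps (fpsub m (a m)).
Proof.
move=> C0 m0 h; rewrite -cvg_shiftS.
have := eps_cvg (fpsub_small C0 m0 h); move: (eps _) => l hl.
apply/cvgrPdist_le => e e0; move/cvgrPdist_le: hl => /(_ e e0)[n0 _ hn].
exists n0 => // n /= n0n; have := hn (n * m).+1.
rewrite /series /= -(sum_multiples n (a m) m0).
rewrite (eq_bigr (fpsub m (a m))) => [|k _]; last by rewrite fpsubE.
by apply; rewrite /= leqW // (leq_trans n0n) // leq_pmulr.
Qed.

(** Exchange of the sums over m and n, justified by the bound K 2^-J on the terms m >= J. *)
Lemma eps_hcomb C M : 0 <= C -> (0 < M)%N -> dbound C 2 M a ->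
  (fun J => \sum_(M <= m < J) limn (series (a m))) @ \oo --> eps (hcomb a M).
Proof.
move=> C0 M0 h; have [K K0 hK] := hcomb_bound 2 C0.
have tail0 : (fun J => K * 2 ^- J * 2 : R) @ \oo --> 0.
  rewrite -(mul0r 2); apply: cvgM; last exact: cvg_cst.
  rewrite -(mulr0 K); apply: cvgM; first exact: cvg_cst.
  under eq_fun do rewrite -exprVn; apply: cvg_expr.
  by rewrite ger0_norm ?invr_ge0 // invf_lt1 ?ltr1n // ltr0n.
apply/cvgrPdist_le => e e0; move/cvgrPdist_le: tail0 => /(_ e e0) tail0.
near=> J; have MJ : (M <= J)%N by near: J; exact: nbhs_infty_ge.
have fs m : fsmall 2 (if (M <= m)%N then fpsub m (a m) else 0).
  case: leqP => hm; last exact: fsmall0.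
  by apply: (fpsub_small C0) (dboundW hm h); apply: leq_trans hm.
have eS : \sum_(M <= m < J) fpsub m (a m) =
    \sum_(M <= m < J) (if (M <= m)%N then fpsub m (a m) else 0).
  by apply: eq_big_nat => m /andP[-> _].
have -> : \sum_(M <= m < J) limn (series (a m)) =
    eps (\sum_(M <= m < J) fpsub m (a m)).
  rewrite eS eps_sum //; apply: eq_big_nat => m /andP[hm _]; rewrite hm.
  by apply/cvg_lim => //; apply: (eps_fpsub C0) (dboundW hm h); apply: leq_trans hm.
have J0 : (0 < J)%N by apply: leq_trans MJ.
have hJ := dboundW MJ h.
rewrite (hcomb_split M0 MJ) epsD; last exact: (hcomb_small C0 J0 hJ).
  rewrite addrC addKr (le_trans (eps_bound _ (hK J J0 hJ))) //.
    by rewrite mulr_ge0 // invr_ge0 exprn_ge0.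
  have : `|0 - K * 2 ^- J * 2| <= e by near: J.
  by rewrite sub0r normrN; apply: le_trans; exact: ler_norm.
by rewrite eS; apply: fsmall_sum.
Unshelve. all: by end_near. Qed.

(** The coefficients live on the multiples of m, whose indicator is q-periodic because m divides
    q. *)
Lemma fpsub_inA q m N (f : nat -> R) : (0 < q)%N -> (0 < m)%N -> (m %| q)%N ->
  asym false 1 f -> (\forall n \near \oo, a m n = x n ^+ 3 * f n) ->
  inA q N (fpsub m (a m)).
Proof.
move=> q0 m0 mq af hf; have [G [aG hG _]] := dil_asym 0 m0 af hf.
apply: (@inA_of_asym _ _ q0 _ _ (fun n => in_class m 0 n * G n)).
  apply: (asym_dvd mq); apply: asymM => //; apply: asym_periodic.
  exact: in_class_periodic.
by apply: filterS hG => n; rewrite /dil fpsXn0 mul1r.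
Qed.

(** Every m < M divides (M - 1)!, while the terms m >= M together are already small of order 2N. *)
Lemma fexp_hcomb_osc C N M : (2 <= N)%N -> 0 <= C -> (0 < M)%N ->
  dbound C (2 * N) M a ->
  (forall m, (0 < m)%N -> exists2 f : nat -> R, asym false 1 f &
     \forall n \near \oo, a m n = x n ^+ 3 * f n) ->
  osc true (M.-1)`! (2 * N) (fexp (hcomb a 1)).
Proof.
move=> N2 C0 M0 hM ha; have q0 := fact_gt0 M.-1.
apply: inA_osc => //; apply: inA_fexp => //; rewrite (hcomb_split (ltn0Sn 0) M0).
apply: inAD; last by apply: (inA_small q0); exact: (hcomb_small C0 M0 hM).
rewrite big_nat_cond big_mkcond; apply: (inA_sum q0) => //= m.
case: ifP => [/andP[/andP[m0 mM] _]|_]; last by apply: (inA_small q0); exact: fsmall0.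
have [f af hf] := ha m m0; apply: (fpsub_inA _ q0 m0 _ af hf).
by rewrite dvdn_fact // m0 -ltnS prednK.
Qed.

End Fixed.
End Combination.

(** * The two generating functions *)

Section TwoFamilies.
Context {R : realType}.
Notation x := (@xs R).
Notation t := (@tcat R).
Notation P := (@sqrt1z R).

Lemma tcat_asym : exists w (c : R), [/\ asym false 1 w, c != 0,
  bigO 1 (fun n => w n - c) & \forall n \near \oo, t n = x n ^+ 3 * w n].
Proof.
have [w [c [aw c0 hw hP]]] := @free_series_asym R 1.
exists (fun n => - 2^-1 * w n), (- 2^-1 * c); split.
- exact: asymCM.
- by rewrite mulf_neq0 // oppr_eq0 invr_eq0 pnatr_eq0.
- by apply: bigO_near (bigOM (bigO_cst (- 2^-1)) hw); apply: nearW => n; ring.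
near=> n; have n0 : (0 < n)%N by near: n; exact: near_gt0.
have h : free_series 1 n = x n ^+ 3 * w n by near: n.
rewrite mulrCA -h /free_series /= expr1 expr0 mulr1.
by case: (n) n0 => // m _; rewrite sqrt1zE; field.
Unshelve. all: by end_near. Qed.

Definition distinct_log (m : nat) : fps R :=
  fun n => (-1) ^+ m.-1 / m%:R * t n ^+ m.

Definition forest_log (m : nat) : fps R :=
  fun n => m%:R^-1 * (t n * 4 ^+ n * 4 ^- (n * m)).

Lemma distinct_log0 m : (0 < m)%N -> distinct_log m 0%N = 0.
Proof. by case: m => // m _; rewrite /distinct_log tcat0 expr0n mulr0. Qed.

Lemma forest_log0 m : (0 < m)%N -> forest_log m 0%N = 0.
Proof. by move=> _; rewrite /forest_log tcat0 !mul0r mulr0. Qed.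

Lemma distinct_log1 : distinct_log 1 = t.
Proof. by apply/funext => n; rewrite /distinct_log /= divr1 mul1r expr1. Qed.

Lemma forest_log1 : forest_log 1 = t.
Proof.
by apply/funext => n; rewrite /forest_log invr1 mul1r muln1 mulfK // expf_neq0 // pnatr_eq0.
Qed.

Lemma inv_nat_le1 m : m%:R^-1 <= 1 :> R.
Proof.
case: m => [|m]; first by rewrite invr0.
by rewrite invf_le1 ?ler1n ?ltr0n.
Qed.

Lemma distinct_log_le m n : `|distinct_log m n| <= t n ^+ m.
Proof.
rewrite /distinct_log !normrM normrX normrN1 expr1n mul1r normfV normr_nat.
by rewrite normrX (ger0_norm (tcat_ge0 n)) ler_piMl ?inv_nat_le1 // exprn_ge0 // tcat_ge0.
Qed.

Lemma tcatX_le m n : (0 < n)%N -> t n ^+ m <= n%:R ^- m * 4 ^- m.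
Proof.
move=> n0; apply: (@le_trans _ _ ((4 * n%:R)^-1 ^+ m)).
  by rewrite lerXn2r ?nnegrE ?tcat_ge0 ?tcat_le // invr_ge0 mulr_ge0.
by rewrite invfM exprMn !exprVn mulrC.
Qed.

(** Order N is reached only for m >= N, so the period must grow with the precision. *)
Lemma distinct_log_bound N : dbound 1 N N distinct_log.
Proof.
move=> m Nm n n0; apply: (le_trans (distinct_log_le m n)).
apply: (le_trans (tcatX_le m n0)).
rewrite mul1r ler_wpM2r ?invr_ge0 ?exprn_ge0 //.
by case: n n0 => // n _; exact: natSXV_le.
Qed.

(** Two factors t_n already give n^-3; the other m - 2 give the geometric decay, and 16 = 4^2 makes
    up for the two factors removed. Order 3 is what the leading term requires. *)
Lemma distinct_log_bound3 : exists2 C : R, 0 <= C & dbound C 3 2 distinct_log.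
Proof.
have [w [c [aw _ _ hw]]] := tcat_asym.
have : fsmall 3 (fun n => t n ^+ 2 : R).
  apply: bigO_fsmall.
  have b3 : bigO 3 t.
    have := bigOM (bigO_xs 3) (asym_free_bounded aw); rewrite addn0.
    by apply: bigO_near; apply: filterS hw => n ->.
  by apply: bigO_near (bigOM b3 b3); apply: nearW => n; rewrite expr2.
move=> [C C0 hC]; exists (C * 16); first by rewrite mulr_ge0.
move=> m m2 n n0; apply: (le_trans (distinct_log_le m n)).
rewrite -(subnK m2) exprD.
have h2 : t n ^+ 2 <= C * n%:R ^- 3.
  apply: (le_trans (ler_norm _)); apply: (le_trans (hC n)).
  by rewrite ler_wpM2l //; case: n n0 => // n _; exact: natSXV_le.
have h1 : t n ^+ (m - 2) <= 4 ^- (m - 2).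
  apply: (le_trans (tcatX_le _ n0)); rewrite ler_piMl ?invr_ge0 ?exprn_ge0 //.
  rewrite invf_le1 ?exprn_gt0 ?ltr0n // exprn_ege1 // ler1n //.
apply: (le_trans (ler_pM _ _ h1 h2)); rewrite ?exprn_ge0 ?tcat_ge0 //.
have -> : 4 ^- (m - 2 + 2) = 4 ^- (m - 2) * 16^-1 :> R.
  by rewrite exprD invfM; congr (_ * _^-1); rewrite expr2 -natrM.
rewrite le_eqVlt; apply/orP; left; apply/eqP.
by move: (4 ^- (m - 2) : R) (n%:R ^- 3 : R) => u u'; field.
Qed.

(** For m >= 2 the decay is exponential in n, hence faster than every power: M = 2, with period 1! =
    1, serves at all precisions. *)
Lemma forest_log_bound N : exists2 C : R, 0 <= C & dbound C N 2 forest_log.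
Proof.
have [K K0 hK] := @pow_le_exp2 R N.
exists (16 * K); first by rewrite mulr_ge0.
move=> m m2 n n0.
have tn : t n <= 1.
  apply: (le_trans (@tcat_le R n n0)); rewrite invf_le1 -?natrM ?ler1n ?ltr0n ?muln_gt0 //.
have f0 : 0 <= t n * 4 ^+ n * 4 ^- (n * m).
  by rewrite !mulr_ge0 ?tcat_ge0 ?exprn_ge0 // invr_ge0 exprn_ge0.
rewrite /forest_log normrM normfV normr_nat (ger0_norm f0).
apply: (@le_trans _ _ (t n * 4 ^+ n * 4 ^- (n * m))).
  by rewrite ler_piMl // inv_nat_le1.
apply: (@le_trans _ _ (4 ^+ n * 4 ^- (n * m))).
  by rewrite -mulrA; apply: ler_piMl.
apply: (@le_trans _ _ (16 * 4 ^- n * 4 ^- m)).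
  have p4 j : 0 < 4 ^+ j :> R by rewrite exprn_gt0.
  (* The exponents compare because (n - 1)(m - 2) >= 0; the 2 accounts for the factor 16. *)
  have le4 : 4 ^- (n * m + 2) <= 4 ^- (n + n + m) :> R.
    rewrite lef_pV2 ?posrE // ler_weXn2l ?ler1n //.
    by case: n n0 {tn f0} => // n _; case: m m2 => [|[|m]] // _; nia.
  have -> : 16 * 4 ^- n * 4 ^- m = 4 ^+ n * (16 * 4 ^- (n + n + m)) :> R.
    rewrite !exprD; have := lt0r_neq0 (p4 n); have := lt0r_neq0 (p4 m).
    by move: (4 ^+ n : R) (4 ^+ m : R) => u v u0 v0; field; rewrite u0 v0.
  have -> : 4 ^- (n * m) = 16 * 4 ^- (n * m + 2) :> R.
    rewrite exprD; have := lt0r_neq0 (p4 (n * m)%N).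
    by move: (4 ^+ (n * m) : R) => u u0; rewrite expr2; field; rewrite u0.
  by rewrite ler_wpM2l ?exprn_ge0 // ler_wpM2l.
rewrite ler_wpM2r ?invr_ge0 ?exprn_ge0 // -mulrA ler_wpM2l //.
rewrite ler_pdivlMr ?exprn_gt0 ?ltr0n // mulrC ler_pdivrMr ?exprn_gt0 //.
apply: (@le_trans _ _ (n.+1%:R ^+ N)); first by rewrite lerXn2r ?nnegrE // ler_nat.
apply: (le_trans (hK n)); rewrite ler_wpM2l // lerXn2r ?nnegrE // ler_nat //.
Qed.

Lemma distinct_log_asym m : (0 < m)%N -> exists2 f : nat -> R, asym false 1 f &
  \forall n \near \oo, distinct_log m n = x n ^+ 3 * f n.
Proof.
case: m => // m _; have [w [c [aw _ _ hw]]] := tcat_asym.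
exists (fun n => (-1) ^+ m / m.+1%:R * (x n ^+ (3 * m) * w n ^+ m.+1)).
  apply: asymCM => //; apply: asymM => //; apply: asymX => //; exact: asym_xs.
apply: filterS hw => n hw; rewrite /distinct_log hw exprMn -exprM mulnS exprD; ring.
Qed.

(** For m >= 2 the decay beats all powers and the expansion is zero. *)
Lemma forest_log_asym m : (0 < m)%N -> exists2 f : nat -> R, asym false 1 f &
  \forall n \near \oo, forest_log m n = x n ^+ 3 * f n.
Proof.
move=> m0; case: (ltnP 1 m) => m1; last first.
  have -> : m = 1%N by apply/eqP; rewrite eqn_leq m1.
  by rewrite forest_log1; have [w [c [aw _ _ hw]]] := tcat_asym; exists w.
exists (fun n => forest_log m n / x n ^+ 3).
  apply: asym_bigO => N; have [C C0 hC] := forest_log_bound (N + 3).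
  exists (C * 4 ^- m); near=> n.
  have n0 : (0 < n)%N by near: n; exact: near_gt0.
  have x0 : 0 < x n ^+ 3 by rewrite exprn_gt0 // xs_gt0.
  rewrite normrM normfV (gtr0_norm x0) ler_pdivrMr //.
  apply: (le_trans (hC m m1 n n0)); rewrite [leLHS]mulrAC -[leRHS]mulrA.
  apply: ler_wpM2l; first by rewrite mulr_ge0 // invr_ge0 exprn_ge0.
  rewrite -exprVn -xs_sqr -exprM -exprD ler_wiXn2l ?xs_ge0 ?xs_le1 //; lia.
near=> n; have n0 : (0 < n)%N by near: n; exact: near_gt0.
by rewrite mulrC divfK // expf_neq0 // gt_eqF // xs_gt0.
Unshelve. all: by end_near. Qed.

Definition distinct_series : fps R := fexp (hcomb distinct_log 1).
Definition forest_series : fps R := fexp (hcomb forest_log 1).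

Lemma distinct_series_osc N : exists2 q, (0 < q)%N & osc true q N distinct_series.
Proof.
exists ((2 * N.+2).-1)`!; first exact: fact_gt0.
apply: (@osc_le _ _ _ _ (2 * N.+2)); first by lia.
by apply: (@fexp_hcomb_osc _ _ distinct_log0 1) => //;
  [exact: distinct_log_bound | exact: distinct_log_asym].
Qed.

Lemma forest_series_asym : asym true 1 forest_series.
Proof.
move=> N; have [C C0 hC] := forest_log_bound (2 * N.+2).
apply: (@osc_le _ _ _ _ (2 * N.+2)); first by lia.
have := @fexp_hcomb_osc _ _ forest_log0 C N.+2 2 isT C0 isT hC forest_log_asym.
exact.
Qed.

Lemma hcomb_lead (a : nat -> fps R) C : (forall m, (0 < m)%N -> a m 0%N = 0) ->
  a 1%N = t -> 0 <= C -> dbound C 3 2 a ->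
  bigO 4 (fun n => fexp (hcomb a 1) n - expR (2^-1 + eps (hcomb a 2)) * t n).
Proof.
move=> a0 a1 C0 hC.
have e : hcomb a 1 = t + hcomb a 2.
  rewrite (hcomb_rec a0) // a1; congr (_ + _).
  by apply/funext => n; rewrite fpsubE dvd1n divn1.
have hs : fsmall 3 (hcomb a 2) by apply: (hcomb_small a0 C0).
rewrite e; have := fsmall_bigO (fexp_lead hs).
by apply: bigO_near; apply: nearW => n; rewrite fpsBE fpsCM.
Qed.

Lemma series_shift1 (f : nat -> R) : f 0%N = 0 ->
  limn (series f) = \big[+%R/0]_(1 <= n <oo) f n.
Proof.
move=> f0; congr (limn _); apply/funext => -[|n].
  by rewrite /series /= !big_geq.
by rewrite /series /= big_ltn // f0 add0r.
Qed.

Lemma distinct_const : eps (hcomb distinct_log 2) = constL R.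
Proof.
have [C C0 hC] := distinct_log_bound3.
have hC2 : dbound C 2 2 distinct_log.
  move=> m m2 n n0; apply: (le_trans (hC m m2 n n0)).
  rewrite ler_wpM2r ?invr_ge0 ?exprn_ge0 // ler_wpM2l //.
  by case: n n0 => // n _; exact: natSXV_le.
have := eps_hcomb distinct_log0 C0 (ltn0Sn 1) hC2.
move=> /cvg_lim <- //; rewrite /constL; congr (limn _); apply/funext => J.
apply: eq_big_nat => m /andP[m2 _]; have m0 : (0 < m)%N by apply: leq_trans m2.
rewrite subn1; set c : R := (-1) ^+ m.-1 / m%:R.
have c0 : c != 0.
  by rewrite mulf_neq0 ?invr_eq0 ?pnatr_eq0 -?lt0n // expf_neq0 // oppr_eq0 oner_eq0.
have hl := eps_fpsub distinct_log0 C0 m0 (dboundW m2 hC2).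
rewrite -series_shift1; last by rewrite -/(t 0) tcat0 expr0n (gtn_eqF m0).
rewrite (cvg_lim _ hl) //; apply: (mulfI (invr_neq0 c0)); rewrite mulKf //.
apply/esym/cvg_lim => //.
rewrite (_ : series _ = fun n => c^-1 * series (distinct_log m) n).
  by apply: cvgM => //; exact: cvg_cst.
apply/funext => n; rewrite /series /= mulr_sumr; apply: eq_bigr => i _.
by rewrite /distinct_log -/c mulKf.
Qed.

(** The series a(v z), so that [eps] gives the value of a at v. *)
Definition scale (v : R) (a : fps R) : fps R := fun n => a n * v ^+ n.

Lemma scaleM v a b : scale v (a * b) = scale v a * scale v b.
Proof.
apply/funext => n; rewrite /scale !fpsME mulr_suml; apply: eq_bigr => k _.
have -> : v ^+ n = v ^+ k * v ^+ (n - k) by rewrite -exprD subnKC ?leq_ord.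
by ring.
Qed.

Lemma scale_small v a C : 0 <= v <= 4^-1 -> (forall n, `|a n| <= C) ->
  fsmall 3 (scale v a).
Proof.
move=> /andP[v0 v1] ha; have [K K0 hK] := @pow_le_exp2 R 3.
have C0 : 0 <= C by apply: le_trans (ha 0%N).
exists (C * K) => [|n]; first exact: mulr_ge0.
rewrite /scale normrM (ger0_norm (exprn_ge0 n v0)) -mulrA.
apply: ler_pM => //; first exact: exprn_ge0.
rewrite ler_pdivlMr ?natSX_gt0 // (le_trans (ler_wpM2l (exprn_ge0 n v0) (hK n))) //.
rewrite mulrCA -exprMn ler_piMr // exprn_ile1 //; first by rewrite mulr_ge0.
by rewrite -ler_pdivlMr ?ltr0n // (le_trans v1) // mul1r lef_pV2 ?posrE ?ltr0n // ler_nat.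
Qed.

Lemma tcat_le4 n : t n <= 4^-1.
Proof.
case: n => [|n]; first by rewrite tcat0 invr_ge0.
apply: (le_trans (@tcat_le R n.+1 isT)).
by rewrite lef_pV2 ?posrE ?mulr_gt0 ?ltr0n // ler_peMr // ler1n.
Qed.

Lemma sqrt1z_le1 n : `|P n| <= 1.
Proof.
case: n => [|n]; first by rewrite sqrt1z0 normr1.
rewrite sqrt1zE normrM normrN normr_nat (ger0_norm (tcat_ge0 _)).
by have := tcat_le4 n.+1; move: (t n.+1) => u; lra.
Qed.

(** Multiplicativity of [eps] yields the square 1 - v. The sign follows from the partial sums: the
    constant term is 1 and the coefficient of z^i is at least -2^-i. *)
Lemma scale_sqrt1z v : 0 <= v <= 4^-1 -> eps (scale v P) = Num.sqrt (1 - v).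
Proof.
move=> v01; have /andP[v0 v1] := v01.
have sP := scale_small v01 sqrt1z_le1.
have e2 : eps (scale v P) ^+ 2 = 1 - v.
  rewrite expr2 -epsM // -scaleM -expr2 sqrt1z_sqr.
  apply: epsP; rewrite -(cvg_shiftn 2) (_ : (fun n => _) = cst (1 - v)); first exact: cvg_cst.
  apply/funext => n; rewrite /series /= addn2 !big_nat_recl //= /scale !fpsBE !fps1E !fpsXnE /=.
  rewrite big1 => [|i _]; last by rewrite fpsBE fps1E fpsXnE /= subrr mul0r.
  by rewrite expr0 expr1 subr0 sub0r mulN1r mulr1 addr0.
have pos : 0 <= eps (scale v P).
  apply: limr_ge; first exact: cvgP (eps_cvg (fsmall_le (isT : (2 <= 3)%N) sP)).
  exists 1%N => // -[|n] // _; rewrite /series /= big_nat_recl // {1}/scale expr0 mulr1 sqrt1z0.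
  have h (i : nat) : - 2 ^- i.+1 <= scale v P i.+1.
    rewrite /scale sqrt1zE !mulNr lerN2.
    have h1 : 2 * tcat i.+1 <= 1 :> R.
      by have := tcat_le4 i.+1; move: (t i.+1) => u; lra.
    have h2 : v ^+ i.+1 <= 2 ^- i.+1.
      rewrite -exprVn lerXn2r ?nnegrE ?invr_ge0 // (le_trans v1) //.
      by rewrite lef_pV2 ?posrE ?ltr0n // ler_nat.
    apply: le_trans h2; rewrite ler_piMl // exprn_ge0 //.
  have h3 : - \sum_(0 <= i < n) 2 ^- i.+1 <= \sum_(0 <= i < n) scale v P i.+1.
    by rewrite -sumrN; apply: ler_sum => i _; exact: h.
  have h4 : \sum_(0 <= i < n) (2 ^- i.+1 : R) = 1 - 2 ^- n.
    elim: (n) => [|m IH]; first by rewrite big_geq // expr0 invr1 subrr.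
    by rewrite big_nat_recr //= IH exprS invfM; move: (2 ^- m : R) => u; field.
  have h5 : 0 <= 2 ^- n :> R by rewrite invr_ge0 exprn_ge0.
  by rewrite h4 in h3; move: h3 h5; move: (\sum_(0 <= i < n) scale v P i.+1) (2 ^- n : R) => u w; lra.
by rewrite -e2 sqrtr_sqr ger0_norm.
Qed.

Lemma forest_log_sum m : (2 <= m)%N -> series (forest_log m) @ \oo -->
  ((2 * m%:R)^-1 * (1 - Num.sqrt (1 - (4 : R) ^ (1 - m%:Z)))).
Proof.
case: m => [//|m] m1; rewrite ltnS in m1.
have -> : (4 : R) ^ (1 - m.+1%:Z) = 4 ^- m by rewrite intS opprD addrA subrr add0r exprnN.
set v : R := 4 ^- m.
have v01 : 0 <= v <= 4^-1.
  rewrite invr_ge0 exprn_ge0 //= lef_pV2 ?posrE ?exprn_gt0 ?ltr0n //.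
  by rewrite -[leLHS]expr1 ler_weXn2l // ler1n.
have e : forest_log m.+1 = fpsC ((2 * m.+1%:R)^-1) * (fpsC 1 - scale v P).
  apply/funext => n; rewrite fpsCM fpsBE fpsCE /scale /forest_log.
  case: n => [|n]; first by rewrite tcat0 sqrt1z0 expr0 !mul0r mulr1 subrr !mulr0.
  have -> : v ^+ n.+1 = 4 ^- (n.+1 * m) by rewrite /v -exprVn -exprM mulnC exprVn.
  rewrite sqrt1zE sub0r mulnS exprD.
  have p : 4 ^+ n.+1 != 0 :> R by rewrite expf_neq0 // pnatr_eq0.
  have p' : 4 ^+ (n.+1 * m) != 0 :> R by rewrite expf_neq0 // pnatr_eq0.
  have p2 : m.+1%:R != 0 :> R by rewrite pnatr_eq0.
  move: p p' p2.
  move: (4 ^+ n.+1 : R) (4 ^+ (n.+1 * m) : R) (m.+1%:R : R) (t n.+1) => p p' q u hp hp' hq.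
  by field; rewrite hp hp' hq.
have sP : fsmall 2 (scale v P) := fsmall_le (isT : (2 <= 3)%N) (scale_small v01 sqrt1z_le1).
have sF : fsmall 2 (forest_log m.+1).
  by rewrite e; apply: fsmallCM; apply: fsmall_sub => //; exact: fsmallC.
have := eps_cvg sF; rewrite {2}e epsCM; last by apply: fsmall_sub => //; exact: fsmallC.
rewrite epsD ?epsN ?eps_C ?scale_sqrt1z //; first exact: fsmallC.
exact: fsmallN.
Qed.

(** The 1/2 is the term k = 1 of the series in [constK], where 1 - 4^(1-k) = 0. *)
Lemma forest_const : expR (2^-1 + eps (hcomb forest_log 2)) = constK R.
Proof.
have [C C0 hC] := forest_log_bound 2.
have := eps_hcomb forest_log0 C0 (ltn0Sn 1) hC => h.
rewrite /constK; congr expR; apply/esym/cvg_lim => //.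
rewrite -(cvg_shiftn 2).
rewrite (_ : (fun n => _) = fun n => 2^-1 +
    \sum_(2 <= m < n + 2) limn (series (forest_log m))).
  apply: cvgD; first exact: cvg_cst.
  by rewrite (cvg_shiftn 2 (fun J => \sum_(2 <= m < J) limn (series (forest_log m)))).
apply/funext => n; rewrite big_ltn; last by rewrite addn2.
congr (_ + _).
  have -> : (4 : R) ^ (1 - 1%:Z) = 1 by [].
  by rewrite subrr sqrtr0 subr0 !mulr1.
apply: eq_big_nat => m /andP[m2 _]; apply/esym/cvg_lim => //.
exact: forest_log_sum.
Qed.

End TwoFamilies.

(** * Enumeration of trees and forests *)

Section Lists.

Lemma uniq_flatten_map (A B : eqType) (f : A -> seq B) (s : seq A) :
  uniq s -> (forall a, a \in s -> uniq (f a)) ->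
  (forall a a' b, a \in s -> a' \in s -> b \in f a -> b \in f a' -> a = a') ->
  uniq (flatten (map f s)).
Proof.
elim: s => //= a s IH /andP[as_ us] uf inj.
rewrite cat_uniq uf ?mem_head //= IH //; last first.
- by move=> a1 a2 b h1 h2; apply: inj; rewrite inE (h1, h2) orbT.
- by move=> a' h; apply: uf; rewrite inE h orbT.
rewrite andbT; apply/hasPn => b /flatten_mapP[a' ha' hb]; apply: contra as_ => hb'.
by rewrite (inj a a' b) // ?mem_head // inE ha' orbT.
Qed.

Lemma size_flatten_map (A B : Type) (f : A -> seq B) (s : seq A) :
  size (flatten (map f s)) = (\sum_(a <- s) size (f a))%N.
Proof.
by elim: s => [|a s IH]; rewrite ?big_nil ?big_cons //= size_cat IH.
Qed.

Lemma card_fset_set_seq (T : choiceType) (A : set T) (s : seq T) : uniq s ->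
  (forall a, A a <-> a \in s) -> #|` fset_set A| = size s.
Proof.
move=> us h.
have -> : A = [set` [fset a in s]%fset].
  by apply/seteqP; split => a /=; rewrite inE /= => /h.
by rewrite set_fsetK card_fseq undup_id.
Qed.

End Lists.

Section PlaneTrees.

Definition graft (t u : plane_tree) := let: PNode s := u in PNode (t :: s).

Lemma tree_size_gt0 t : (0 < tree_size t)%N.
Proof. by case: t. Qed.

Lemma graft_size t u : tree_size (graft t u) = (tree_size t + tree_size u)%N.
Proof. by case: u => s /=; rewrite addnS. Qed.

Lemma graft_inj t u t' u' : graft t u = graft t' u' -> t = t' /\ u = u'.
Proof. by case: u u' => [s] [s'] /= [-> ->]. Qed.

(* [graft] is a bijection from pairs of trees to trees of size at least 2. *)
Fixpoint trees_rec (fuel n : nat) : seq plane_tree :=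
  if fuel is m.+1 then
    (if n == 1%N then [:: PNode [::]] else [::]) ++
    flatten [seq [seq graft p.1 p.2 |
      p <- [seq (t, u) | t <- trees_rec m k, u <- trees_rec m (n - k)]] |
      k <- iota 1 n.-1]
  else [::].

Lemma mem_trees_rec fuel n t : (n <= fuel)%N ->
  (t \in trees_rec fuel n) = (tree_size t == n).
Proof.
elim: fuel n t => [|m IH] n t hn /=.
  by move: hn; rewrite leqn0 => /eqP->; rewrite gtn_eqF ?tree_size_gt0.
rewrite mem_cat; apply/orP/eqP => [[]|en].
- by case: eqP => // -> /[!inE] /eqP ->.
- move=> /flatten_mapP[k]; rewrite mem_iota => /andP[k1 k2].
  move=> /mapP[[a b]] /allpairsP[[a' b'] /= [ha hb [-> ->]]] ->.
  rewrite graft_size; move: ha hb; rewrite !IH; [|lia|lia].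
  by move=> /eqP -> /eqP ->; lia.
rewrite -{}en in hn *; case: t hn => -[|a s] hn; [by left; rewrite inE | right].
have e : PNode (a :: s) = graft a (PNode s) by [].
have sz := graft_size a (PNode s); rewrite -e in sz.
have a0 := tree_size_gt0 a; have s0 := tree_size_gt0 (PNode s).
have hs : (tree_size a + tree_size (PNode s) <= m.+1)%N by rewrite -sz.
rewrite e; clear hn sz e; move: (PNode s) s0 hs => u u0 hs; rewrite graft_size.
apply/flatten_mapP; exists (tree_size a); first by rewrite mem_iota; lia.
apply/mapP; exists (a, u) => //; apply/allpairsP; exists (a, u); split=> //=.
  by rewrite IH ?eqxx //; lia.
by rewrite IH; [apply/eqP|]; lia.
Qed.

Lemma uniq_trees_rec fuel n : (n <= fuel)%N -> uniq (trees_rec fuel n).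
Proof.
elim: fuel n => // m IH n hn; rewrite [trees_rec _ _]/= cat_uniq.
apply/and3P; split; first by case: eqP.
  apply/hasPn => t /flatten_mapP[k]; rewrite mem_iota => hk.
  move=> /mapP[[a b]] /allpairsP[[a' b'] /= [ha hb [-> ->]]] ->.
  by case: eqP => // n1; move: hk; rewrite n1; lia.
apply: uniq_flatten_map; first exact: iota_uniq.
- move=> k; rewrite mem_iota => hk; rewrite map_inj_uniq; last first.
    by move=> [a b] [a' b'] /= /graft_inj[-> ->].
  by apply: allpairs_uniq => [||[a b] [a' b'] _ _ //]; apply: IH; lia.
move=> k k' t; rewrite !mem_iota => hk hk'.
move=> /mapP[[a b]] /allpairsP[[a1 b1] /= [ha hb [-> ->]]] ->.
move=> /mapP[[a' b']] /allpairsP[[a2 b2] /= [ha' hb' [-> ->]]] /graft_inj[e _].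
move: ha ha'; rewrite !mem_trees_rec; [|lia|lia].
by move=> /eqP <- /eqP <-; rewrite e.
Qed.

Definition trees n := trees_rec n n.

Lemma mem_trees n t : (t \in trees n) = (tree_size t == n).
Proof. exact: mem_trees_rec. Qed.

Lemma uniq_trees n : uniq (trees n).
Proof. exact: uniq_trees_rec. Qed.

Lemma size_trees_rec fuel n : (n <= fuel)%N ->
  size (trees_rec fuel n) = size (trees n).
Proof.
move=> hn; apply: perm_size; apply: uniq_perm; rewrite ?uniq_trees ?uniq_trees_rec //.
by move=> t; rewrite mem_trees mem_trees_rec.
Qed.

Lemma size_trees n : size (trees n) =
  ((n == 1) + \sum_(1 <= k < n) size (trees k) * size (trees (n - k)))%N.
Proof.
case: n => [|n]; first by rewrite big_geq.
rewrite {1}/trees [trees_rec _ _]/= size_cat size_flatten_map; congr (_ + _)%N.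
  by case: eqP.
rewrite /index_iota subn1; apply: eq_big_seq => k; rewrite mem_iota => hk.
by rewrite size_map size_allpairs !size_trees_rec //; lia.
Qed.

End PlaneTrees.

Section TreeCount.
Context {R : realType}.
Notation t := (@tcat R).

Lemma tcat_quadratic : t = fpsC 4^-1 * fpsXn 1 + t * t.
Proof.
have e2 : fpsC (2^-1 : R) * fpsC 2^-1 = fpsC 4^-1.
  by rewrite -rmorphM /=; congr fpsC; field.
have e1 : fpsC (2^-1 : R) = fpsC 4^-1 + fpsC 4^-1.
  by rewrite -rmorphD /=; congr fpsC; field.
have eZ : fpsXn 1 = 1 - sqrt1z ^+ 2 :> fps R by rewrite sqrt1z_sqr; ring.
rewrite !tcat_sqrt1z eZ; move: e1 e2.
move: (fpsC 2^-1) (fpsC 4^-1) sqrt1z => h q P -> e2.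
transitivity (q + q - (q + q) * P); first by [].
have -> : ((q + q) - (q + q) * P) * ((q + q) - (q + q) * P) =
  (q + q) * (q + q) * (1 - P) ^+ 2 by ring.
by rewrite e2; ring.
Qed.

(** The equation t = z/4 + t^2 is the recurrence of [size_trees], rescaled by 4^-n. *)
Lemma tree_count n : (size (trees n))%:R * 4 ^- n = t n.
Proof.
elim/ltn_ind: n => n IH; have := congr1 (@^~ n) tcat_quadratic.
rewrite fpsDE fpsCM fpsXnE fpsME => ->.
case: n IH => [|n] IH.
  by rewrite big_ord1 /= tcat0 !(mul0r, mulr0) addr0.
rewrite size_trees natrD mulrDl; congr (_ + _).
  by case: n {IH} => [|n]; rewrite ?mul0r ?mulr0 // mul1r mulr1 expr1.
rewrite -(big_mkord xpredT (fun k => t k * t (n.+1 - k)%N)).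
rewrite [in RHS]big_ltn // tcat0 mul0r add0r [in RHS]big_nat_recr //= subnn tcat0 mulr0 addr0.
rewrite natr_sum mulr_suml; apply: eq_big_nat => k /andP[k1 k2].
rewrite -!IH //; last by lia.
have -> : 4 ^- n.+1 = 4 ^- k * 4 ^- (n.+1 - k) :> R.
  by rewrite -invfM -exprD subnKC // ltnW.
by rewrite natrM; ring.
Qed.

End TreeCount.

(** * Enumeration of forests as multisets *)

Section Forests.
Implicit Types (f g : forest) (l : seq plane_tree) (ks : seq nat).

Lemma perm_enum_msetD f g : perm_eq (enum_mset (f `+` g)%mset) (enum_mset f ++ enum_mset g).
Proof.
by apply/allP => a _ /=; rewrite count_cat !count_mem_mset msetE2.
Qed.

Lemma forest_sizeD f g : forest_size (f `+` g)%mset = (forest_size f + forest_size g)%N.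
Proof. by rewrite /forest_size (perm_big _ (perm_enum_msetD f g)) big_cat. Qed.

Lemma forest_sizen j t : forest_size (msetn j t) = (j * tree_size t)%N.
Proof. by rewrite /forest_size enum_msetn big_nseq iter_addn_0 mulnC. Qed.

Lemma forest_size0 : forest_size mset0 = 0%N.
Proof. by rewrite /forest_size enum_mset0 big_nil. Qed.

Lemma forest_size_ge f a : a \in f -> (tree_size a <= forest_size f)%N.
Proof. by move=> /msetB1K <-; rewrite forest_sizeD forest_sizen mul1n leq_addr. Qed.

Lemma mset0P f : (forall a, f a = 0%N) -> f = mset0.
Proof. by move=> h; apply/msetP => a; rewrite h mset0E. Qed.

Fixpoint forests_on l n : seq forest :=
  if l is t :: l' then
    flatten [seq [seq (msetn j t `+` f)%mset | f <- forests_on l' (n - j * tree_size t)%N]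
            | j <- iota 0 (n %/ tree_size t).+1]
  else if n == 0%N then [:: mset0] else [::].

Lemma forests_on_cons t l n : forests_on (t :: l) n =
  flatten [seq [seq (msetn j t `+` f)%mset | f <- forests_on l (n - j * tree_size t)%N]
          | j <- iota 0 (n %/ tree_size t).+1].
Proof. by []. Qed.

Lemma mem_forests_on l n f : uniq l ->
  (f \in forests_on l n) <-> ((forall a, a \in f -> a \in l) /\ forest_size f = n).
Proof.
elim: l n f => [|t l IH] n f; last rewrite forests_on_cons.
  move=> _ /=; split=> [|[h <-]].
    by case: eqP => // ->; rewrite inE => /eqP ->; rewrite forest_size0; split=> // a; rewrite in_mset0.
  have -> : f = mset0.
    by apply: mset0P => a; apply/eqP; rewrite mset_eq0; apply/negP => /h.
  by rewrite forest_size0 eqxx inE.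
move=> /andP[tl ul]; split=> [|[h sz]].
  move=> /flatten_mapP[j]; rewrite mem_iota /= add0n ltnS => hj /mapP[g /(IH _ _ ul)[hg sg] ->]; split.
    move=> a; rewrite in_msetD in_msetn inE => /orP[/andP[_ ->] //|/hg ->].
    by rewrite orbT.
  rewrite forest_sizeD forest_sizen sg subnKC // .
  by rewrite leq_divRL ?tree_size_gt0 // in hj.
pose g := (f `\` msetn (f t) t)%mset.
have gE a : g a = if a == t then 0%N else f a.
  by rewrite msetE2 msetnE; case: eqP => [->|]; rewrite ?subnn ?subn0.
have e : f = (msetn (f t) t `+` g)%mset.
  by apply/msetP => a; rewrite msetE2 gE msetnE; case: eqP => [->|]; rewrite ?addn0.
have se : (f t * tree_size t + forest_size g)%N = n by rewrite -sz {2}e forest_sizeD forest_sizen.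
apply/flatten_mapP; exists (f t).
  rewrite mem_iota /= add0n ltnS leq_divRL ?tree_size_gt0 // -se leq_addr //.
apply/mapP; exists g => //; apply/(IH _ _ ul); split; last by rewrite -se addKn.
move=> a; rewrite -mset_neq0 gE; case: (eqVneq a t) => // ne; rewrite mset_neq0 => /h.
by rewrite inE (negbTE ne).
Qed.

Lemma uniq_forests_on l n : uniq l -> uniq (forests_on l n).
Proof.
elim: l n => [|t l IH] n; first by rewrite /=; case: eqP.
rewrite forests_on_cons => /andP[tl ul]; apply: uniq_flatten_map; first exact: iota_uniq.
  move=> j _; rewrite map_inj_uniq; first exact: IH.
  move=> f g /msetP h; apply/msetP => a; have := h a.
  by rewrite !msetE2 => /eqP; rewrite eqn_add2l => /eqP.
have ht m g : g \in forests_on l m -> g t = 0%N.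
  move=> /(mem_forests_on _ _ ul)[hg _]; apply/eqP; rewrite mset_eq0.
  by apply: contra tl => /hg.
move=> j j' f _ _ /mapP[g /ht hg ->] /mapP[g' /ht hg' /msetP/(_ t)].
by rewrite !msetE2 !msetnxx hg hg' !addn0.
Qed.

(** Either [t] does not occur or one copy of it is removed. On generating functions: multiplication
    by 1 - z^|t| removes [t] from the list. *)
Lemma size_forests_on t l n : size (forests_on (t :: l) n) =
  (size (forests_on l n) +
   (if tree_size t <= n then size (forests_on (t :: l) (n - tree_size t)) else 0))%N.
Proof.
rewrite forests_on_cons size_flatten_map [iota _ _]/= big_cons size_map mul0n subn0; congr (_ + _)%N.
have t0 := tree_size_gt0 t; case: leqP => h; last by rewrite divn_small // big_nil.
rewrite forests_on_cons size_flatten_map (_ : n %/ tree_size t = ((n - tree_size t) %/ tree_size t).+1)%N.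
  rewrite (iotaDl 1 0) big_map; apply: eq_bigr => j _.
  by rewrite !size_map add1n mulSn subnDA.
by rewrite -{1}(subnK h) divnDr // divnn t0 addn1.
Qed.

Lemma perm_mset1D a f : perm_eq (enum_mset (a +` f)%mset) (a :: enum_mset f).
Proof. by rewrite (perm_trans (perm_enum_msetD _ _)) // enum_msetn. Qed.

Lemma dissimilar1D a f : dissimilar (a +` f)%mset =
  (tree_size a \notin [seq tree_size t | t <- enum_mset f]) && dissimilar f.
Proof. by rewrite /dissimilar (perm_uniq (perm_map _ (perm_mset1D a f))). Qed.

Lemma mem_sizes k f :
  reflect (exists2 a, a \in f & tree_size a = k) (k \in [seq tree_size t | t <- enum_mset f]).
Proof. by apply: (iffP mapP) => -[a h e]; exists a. Qed.

Fixpoint dissimilar_on ks n : seq forest :=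
  if ks is k :: ks' then
    dissimilar_on ks' n ++
    (if (k <= n)%N then [seq (p.1 +` p.2)%mset |
       p <- [seq (t, f) | t <- trees k, f <- dissimilar_on ks' (n - k)%N]] else [::])
  else if n == 0%N then [:: mset0] else [::].

Lemma mem_dissimilar_on ks n f : uniq ks ->
  (f \in dissimilar_on ks n) <->
  [/\ forall a, a \in f -> tree_size a \in ks, dissimilar f & forest_size f = n].
Proof.
elim: ks n f => [|k ks IH] n f /=.
  move=> _; split=> [|[h _ <-]].
    case: eqP => // ->; rewrite inE => /eqP ->; rewrite forest_size0 /dissimilar enum_mset0.
    by split=> // a; rewrite in_mset0.
  have -> : f = mset0.
    by apply: mset0P => a; apply/eqP; rewrite mset_eq0; apply/negP => /h.
  by rewrite forest_size0 eqxx inE.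
move=> /andP[kks uks]; rewrite mem_cat; split.
  move=> /orP[/(IH _ _ uks)[h1 h2 h3]|].
    by split=> // a /h1; rewrite inE orbC => ->.
  case: leqP => // kn /mapP[[a g] /allpairsP[[a' g'] /=]].
  rewrite mem_trees => -[/eqP ha /(IH _ _ uks)[h1 h2 h3] [-> ->]] ->; split.
  - move=> b; rewrite in_mset1D inE => /orP[/eqP ->|/h1 ->]; first by rewrite ha eqxx.
    by rewrite orbT.
  - rewrite dissimilar1D h2 andbT ha; apply/mem_sizes => -[b /h1 hb e].
    by rewrite -e hb in kks.
  - by rewrite forest_sizeD forest_sizen mul1n h3 ha subnKC.
move=> [h1 h2 h3]; apply/orP.
have [/mem_sizes[a af ak]|/mem_sizes nk] := boolP (k \in [seq tree_size t | t <- enum_mset f]).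
  right; have e := msetB1K af; set g := (f `\ a)%mset in e.
  have kn : (k <= n)%N by rewrite -h3 -ak forest_size_ge.
  rewrite kn; apply/mapP; exists (a, g) => //; apply/allpairsP; exists (a, g).
  move: h2; rewrite -e dissimilar1D => /andP[/mem_sizes hk hg]; split=> //=.
    by rewrite mem_trees ak.
  apply/(IH _ _ uks); split=> //.
    move=> b bg; have : b \in f by rewrite -e in_mset1D bg orbT.
    move=> /h1; rewrite inE => /orP[/eqP bk|//].
    by case: hk; exists b => //; rewrite ak.
  by rewrite -h3 -e forest_sizeD forest_sizen mul1n ak addKn.
left; apply/(IH _ _ uks); split=> // a af; have := h1 a af.
by rewrite inE => /orP[/eqP e|//]; case: nk; exists a.
Qed.

Lemma uniq_dissimilar_on ks n : uniq ks -> uniq (dissimilar_on ks n).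
Proof.
elim: ks n => [|k ks IH] n /=; first by case: eqP.
move=> /andP[kks uks]; rewrite cat_uniq IH //=.
have nok m g b : g \in dissimilar_on ks m -> tree_size b = k -> b \notin g.
  by move=> /(mem_dissimilar_on _ _ uks)[h _ _] e; apply: contra kks => /h; rewrite e.
case: leqP => // kn; apply/andP; split.
  apply/hasPn => f /mapP[[a g] /allpairsP[[a' g'] /= [ha hg [-> ->]]] ->].
  apply/negP => hin; rewrite mem_trees in ha.
  by have := nok _ _ a' hin (eqP ha); rewrite mset1D1.
rewrite map_inj_in_uniq.
  by apply: allpairs_uniq => [||[a b] [a' b'] _ _ //]; [exact: uniq_trees | exact: IH].
move=> p q /allpairsP[[a g] /= [ha hg ->]] /allpairsP[[a' g'] /= [ha' hg' ->]] /= e.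
rewrite !mem_trees in ha ha'.
have : a \in (a' +` g')%mset by rewrite -e mset1D1.
rewrite in_mset1D (negbTE (nok _ _ _ hg' (eqP ha))) orbF => /eqP ea.
by rewrite ea in e *; congr pair; rewrite -(msetD1K a' g) e msetD1K.
Qed.

Lemma size_dissimilar_on k ks n : size (dissimilar_on (k :: ks) n) =
  (size (dissimilar_on ks n) +
   (if k <= n then size (trees k) * size (dissimilar_on ks (n - k)) else 0))%N.
Proof.
by rewrite /= size_cat; case: ifP => // _; rewrite size_map size_allpairs.
Qed.

Definition trees_upto n := flatten [seq trees k | k <- iota 1 n].

Lemma mem_trees_upto n t : (t \in trees_upto n) = (tree_size t <= n)%N.
Proof.
apply/flatten_mapP/idP => [[k]|h].
  by rewrite mem_iota mem_trees => hk /eqP e; lia.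
by exists (tree_size t); rewrite ?mem_trees // mem_iota; have := tree_size_gt0 t; lia.
Qed.

Lemma uniq_trees_upto n : uniq (trees_upto n).
Proof.
apply: uniq_flatten_map; [exact: iota_uniq | by move=> k _; exact: uniq_trees |].
by move=> k k' t _ _; rewrite !mem_trees => /eqP <- /eqP.
Qed.

Lemma card_forests n : #|` fset_set (forests n)| = size (forests_on (trees_upto n) n).
Proof.
have u := uniq_trees_upto n; apply: card_fset_set_seq; first exact: uniq_forests_on.
move=> f; rewrite /forests /= (mem_forests_on _ _ u); split=> [e|[]//].
by split=> // a /forest_size_ge; rewrite mem_trees_upto e.
Qed.

Lemma card_dissimilar_forests n :
  #|` fset_set (dissimilar_forests n)| = size (dissimilar_on (iota 1 n) n).
Proof.
have u := iota_uniq 1 n; apply: card_fset_set_seq; first exact: uniq_dissimilar_on.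
move=> f; rewrite /dissimilar_forests /= (mem_dissimilar_on _ _ u).
split=> [[e d]|[]//]; split=> // a /forest_size_ge; rewrite e mem_iota.
by have := tree_size_gt0 a; lia.
Qed.

End Forests.

(** * From the enumerations to exponential formulas *)

Section Counting.
Context {R : realType}.
Notation t := (@tcat R).

(** Both sides sum f m k over the factorizations i = m k. *)
Lemma divisor_swap (i J : nat) (f : nat -> nat -> R) : (0 < i < J)%N ->
  \sum_(1 <= m < J) (if (m %| i)%N then f m (i %/ m)%N else 0) =
  \sum_(1 <= k < J) (if (k %| i)%N then f (i %/ k)%N k else 0).
Proof.
move=> /andP[i0 iJ].
have single m (g : nat -> R) : (0 < m)%N -> (if (m %| i)%N then g (i %/ m)%N else 0) =
    \sum_(1 <= k < J) (if (m * k == i)%N then g k else 0).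
  move=> m0; rewrite -big_mkcond /=; case: ifP => [/dvdnP[q e]|nd].
    rewrite e mulnK // (eq_bigl (fun k => k == q)) => [|k]; last first.
      by rewrite mulnC eqn_mul2r (gtn_eqF m0).
    rewrite big_nat1_eq ifT //; move: i0 iJ; rewrite e muln_gt0 => /andP[-> _] /=.
    by apply: leq_ltn_trans; rewrite leq_pmulr.
  rewrite big1_seq // => k /andP[/eqP e _].
  by move: nd; rewrite -e dvdn_mulr.
rewrite (eq_big_nat _ _ (fun m hm => single m (f m) (andP hm).1)).
rewrite [RHS](eq_big_nat _ _ (fun k hk => single k (f^~ k) (andP hk).1)).
rewrite exchange_big /=; apply: eq_bigr => k _; apply: eq_bigr => m _.
by rewrite mulnC.
Qed.

Lemma hcomb_wide (a : nat -> fps R) i n : (0 < i <= n)%N ->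
  hcomb a 1 i = \sum_(1 <= m < n.+1) (if (m %| i)%N then a m (i %/ m)%N else 0).
Proof.
move=> /andP[i0 hin]; rewrite (big_cat_nat (n := i.+1)) //=.
rewrite [X in _ + X]big_nat_cond [X in _ + X]big1 ?addr0; last first.
  move=> m /andP[/andP[im _] _]; case: ifP => // /(dvdn_leq i0).
  by rewrite leqNgt im.
by apply: eq_bigr => m _; rewrite fpsubE.
Qed.

Lemma hcomb_0 (a : nat -> fps R) : hcomb a 1 0%N = 0.
Proof. by rewrite /hcomb big_geq. Qed.

Lemma flog_term_0 (c : R) k : flog_term c k 0%N = 0.
Proof. by rewrite /flog_term dvdn0 div0n invr0 mulr0. Qed.

Lemma fexp_inv (X : fps R) : fexp (- X) * fexp X = 1.
Proof. by rewrite -fexpD addNr fexp0. Qed.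

Lemma forests_on_series (l : seq plane_tree) :
  (fun n => (size (forests_on l n))%:R * 4 ^- n : R) =
  fexp (\sum_(u <- l) - flog_term (- 4 ^- tree_size u) (tree_size u)) :> fps R.
Proof.
elim: l => [|u l IH].
  rewrite big_nil fexp0; apply/funext => -[|n]; rewrite fps1E /=; last by rewrite mul0r.
  by rewrite expr0 invr1 mulr1.
rewrite big_cons fexpD -IH; set X := flog_term _ _.
set F : fps R := fun n => (size (forests_on (u :: l) n))%:R * 4 ^- n.
(* Multiplying by exp X = 1 - (z/4)^|u| reduces the claim to the recurrence of [size_forests_on]. *)
rewrite -[LHS]/F -[LHS]mul1r -(fexp_inv X) -mulrA; congr (_ * _).
rewrite /X fexp_log_term ?tree_size_gt0 // mulrDl mul1r -mulrA.
apply/funext => n; rewrite fpsDE fpsCM fpsXnM {1}/F size_forests_on natrD mulrDl.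
case: leqP => h; last by rewrite mul0r mulr0 addr0 addr0.
rewrite -addrA -[RHS]addr0; congr (_ + _); rewrite /F.
have -> : 4 ^- n = 4 ^- tree_size u * 4 ^- (n - tree_size u) :> R.
  by rewrite -invfM -exprD subnKC.
by rewrite mulNr mulrCA subrr.
Qed.

Lemma dissimilar_on_series (ks : seq nat) : all (leq 1) ks ->
  (fun n => (size (dissimilar_on ks n))%:R * 4 ^- n : R) =
  fexp (\sum_(k <- ks) flog_term (t k) k) :> fps R.
Proof.
elim: ks => [_|k ks IH /= /andP[k0 hks]].
  rewrite big_nil fexp0; apply/funext => -[|n]; rewrite fps1E /=; last by rewrite mul0r.
  by rewrite expr0 invr1 mulr1.
rewrite big_cons fexpD -(IH hks) fexp_log_term // mulrDl mul1r -mulrA.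
apply/funext => n; rewrite fpsDE fpsCM fpsXnM.
have -> := size_dissimilar_on k ks n; rewrite natrD mulrDl; congr (_ + _).
case: leqP => h; last by rewrite mul0r mulr0.
rewrite -tree_count natrM; have -> : 4 ^- n = 4 ^- k * 4 ^- (n - k) :> R.
  by rewrite -invfM -exprD subnKC.
by rewrite mulrACA.
Qed.

(** Coefficient n sees only trees of size at most n. Trees of equal size k contribute equal
    logarithms, and exchanging k with the exponent m regroups these into [hcomb]. *)
Lemma card_forests_series n :
  #|` fset_set (forests n)|%:R * 4 ^- n = @forest_series R n.
Proof.
rewrite card_forests; have := congr1 (@^~ n) (forests_on_series (trees_upto n)).
move=> /= ->; apply: fexp_ext => i hin; rewrite fps_sumE /trees_upto.
rewrite big_flatten big_map /=.
have e k : \sum_(u <- trees k) (- flog_term (- 4 ^- tree_size u) (tree_size u) : fps R) i =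
    (size (trees k))%:R * - flog_term (- 4 ^- k) k i.
  rewrite (eq_big_seq (fun=> - flog_term (- 4 ^- k) k i)) => [|u]; last first.
    by rewrite mem_trees => /eqP ->.
  by rewrite big_const_seq count_predT iter_addr_0 mulr_natl.
rewrite (eq_bigr _ (fun k _ => e k)).
case: i hin {e} => [|i] hin.
  by rewrite hcomb_0 big1 // => k _; rewrite flog_term_0 oppr0 mulr0.
rewrite (hcomb_wide _ (_ : (0 < i.+1 <= n)%N)) //.
rewrite (divisor_swap (fun m k => forest_log m k)); last by rewrite ltnS.
rewrite -[iota 1 n](_ : index_iota 1 n.+1 = _); last by rewrite /index_iota subn1.
apply: eq_big_nat => k /andP[k0 _]; rewrite /flog_term; case: ifP => [/dvdnP[m em]|].
  rewrite em mulnK //.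
  have m0 : (0 < m)%N by move: em; case: m.
  rewrite /forest_log -tree_count divfK ?expf_neq0 ?pnatr_eq0 //.
  case: m m0 {em} => // m _ /=.
  have -> : (- 4 ^- k) ^+ m.+1 = (-1) ^+ m.+1 * 4 ^- (k * m.+1) :> R.
    by rewrite [LHS]exprNn exprVn -exprM.
  have -> : (-1) ^+ m * ((-1) ^+ m.+1 * 4 ^- (k * m.+1)) = - 4 ^- (k * m.+1) :> R.
    have s1 : (-1) ^+ m * (-1) ^+ m = 1 :> R by rewrite -exprMn mulrNN mulr1 expr1n.
    by rewrite mulrA exprS mulN1r mulrN s1 mulN1r.
  by rewrite mulNr opprK mulrA mulrC.
by rewrite oppr0 mulr0.
Qed.

Lemma card_dissimilar_forests_series n :
  #|` fset_set (dissimilar_forests n)|%:R * 4 ^- n = @distinct_series R n.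
Proof.
rewrite card_dissimilar_forests.
have hall : all (leq 1) (iota 1 n) by apply/allP => k; rewrite mem_iota => /andP[].
have := congr1 (@^~ n) (dissimilar_on_series hall).
move=> /= ->; apply: fexp_ext => i hin; rewrite fps_sumE.
case: i hin => [|i] hin; first by rewrite hcomb_0 big1 // => k _; rewrite flog_term_0.
rewrite (hcomb_wide _ (_ : (0 < i.+1 <= n)%N)) //.
rewrite (divisor_swap (fun m k => distinct_log m k)); last by rewrite ltnS.
rewrite -[iota 1 n](_ : index_iota 1 n.+1 = _); last by rewrite /index_iota subn1.
apply: eq_big_nat => k /andP[k0 _]; rewrite /flog_term; case: ifP => // _.
by rewrite /distinct_log mulrAC.
Qed.

Lemma dissimilar_prob_series n :
  dissimilar_prob R n = distinct_series n / forest_series n.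
Proof.
rewrite -card_forests_series -card_dissimilar_forests_series /dissimilar_prob.
by rewrite invfM mulrACA divff ?mulr1 // invr_neq0 // expf_neq0 // pnatr_eq0.
Qed.

End Counting.

(** * Uniqueness of expansions and the quotient *)

Section Uniqueness.
Context {R : realType}.
Implicit Types (f : nat -> R) (p : {poly {poly R}}).
Notation x := (@xs R).

Lemma ln_inv_cvg0 : (fun n => (ln n%:R)^-1 : R) @ \oo --> 0.
Proof.
apply/cvgrPdist_le => e e0; near=> n; rewrite sub0r normrN normfV.
have h : expR e^-1 <= n%:R by near: n; exact: nbhs_infty_ger.
have n0 : 0 < n%:R :> R by apply: lt_le_trans h; exact: expR_gt0.
have l : e^-1 <= ln n%:R by rewrite -ler_expR lnK.
have i0 : 0 < e^-1 by rewrite invr_gt0.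
rewrite ger0_norm; last exact: le_trans (ltW i0) l.
by rewrite invf_ple ?posrE // (lt_le_trans i0).
Unshelve. all: by end_near. Qed.

Lemma near_class q r (Q : nat -> Prop) : (0 < q)%N ->
  (\forall n \near \oo, Q n) -> \forall m \near \oo, Q (r + q * m)%N.
Proof.
move=> q0 [n0 _ h]; exists n0 => // m /= hm; apply: h => /=; nia.
Qed.

Lemma cvg_class q r f (l : R) : (0 < q)%N -> f @ \oo --> l ->
  (fun m => f (r + q * m)%N) @ \oo --> l.
Proof.
move=> q0 /cvgrPdist_le h; apply/cvgrPdist_le => e e0.
exact: near_class q0 (h e e0).
Qed.

(** With y tending to infinity in absolute value, dividing c 'X + d by y shows that c also tends to
    0 along y, so c = 0 by induction, and then d = 0. *)
Lemma poly_cvg0 (c : {poly R}) (y : nat -> R) :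
  (fun m => (y m)^-1) @ \oo --> 0 -> (\forall m \near \oo, y m != 0) ->
  (fun m => c.[y m]) @ \oo --> 0 -> c = 0.
Proof.
move=> hy y0; elim/poly_ind: c => [//|c d IH] hc.
have c0 : c = 0.
  apply: IH.
  have h : (fun m => ((c * 'X + d%:P).[y m] - d) * (y m)^-1) @ \oo --> (0 - d) * 0.
    by apply: cvgM => //; apply: cvgB => //; exact: cvg_cst.
  rewrite mulr0 in h; apply: cvg_trans h; apply: near_eq_cvg.
  by apply: filterS y0 => m ym; rewrite hornerMXaddC addrK mulfK.
rewrite c0 mul0r add0r in hc *; congr _%:P.
have h : (fun m => d%:P.[y m]) @ \oo --> d.
  rewrite (_ : (fun m => _) = cst d); first exact: cvg_cst.
  by apply/funext => m; rewrite hornerC.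
exact: cvgn_uniq h hc.
Qed.

(** [ev_growth] gives boundedness only; applied to the square of [p], it leaves a spare factor
    n^(-1/2) for the square of the sequence. *)
Lemma x_ev_cvg0 q (p : nat -> {poly {poly R}}) : (0 < q)%N -> periodic q p ->
  (fun n => x n * ev true (p n) n) @ \oo --> 0.
Proof.
move=> q0 hp.
have h2 : bigO 1 (fun n => (x n * ev true (p n) n) ^+ 2).
  have h : bigO 0 (fun n => x n * ev true (p n * p n) n).
    apply: (@bigO_periodic _ 0 q _ (fun n => p n * p n) (fun c n => x n * ev true c n)) => //.
      by move=> n; rewrite hp.
    by move=> c; exact: ev_growth.
  by apply: bigO_near (bigOM h (bigO_xs 1)); apply: nearW => n; rewrite evM; ring.
have [C C0 hC] := bigO_pos h2; apply/cvgrPdist_le => e e0.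
near=> n; rewrite sub0r normrN -(@ler_pXn2r _ 2) ?nnegrE ?(ltW e0) //.
have h : `|(x n * ev true (p n) n) ^+ 2| <= C * x n ^+ 1 by near: n.
rewrite -normrX (le_trans h) // expr1 mulrC -ler_pdivlMr //.
by near: n; apply: near_xs_le; rewrite divr_gt0 // exprn_gt0.
Unshelve. all: by end_near. Qed.

(* [ln n] tends to infinity, so the polynomial in [ln n] of lowest order in
   [n^(-1/2)] can only tend to [0] if it vanishes. *)
Lemma ev_unique N q r p : (0 < q)%N ->
  (exists C : R, \forall m \near \oo,
     `|ev true p (r + q * m)%N| <= C * x (r + q * m)%N ^+ N) ->
  forall i, (i < N)%N -> p`_i = 0.
Proof.
move=> q0; elim: N p => // N IH p [C hC].
have [p1 [c ep]] : exists p1 c, p = p1 * 'X + c%:P.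
  elim/poly_ind: p {hC} => [|p1 c _]; last by exists p1, c.
  by exists 0, 0; rewrite mul0r addr0.
have eE n : ev true p n = ev true p1 n * x n + c.[lam true n].
  by rewrite ep evD evM evX; congr (_ + _); rewrite /ev hornerC.
have c0 : c = 0.
  apply: (@poly_cvg0 _ (fun m => lam true (r + q * m)%N)).
  - by apply: (@cvg_class q r (fun n => (lam true n)^-1)) => //; exact: ln_inv_cvg0.
  - apply: (@near_class q r (fun n => lam true n != 0)) => //.
    exists 2 => // n /= n2; rewrite /lam gt_eqF // ln_gt0 // ltr1n //.
  have h1 : (fun m => ev true p (r + q * m)%N) @ \oo --> 0.
    have hx : (fun m => `|C| * x (r + q * m)%N) @ \oo --> 0.
      rewrite -(mulr0 `|C|); apply: cvgM; first exact: cvg_cst.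
      by apply: (@cvg_class q r x) => //; exact: xs_cvg0.
    apply/cvgrPdist_le => e e0; move/cvgrPdist_le: hx => /(_ e e0) hx.
    near=> m; rewrite sub0r normrN.
    have hm : `|ev true p (r + q * m)%N| <= C * x (r + q * m)%N ^+ N.+1 by near: m.
    have he : `|0 - `|C| * x (r + q * m)%N| <= e by near: m.
    rewrite sub0r normrN ger0_norm ?mulr_ge0 ?xs_ge0 // in he.
    apply: (le_trans hm); apply: (le_trans _ he).
    apply: (le_trans (ler_wpM2r (xsX_ge0 _ _) (ler_norm C))).
    rewrite ler_wpM2l // exprSr ler_piMl ?xs_ge0 // exprn_ile1 ?xs_ge0 ?xs_le1 //.
  have h2 : (fun m => ev true p1 (r + q * m)%N * x (r + q * m)%N) @ \oo --> 0.
    apply: (@cvg_class q r (fun n => ev true p1 n * x n)) => //.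
    rewrite (_ : (fun n => _) = fun n => x n * ev true p1 n).
      exact: (@x_ev_cvg0 1 (fun=> p1)).
    by apply/funext => n; rewrite mulrC.
  rewrite -(subrr 0) (_ : (fun m => _) = (fun m => ev true p (r + q * m)%N) \-
    (fun m => ev true p1 (r + q * m)%N * x (r + q * m)%N)); first exact: cvgB.
  by apply/funext => m; rewrite /= eE addrC addKr.
have h : exists C : R, \forall m \near \oo,
    `|ev true p1 (r + q * m)%N| <= C * x (r + q * m)%N ^+ N.
  exists C; have n0 := @near_class q r _ q0 near_gt0.
  apply: filterS2 n0 hC => m n0.
  rewrite eE c0 horner0 addr0 normrM (ger0_norm (xs_ge0 _)) exprSr mulrA.
  by rewrite ler_pM2r ?xs_gt0.
case=> [|i]; first by rewrite ep c0 addr0 coefMX.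
by rewrite ltnS ep c0 addr0 coefMX /=; exact: IH.
Unshelve. all: by end_near. Qed.

Lemma periodic_unique N q (p : nat -> {poly {poly R}}) : (0 < q)%N ->
  periodic q p -> bigO N (fun n => ev true (p n) n) ->
  forall n i, (i < N)%N -> (p n)`_i = 0.
Proof.
move=> q0 hp [C hC] n; apply: (@ev_unique N q n) => //; exists C.
have := near_class n q0 hC; apply: filterS => m.
by rewrite mulnC (periodicM m hp).
Qed.

(** As f = O(n^(-3/2)), uniqueness forces the three lowest coefficients to vanish, so the expansion
    is divisible by the cube of the variable. *)
Lemma osc_div N q f : (0 < q)%N -> osc true q (N + 3) f -> bigO 3 f ->
  osc true q N (fun n => f n / x n ^+ 3).
Proof.
move=> q0 [p hp hf] f3.
have p3 n i : (i < 3)%N -> (p n)`_i = 0.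
  apply: (periodic_unique q0 hp).
  apply: bigO_near (bigOB f3 (bigO_le (leq_addl N 3) hf)); apply: nearW => m; ring.
exists (fun n => drop_poly 3 (p n)) => [n|]; first by rewrite hp.
have e n : p n = drop_poly 3 (p n) * 'X^3.
  rewrite -[LHS](poly_take_drop 3) -[RHS]add0r; congr (_ + _).
  by apply/polyP => i; rewrite coef_take_poly coef0; case: ifP => // /(p3 n).
have [C hC] := hf; exists C; near=> n.
have n0 : (0 < n)%N by near: n; exact: near_gt0.
have x3 : 0 < x n ^+ 3 by rewrite exprn_gt0 // xs_gt0.
have h : `|f n - ev true (p n) n| <= C * x n ^+ (N + 3) by near: n.
rewrite -(ler_pM2r x3) -mulrA -exprD -[X in _ * X](gtr0_norm x3) -normrM.
rewrite mulrBl divfK ?gt_eqF //.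
have ex : ev true (drop_poly 3 (p n)) n * x n ^+ 3 = ev true (p n) n.
  by rewrite [in RHS]e evM; congr (_ * _); rewrite /ev !hornerE.
by rewrite ex.
Unshelve. all: by end_near. Qed.

End Uniqueness.

Section Quotient.
Context {R : realType}.
Implicit Types (f g : nat -> R).
Notation x := (@xs R).

Lemma bigO_div N M f : bigO (N + M) f -> bigO N (fun n => f n / x n ^+ M).
Proof.
move=> [C hC]; exists C; apply: filterS2 near_gt0 hC => n n0 h.
have xM : 0 < x n ^+ M by rewrite exprn_gt0 // xs_gt0.
by rewrite normrM normfV (gtr0_norm xM) ler_pdivrMr // -mulrA -exprD.
Qed.

(** Write f = v (1 - u) with u = O(n^(-1/2)) and compose with 1/(1 - y). *)
Lemma asym_inv k q f v : (0 < q)%N -> v != 0 -> asym k q f ->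
  bigO 1 (fun n => f n - v) -> asym k q (fun n => (f n)^-1).
Proof.
move=> q0 v0 af hf; pose u n := 1 - v^-1 * f n.
have au : asym k q u by apply: asymB => //; [exact: asym_cst | exact: asymCM].
have hu : bigO 1 u.
  apply: bigO_near (bigOM (bigO_cst (- v^-1)) hf); apply: nearW => n.
  by rewrite mulNr mulrBr mulVf // opprB.
have hu2 : bigO 1 (fun n => u n ^+ 2) by exact: bigO_le (bigOM hu hu).
apply: asym_near (asymCM v^-1 q0 (asym_comp q0 taylor0_inv au hu2)).
by apply: nearW => n; rewrite /u opprB addrC subrK invfM invrK mulrA mulVf ?mul1r.
Qed.

Lemma tcat_multiple_lead f (A c : R) w : bigO 1 (fun n => w n - c) ->
  (\forall n \near \oo, tcat n = x n ^+ 3 * w n) ->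
  bigO 4 (fun n => f n - A * tcat n) ->
  bigO 1 (fun n => f n / x n ^+ 3 - A * c).
Proof.
move=> hw ht hf.
have h := bigOD (@bigO_div 1 3 _ hf) (bigOM (bigO_cst A) hw).
apply: bigO_near h; apply: filterS2 near_gt0 ht => n n0 ->.
have xM : x n ^+ 3 != 0 by rewrite expf_neq0 // gt_eqF // xs_gt0.
by rewrite [_ * w n]mulrC mulrBl mulrA (mulfK xM) mulrBr addrA subrK.
Qed.

Lemma bigO_mul_xs N f c : bigO 1 (fun n => f n / x n ^+ N - c) -> bigO N f.
Proof.
move=> h.
have h1 := bigOM (bigOD (bigO_le (leq0n 1) h) (bigO_cst c)) (bigO_xs N).
apply: bigO_near h1; apply: filterS near_gt0 => n n0.
have xM : x n ^+ N != 0 by rewrite expf_neq0 // gt_eqF // xs_gt0.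
by rewrite subrK divfK.
Qed.

End Quotient.

(** * The limit and the expansion of the probability *)

Section Probability.
Context {R : realType}.
Notation x := (@xs R).

Lemma constK_gt0 : 0 < constK R. Proof. exact: expR_gt0. Qed.

Lemma series_lead : exists2 c : R, c != 0 &
  bigO 1 (fun n => distinct_series n / x n ^+ 3 - expR (constL R + 2^-1) * c) /\
  bigO 1 (fun n => forest_series n / x n ^+ 3 - constK R * c).
Proof.
have [w [c [_ c0 hw ht]]] := @tcat_asym R; exists c => //; split.
- have [C C0 hC] := @distinct_log_bound3 R.
  apply: tcat_multiple_lead hw ht _; rewrite addrC -distinct_const.
  exact: (hcomb_lead distinct_log0 distinct_log1 C0 hC).
- have [C C0 hC] := @forest_log_bound R 3.
  apply: tcat_multiple_lead hw ht _; rewrite -forest_const.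
  exact: (hcomb_lead forest_log0 forest_log1 C0 hC).
Qed.

Lemma dissimilar_prob_cvg : dissimilar_prob R @ \oo --> kappa R.
Proof.
have [c c0 [he hf]] := series_lead.
have ce := bigO_cvg0 he; have cf := bigO_cvg0 hf.
have Kc : constK R * c != 0 by rewrite mulf_neq0 // gt_eqF // constK_gt0.
have h (g : nat -> R) a : (fun n => g n - a) @ \oo --> 0 -> g @ \oo --> a.
  move=> hg; have hd : (fun n => g n - a + a) @ \oo --> 0 + a.
    by apply: cvgD => //; exact: cvg_cst.
  rewrite add0r in hd; apply: cvg_trans hd.
  by apply: near_eq_cvg; apply: nearW => n /=; rewrite subrK.
have e : kappa R = expR (constL R + 2^-1) * c * (constK R * c)^-1.
  by rewrite -mulf_div divff // mulr1.
rewrite e; apply: cvg_trans (cvgM (h _ _ ce) (cvgV Kc (h _ _ cf))).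
apply: near_eq_cvg; apply: filterS near_gt0 => n n0 /=.
have xM : x n ^+ 3 != 0 by rewrite expf_neq0 // gt_eqF // xs_gt0.
by rewrite dissimilar_prob_series -mulf_div divff ?mulr1 // invr_neq0.
Qed.

(** After division by n^(-3/2) the denominator has a nonzero limit and can be inverted; the period
    is that of the numerator. *)
Lemma dissimilar_prob_osc N : exists2 q, (0 < q)%N &
  osc true q N (dissimilar_prob R).
Proof.
have [c c0 [he hf]] := series_lead.
have Kc : constK R * c != 0 by rewrite mulf_neq0 // gt_eqF // constK_gt0.
have af : asym true 1 (fun n => forest_series n / x n ^+ 3).
  by move=> M; apply: osc_div => //; [exact: forest_series_asym | exact: bigO_mul_xs hf].
have [q q0 oe] := @distinct_series_osc R (N.+1 + 3).
exists q => //.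
have oe' := osc_div q0 oe (bigO_mul_xs he).
have of' := asym_dvd (dvd1n q) (asym_inv (ltn0Sn 0) Kc af hf) N.+1.
apply: osc_near (oscM q0 oe' of'); apply: filterS near_gt0 => n n0 /=.
have xM : x n ^+ 3 != 0 by rewrite expf_neq0 // gt_eqF // xs_gt0.
by rewrite dissimilar_prob_series -/(_ / _) -mulf_div divff ?mulr1 // invr_neq0.
Qed.

End Probability.

Section Expansion.
Context {R : realType}.
Implicit Types (f : nat -> R).
Notation x := (@xs R).

Lemma powR_half n r : n%:R `^ (2^-1 * r%:R) = x n ^- r.
Proof. by rewrite powRrM powR12_sqrt // powR_mulrn ?sqrtr_ge0 // exprVn invrK. Qed.

Lemma ev_take k m (p : {poly {poly R}}) n :
  ev k (take_poly m p) n = \sum_(i < m) (p`_i).[lam k n] * x n ^+ i.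
Proof.
rewrite /ev (horner_coef_wide _ (size_take_poly m p)) horner_sum.
apply: eq_bigr => i _; rewrite coef_take_poly ltn_ord.
by rewrite hornerM -rmorphXn /= hornerC.
Qed.

Lemma periodic_oscillating q (p : nat -> {poly R}) : (0 < q)%N -> periodic q p ->
  oscillating_log_poly (fun n => (p n).[ln n%:R]).
Proof.
move=> q0 hp; exists (\max_(i < q) size (p i)), (fun j n => (p n)`_j); split.
  by move=> j; exists q => // n; rewrite hp.
move=> n; apply: horner_coef_wide; apply: leqW; rewrite (periodic_mod n hp).
exact: (@leq_bigmax_cond _ xpredT (fun i : 'I_q => size (p i)) (Ordinal (ltn_pmod n q0))).
Qed.

Lemma osc_expansion f : (forall N, exists2 q, (0 < q)%N & osc true q N f) ->
  full_oscillating_expansion f.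
Proof.
move=> h.
have /choice[F hF] : forall N, exists F : nat * (nat -> {poly {poly R}}),
    [/\ (0 < F.1)%N, periodic F.1 F.2 &
        bigO N.+1 (fun n => f n - ev true (F.2 n) n)].
  by move=> N; have [q q0 [p hp hf]] := h N.+1; exists (q, p).
pose P r n := ((F r).2 n)`_r.
(* Expansions of different precisions have different periods; they are compared over the product of
   the two. *)
have coh N r n : (r <= N)%N -> ((F N).2 n)`_r = P r n.
  move=> rN; have [qN pN fN] := hF N; have [qr pr fr] := hF r.
  apply/eqP; rewrite -subr_eq0 -coefB; apply/eqP.
  apply: (@periodic_unique _ r.+1 ((F N).1 * (F r).1)
    (fun n => (F N).2 n - (F r).2 n)) => //.
  - by rewrite muln_gt0 qN.
  - by move=> m; rewrite (periodicM (F N).1 pr) mulnC (periodicM (F r).1 pN).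
  - apply: bigO_near (bigOB fr (bigO_le (_ : r < N.+1)%N fN)) => //.
    by apply: nearW => m; rewrite evB; ring.
exists (fun r => 2^-1 * r%:R), (fun r n => (P r n).[ln n%:R]); split.
- by move=> r s rs; rewrite ltr_pM2l ?invr_gt0 // ltr_nat.
- apply/cvgryPge => A; near=> r; rewrite mulrC ler_pdivlMr //.
  by near: r; exact: nbhs_infty_ger.
- move=> r; have [q0 hp _] := hF r.
  by apply: (@periodic_oscillating (F r).1) => // n; rewrite /P hp.
move=> N; have [q0 hp hf] := hF N; apply/eqoP => e e0.
have e2 : 0 < e / 2 by rewrite divr_gt0.
have [C C0 hC] := bigO_pos hf.
have hd : periodic (F N).1 (fun n => drop_poly N.+1 ((F N).2 n)).
  by move=> n; rewrite hp.
(* The terms beyond index N may carry logarithms, yet they are o(n^(-N/2)). *)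
have /cvgrPdist_le/(_ _ e2) hx := x_ev_cvg0 q0 hd.
near=> n.
have hn : `|f n - ev true ((F N).2 n) n| <= C * x n ^+ N.+1 by near: n.
have hxn : `|x n * ev true (drop_poly N.+1 ((F N).2 n)) n| <= e / 2.
  by rewrite -normrN -sub0r; near: n.
have hCx : C * x n <= e / 2.
  by rewrite mulrC -ler_pdivlMr //; near: n; apply: near_xs_le; exact: divr_gt0.
rewrite powRN powR_half invrK.
have -> : \sum_(r < N.+1) (P r n).[ln n%:R] / n%:R `^ (2^-1 * r%:R) =
    ev true (take_poly N.+1 ((F N).2 n)) n.
  rewrite ev_take; apply: eq_bigr => r _.
  by rewrite powR_half invrK coh // -ltnS.
have eN : ev true ((F N).2 n) n = ev true (take_poly N.+1 ((F N).2 n)) n +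
    x n ^+ N * (x n * ev true (drop_poly N.+1 ((F N).2 n)) n).
  rewrite -{1}(poly_take_drop N.+1 ((F N).2 n)) evD evM; congr (_ + _).
  by rewrite mulrA -exprSr mulrC /ev !hornerE.
rewrite (_ : f n - _ = (f n - ev true ((F N).2 n) n) +
  x n ^+ N * (x n * ev true (drop_poly N.+1 ((F N).2 n)) n)); last by rewrite eN; ring.
rewrite (ger0_norm (xsX_ge0 n N)) (le_trans (ler_normD _ _)) //.
rewrite [leRHS](_ : _ = x n ^+ N * (e / 2) + x n ^+ N * (e / 2)); last by field.
apply: lerD.
  by rewrite (le_trans hn) // exprSr mulrCA ler_wpM2l // xsX_ge0.
by rewrite normrM (ger0_norm (xsX_ge0 n N)) ler_wpM2l // xsX_ge0.
Unshelve. all: by end_near. Qed.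

End Expansion.

Lemma kappa_gt0 (R : realType) : 0 < kappa R.
Proof. by rewrite divr_gt0 // expR_gt0. Qed.

Theorem proposition6 (R : realType) :
  (dissimilar_prob R : nat -> R^o) ~_\oo (cst (kappa R) : nat -> R^o) /\
  full_oscillating_expansion (dissimilar_prob R).
Proof.
split; last exact: osc_expansion dissimilar_prob_osc.
apply/eqaddoP => e e0.
have /cvgrPdist_le h := @dissimilar_prob_cvg R.
have := h _ (mulr_gt0 e0 (kappa_gt0 R)); apply: filterS => n.
by rewrite distrC [in X in _ -> X](gtr0_norm (kappa_gt0 R)).
Qed.
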